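(* Let $p\in(0,1)$ be a constant and let $k=O(1)$. Let $H$ be a $k$-clique cover on $n$ vertices, i.e. the vertex-disjoint union of $n/k$ copies of the complete graph $K_k$. Then there exists a fully polynomial time randomized approximation scheme (fpras) for estimating the number of copies of $H$ in a random graph $G\in\mathcal{G}(n,p)$.
   Context: $\mathcal{G}(n,p)$ denotes the Erdős–Rényi random graph on a fixed set of $n$ vertices in which each of the $\binom{n}{2}$ possible edges is present independently with probability $p$; $n$ is assumed divisible by $k$. The number of copies of $H$ in $G$ is the number of partitions of $V(G)$ into $n/k$ sets of size $k$ each inducing a complete graph in $G$. An fpras for this counting problem (in the random-graph sense used here) is a randomized algorithm that, given a graph $G$ on $n$ vertices and $\varepsilon>0$, runs in time polynomial in $n$ and $\varepsilon^{-1}$ and, for graphs $G$ sampled from $\mathcal{G}(n,p)$, returns an answer within relative error $(1\pm\varepsilon)$ of the true count with high probability (probability tending to $1$ as $n\to\infty$). *)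

(* Defs.v *)
From HB Require Import structures.
From mathcomp Require Import all_boot all_order all_algebra.
From mathcomp Require Import all_classical all_reals all_analysis.

Set Implicit Arguments.
Unset Strict Implicit.
Unset Printing Implicit Defensive.

Import Order.TTheory GRing.Theory Num.Theory.
Import numFieldNormedType.Exports.

Local Open Scope ring_scope.

(** * Graphs on the vertex set 'I_n *)

(* A simple graph is given by its edge set, a subset of [pairs n]. *)
Definition pairs (n : nat) : {set {set 'I_n}} := [set e : {set 'I_n} | #|e| == 2].

Definition clique (n : nat) (G : {set {set 'I_n}}) (B : {set 'I_n}) : bool :=
  [forall u in B, forall v in B, (u != v) ==> ([set u; v] \in G)].

Definition clique_cover (k n : nat) (G : {set {set 'I_n}})
    (P : {set {set 'I_n}}) : bool :=
  [&& finset.partition P [set: 'I_n], #|P| == (n %/ k)%N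
    & [forall B in P, (#|B| == k) && clique G B]].

Definition num_clique_covers (k n : nat) (G : {set {set 'I_n}}) : nat :=
  #|[set P : {set {set 'I_n}} | clique_cover k G P]|.

(* The probability of the graph G under G(n,p). *)
Definition gnp (R : realType) (p : R) (n : nat) (G : {set {set 'I_n}}) : R :=
  \prod_(e in pairs n) (if e \in G then p else 1 - p).

(** * Randomized algorithms

   A structured random access machine over unbounded natural numbers.  The
   memory is a family of arrays; a program names arrays by constants and indexes
   them by computed values, and a scalar variable is the cell 0 of an array.
   The arithmetic is addition and truncated subtraction only: numbers then grow
   by O(1) bits per step, so that counting every instruction as one unit of time
   is polynomially equivalent to time on a probabilistic Turing machine.
   A unit-cost multiplication would break this equivalence. *)

Definition memory := nat -> nat -> nat.

Inductive expr : Type :=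
  | Const of nat
  | Cell of nat & expr
  | Add of expr & expr
  | Sub of expr & expr.

(* [If] and [While] take a nonzero value as true. *)
Inductive prog : Type :=
  | Skip
  | Store of nat & expr & expr
  | Flip of nat & expr
  | Seq of prog & prog
  | If of expr & prog & prog
  | While of expr & prog.

Fixpoint eval (M : memory) (e : expr) : nat :=
  match e with
  | Const c => c
  | Cell a e1 => M a (eval M e1)
  | Add e1 e2 => (eval M e1 + eval M e2)%N
  | Sub e1 e2 => (eval M e1 - eval M e2)%N
  end.

Definition update (M : memory) (a i x : nat) : memory :=
  fun b j => if (b == a) && (j == i) then x else M b j.

(* The commands still to be executed, the memory, and the coin tosses to come. *)
Definition config := (seq prog * memory * seq bool)%type.

Definition step (c : config) : config :=
  let: (s, M, w) := c in
  match s with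
  | [::] => c
  | Skip :: s' => (s', M, w)
  | Store a i e :: s' => (s', update M a (eval M i) (eval M e), w)
  | Flip a i :: s' => (s', update M a (eval M i) (head false w), behead w)
  | Seq A B :: s' => (A :: B :: s', M, w)
  | If e A B :: s' => ((if eval M e != 0%N then A else B) :: s', M, w)
  | While e A :: s' =>
      (if eval M e != 0%N then A :: While e A :: s' else s', M, w)
  end.

Definition run (A : prog) (M : memory) (w : seq bool) (t : nat) : config :=
  iter t step ([:: A], M, w).

Definition halted (c : config) : bool := nilp c.1.1.

(* The answer is the rational number written in the cells 0 and 1 of array 0. *)
Definition answer (R : realType) (c : config) : R :=
  (c.1.2 0%N 0%N)%:R / (c.1.2 0%N 1%N)%:R.

(* Array 0 holds the numbers n, k, m; array 1 holds the adjacency matrix of G,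
   row by row. *)
Definition input (k m n : nat) (G : {set {set 'I_n}}) : memory :=
  fun a i =>
    match a with
    | 0 => nth 0%N [:: n; k; m] i
    | 1 => nat_of_bool [exists u : 'I_n, exists v : 'I_n,
                          (i == n * u + v)%N && ([set u; v] \in G)]
    | _ => 0%N
    end.

(** * Approximation schemes on random graphs *)

(* A real accuracy eps > 0 is handed to the machine as this integer m, so that
   1/m <= eps and m < 1/eps + 1. *)
Definition accuracy (R : realType) (eps : R) : nat := `|Num.ceil eps^-1|%N.

(* Probability, over G drawn from G(n,p) and t independent fair coin tosses,
   that within t steps A gives an answer within relative error eps of X G.
   A step tosses at most one coin, so t tosses suffice for t steps. *)
Definition success_prob (R : realType) (p : R) (A : prog) (t k n : nat)
    (eps : R) (X : {set {set 'I_n}} -> nat) : R :=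
  \sum_(G in powerset (pairs n)) gnp p G *
    (#|[set w : t.-tuple bool |
         let c := run A (input k (accuracy eps) G) w t in
         halted c && (`|answer R c - (X G)%:R| <= eps * (X G)%:R)]|%:R
     / 2 ^+ t).

(* A is an fpras on G(n,p) for the counts X k n, where the parameter k <= K is
   part of the input and n is a multiple of k: on every graph and for all coin
   tosses A halts within C (n + m)^d steps, m = accuracy eps, and it errs with
   probability at most delta n --> 0, uniformly in eps and k. *)
Definition fpras (R : realType) (p : R) (K : nat)
    (X : forall k n : nat, {set {set 'I_n}} -> nat) (A : prog) : Prop :=
  exists (C d : nat) (delta : nat -> R),
    (delta n @[n --> \oo] --> (0 : R))%classic /\
    forall (k n : nat) (eps : R),
      (0 < k <= K)%N -> (k %| n)%N -> 0 < eps ->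
      let t := (C * (n + accuracy eps) ^ d)%N in
      (forall (G : {set {set 'I_n}}) (w : t.-tuple bool), G \subset pairs n ->
         halted (run A (input k (accuracy eps) G) w t)) /\
      1 - delta n <= success_prob p A t k eps (@X k n).

(* Main.v *)
(* Proof idea.  Write n = k N.  Take the vertices in a uniformly random order and
   cut the order into k columns of length N; a vertex of column c joins, uniformly
   at random, one of the N rows that have no vertex of column c yet and whose c
   members are all adjacent to it.  The product X of the numbers of choices is an
   unbiased estimate of the number of clique covers, up to an explicit factor
   (Knuth, Rasmussen).  The edges inspected at a step are fresh, so the number of
   choices for a row is binomial with parameters N - a and p^c, and
   E X^2 <= poly(n) (E X)^2 on average over the graph.

   It remains to see that with high probability the count Z of leaves of the
   search tree is not much smaller than its mean.  Give the leaves the weights w of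
   the same random process, except that the last l vertices of each column are
   placed by a uniformly random completion.  Then (sum w)^2 <= Z (sum w^2) by
   Cauchy-Schwarz.  Here sum w <= 1 is the probability that the process survives;
   its mean tends to 1 as l grows, by Hall's theorem for an l x l random bipartite
   graph.  The mean of sum w^2 is a product of inverse moments of binomials, hence
   at most l!^k poly(n) / E Z, and l is chosen with l! <= N.

   So on a typical graph poly(n) / eps^2 independent trials suffice, by Chebyshev.
   The machine has only fair coins: it picks from r candidates with u mod r, for u
   uniform in [0, 2^b), which biases X by a factor in (1 +- n/2^b)^(2n) only. *)
Require Import Defs.
From HB Require Import structures.
From mathcomp Require Import all_boot all_order all_algebra.
From mathcomp Require Import all_fingroup.
From mathcomp Require Import all_classical all_reals all_analysis.
From mathcomp Require Import zify ring lra.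
From mathcomp Require Import fintype finset.
Import Defs.

Set Implicit Arguments.
Unset Strict Implicit.
Unset Printing Implicit Defensive.

Import Order.TTheory GRing.Theory Num.Theory.
Import numFieldNormedType.Exports.

Local Open Scope ring_scope.

(** * Big-step execution of programs *)

(** A direct second moment of the number of leaves would require comparing pairs of clique covers.
    The weights avoid this: their total never exceeds 1 and has mean near 1, so Markov's inequality
    alone keeps it above 1/2 with high probability, and the sum of squares involves one leaf at a
    time. The weights occur in the analysis only; the program never computes them. Every mean
    becomes explicit by an exchange: a complete leaf is fixed before the graph is drawn, that is,
    the vertex treated at each step and the row it joins. For a fixed leaf the edge sets that decide
    whether a step may use a row are pairwise disjoint. So column c, counted from 0, sees an N x N
    random bipartite graph of density p^c, independent of the other columns, and all means
    factorise. The last l steps of a column need their own treatment because only few rows are then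
    free and the process gets stuck with a probability bounded away from 0; a uniform completion
    fails only if no completion exists. Its price is a factor l! per column in the mean of the
    squared weights, so l must grow slowly. *)

Inductive bigstep : prog -> memory -> seq bool -> memory -> seq bool -> nat -> Prop :=
  | BSkip M w : bigstep Skip M w M w 1
  | BStore a i e M w :
      bigstep (Store a i e) M w (update M a (eval M i) (eval M e)) w 1
  | BFlip a i M w :
      bigstep (Flip a i) M w (update M a (eval M i) (head false w)) (behead w) 1
  | BSeq A B M w M1 w1 M2 w2 t1 t2 :
      bigstep A M w M1 w1 t1 -> bigstep B M1 w1 M2 w2 t2 ->
      bigstep (Seq A B) M w M2 w2 (t1 + t2).+1
  | BIf e A B M w M1 w1 t :
      bigstep (if eval M e != 0%N then A else B) M w M1 w1 t ->
      bigstep (If e A B) M w M1 w1 t.+1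
  | BWhileF e A M w : eval M e = 0%N -> bigstep (While e A) M w M w 1
  | BWhileT e A M w M1 w1 M2 w2 t1 t2 : eval M e != 0%N ->
      bigstep A M w M1 w1 t1 -> bigstep (While e A) M1 w1 M2 w2 t2 ->
      bigstep (While e A) M w M2 w2 (t1 + t2).+1.

(** The arbitrary continuation [s] below the executed command lets the induction pass through [Seq]
    and [While], which push commands on the stack. *)
Lemma bigstep_iter A M w M1 w1 t : bigstep A M w M1 w1 t ->
  forall s, iter t step (A :: s, M, w) = (s, M1, w1).
Proof.
elim=> {A M w M1 w1 t}.
- by [].
- by [].
- by [].
- move=> A B M w M1 w1 M2 w2 t1 t2 _ IHA _ IHB s.
  by rewrite iterSr addnC iterD /= IHA IHB.
- by move=> e A B M w M1 w1 t _ IH s; rewrite iterSr /= IH.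
- by move=> e A M w e0 s; rewrite /= e0.
- move=> e A M w M1 w1 M2 w2 t1 t2 e0 _ IHA _ IHW s.
  by rewrite iterSr addnC iterD /= e0 IHA IHW.
Qed.

(** A halted configuration is a fixed point of [step], so an upper bound may replace the exact
    time. *)
Lemma run_bigstep A M w M1 w1 t t' : bigstep A M w M1 w1 t -> (t <= t')%N ->
  run A M w t' = ([::], M1, w1).
Proof.
move=> /bigstep_iter/(_ [::]) H /subnK <-; rewrite /run iterD H.
by elim: (t' - t)%N => //= j ->.
Qed.

Fixpoint writes (A : prog) : seq nat :=
  match A with
  | Skip => [::]
  | Store a _ _ => [:: a]
  | Flip a _ => [:: a]
  | Seq A B => writes A ++ writes B
  | If _ A B => writes A ++ writes B
  | While _ A => writes A
  end.

(** Programs name arrays by constants but compute indices, so the frame is kept by whole arrays and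
    can be read off the syntax. *)
Definition agree_off (W : seq nat) (M M' : memory) : Prop :=
  forall a, a \notin W -> M' a = M a.

Lemma updateE M a i x : update M a i x a i = x.
Proof. by rewrite /update !eqxx. Qed.

Lemma update_other M a i x b : b != a -> update M a i x b = M b.
Proof. by move=> /negPf ba; apply: functional_extensionality_dep => j; rewrite /update ba. Qed.

Lemma bigstep_frame A M w M1 w1 t : bigstep A M w M1 w1 t -> agree_off (writes A) M M1.
Proof.
elim=> {A M w M1 w1 t} //=.
- by move=> a i e M w b; rewrite inE => ba; apply: update_other.
- by move=> a i M w b; rewrite inE => ba; apply: update_other.
- move=> A B M w M1 w1 M2 w2 t1 t2 _ IHA _ IHB b.
  by rewrite mem_cat negb_or => /andP[bA bB]; rewrite IHB // IHA.
- move=> e A B M w M1 w1 t _ IH b; rewrite mem_cat negb_or => /andP[bA bB].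
  by apply: IH; case: ifP.
- by move=> e A M w M1 w1 M2 w2 t1 t2 e0 _ IHA _ IHW b bA; rewrite IHW // IHA.
Qed.

Definition runs (A : prog) (M : memory) (w : seq bool) (T : nat)
    (Q : memory -> seq bool -> Prop) : Prop :=
  exists M1 w1 t, [/\ bigstep A M w M1 w1 t, (t <= T)%N & Q M1 w1].

Lemma runs_weaken A M w T T' (Q Q' : memory -> seq bool -> Prop) :
  runs A M w T Q -> (T <= T')%N ->
  (forall M1 w1, agree_off (writes A) M M1 -> Q M1 w1 -> Q' M1 w1) -> runs A M w T' Q'.
Proof.
move=> [M1 [w1 [t [H tT q]]]] TT' QQ; exists M1, w1, t; split=> //.
  exact: leq_trans TT'.
exact: QQ (bigstep_frame H) q.
Qed.

Lemma runs_skip M w (Q : memory -> seq bool -> Prop) : Q M w -> runs Skip M w 1 Q.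
Proof. by move=> q; exists M, w, 1%N; split=> //; constructor. Qed.

Lemma runs_store a i e M w (Q : memory -> seq bool -> Prop) :
  Q (update M a (eval M i) (eval M e)) w -> runs (Store a i e) M w 1 Q.
Proof. by move=> q; do 3 eexists; split; [constructor| |exact: q]. Qed.

Lemma runs_flip a i M w (Q : memory -> seq bool -> Prop) :
  Q (update M a (eval M i) (head false w)) (behead w) -> runs (Flip a i) M w 1 Q.
Proof. by move=> q; do 3 eexists; split; [constructor| |exact: q]. Qed.

Lemma runs_seq A B M w T1 T2 T (Q : memory -> seq bool -> Prop) (Q1 : memory -> seq bool -> Prop) :
  runs A M w T1 Q1 -> (T1 + T2 < T)%N ->
  (forall M1 w1, agree_off (writes A) M M1 -> Q1 M1 w1 -> runs B M1 w1 T2 Q) ->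
  runs (Seq A B) M w T Q.
Proof.
move=> [M1 [w1 [t1 [H1 le1 q1]]]] le QB.
have [M2 [w2 [t2 [H2 le2 q2]]]] := QB _ _ (bigstep_frame H1) q1.
exists M2, w2, (t1 + t2).+1; split=> //; first exact: BSeq H1 H2.
by apply: leq_trans le; rewrite ltnS leq_add.
Qed.

Lemma runs_if e A B M w T (Q : memory -> seq bool -> Prop) :
  (eval M e != 0%N -> runs A M w T Q) -> (eval M e = 0%N -> runs B M w T Q) ->
  runs (If e A B) M w T.+1 Q.
Proof.
move=> HA HB; suff [M1 [w1 [t [H le q]]]] :
    runs (if eval M e != 0%N then A else B) M w T Q.
  by exists M1, w1, t.+1; split=> //; constructor.
by case: (eqVneq (eval M e) 0%N) => [/HB|/HA].
Qed.

(* The body sees the counter run downwards from [e - 1] to [0]. *)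
Definition For (c : nat) (e : expr) (A : prog) : prog :=
  Seq (Store c (Const 0) e)
    (While (Cell c (Const 0))
      (Seq (Store c (Const 0) (Sub (Cell c (Const 0)) (Const 1))) A)).

(** [Inv i] describes the state with [i] rounds left. The loop writes its own counter, hence the
    required stability of [Inv] under changes of array [c]. A round costs [Tb] plus 3 for the test,
    the [Seq] and the decrement; the final 3 are the outer [Seq], the initialisation and the last
    test. *)
Lemma runs_for c e A M w B Tb T (Inv : nat -> memory -> seq bool -> Prop) :
  c \notin writes A -> eval M e = B ->
  (forall M1, agree_off [:: c] M M1 -> Inv B M1 w) ->
  (forall i M1 w1, (i < B)%N -> agree_off (c :: writes A) M M1 -> M1 c 0%N = i ->
     Inv i.+1 M1 w1 -> runs A M1 w1 Tb (Inv i)) ->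
  (forall i M1 M2 w1, agree_off [:: c] M1 M2 -> Inv i M1 w1 -> Inv i M2 w1) ->
  (B * (Tb + 3) + 3 <= T)%N ->
  runs (For c e A) M w T (Inv 0%N).
Proof.
move=> cA eB Inv0 body Invc leT.
suff loop : forall i M1 w1, (i <= B)%N -> agree_off (c :: writes A) M M1 -> M1 c 0%N = i ->
    Inv i M1 w1 -> runs (While (Cell c (Const 0))
      (Seq (Store c (Const 0) (Sub (Cell c (Const 0)) (Const 1))) A)) M1 w1
      (i * (Tb + 3) + 1) (Inv 0%N).
  apply: (runs_seq (T2 := (B * (Tb + 3) + 1)%N) (Q1 := fun M1 w1 => w1 = w /\ M1 c 0%N = B /\ Inv B M1 w)).
  - apply: runs_store; split=> //=; rewrite updateE eB; split=> //.
    by apply: Inv0 => a; rewrite inE => ac; apply: update_other.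
  - by move: leT; lia.
  - move=> M1 w1 ag [-> [cB Inv1]]; apply: loop => // a; rewrite inE negb_or => /andP[ac _].
    by apply: ag; rewrite inE.
elim=> [|i IH] M1 w1 iB ag ci Invi.
  by exists M1, w1, 1%N; split=> //; constructor; rewrite /= ci.
pose M2 := update M1 c 0 i.
have ag2 : agree_off [:: c] M1 M2 by move=> a; rewrite inE => ac; apply: update_other.
have ag3 : agree_off (c :: writes A) M M2.
  move=> a acA; rewrite ag2 ?ag //; by move: acA; rewrite !inE negb_or => /andP[].
have [M3 [w3 [t3 [H3 le3 q3]]]] := body i M2 w1 iB ag3 (updateE _ _ _ _) (Invc _ _ _ _ ag2 Invi).
have ag4 : agree_off (c :: writes A) M M3.
  move=> a acA; rewrite (bigstep_frame H3) ?ag3 //; by move: acA; rewrite !inE negb_or => /andP[].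
have c3 : M3 c 0%N = i by rewrite (bigstep_frame H3) // /M2 updateE.
have [M4 [w4 [t4 [H4 le4 q4]]]] := IH M3 w3 (ltnW iB) ag4 c3 q3.
exists M4, w4, (((1 + t3).+1 + t4).+1); split=> //.
  apply: BWhileT H4; first by rewrite /= ci.
  apply: BSeq H3; rewrite /M2; have -> : i = eval M1 (Sub (Cell c (Const 0)) (Const 1)).
    by rewrite /= ci; lia.
  exact: BStore.
rewrite mulSn; lia.
Qed.

Local Open Scope nat_scope.

Lemma update_same M a i x j : update M a i x a j = if j == i then x else M a j.
Proof. by rewrite /update eqxx. Qed.

(** * The program *)

(* Besides 0 and 1 (the input), the program uses the arrays
    2 the number of rows,            3 the lower bound on the range 2^b of a draw,
    4 the number of trials,          5 the denominator of the answer,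
    6 the sum of the trials,         7 the current product X,
    8 the number of steps done,      9 the start of the current column,
   10 the vertices chosen,          11 their rows,
   12 their offsets in array 1,     13 the flags of the admissible candidates,
   14 the list of these candidates, 15 its length,
   16 the number drawn,             17 the range of the draw,
   18 the candidate picked,
   19 and 20 for temporary results, and 21 to 29 as loop counters. *)
Definition var (x : nat) : expr := Cell x (Const 0).

Definition assign (x : nat) (e : expr) : prog := Store x (Const 0) e.

(** Repeated addition takes time linear in the multiplier [e], whereas the cell [y] may hold an
    exponentially large number. *)
Definition Mult (y : nat) (e : expr) : prog :=
  Seq (assign 20 (Const 0))
    (Seq (For 21 e (assign 20 (Add (var 20) (var y)))) (assign y (var 20))).

Lemma runs_mult y e M w x : y \notin [:: 20; 21] -> eval (update M 20 0 0) e = x ->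
  runs (Mult y e) M w (x * 4 + 8) (fun M1 w1 => w1 = w /\ M1 y 0%N = (x * M y 0)%N).
Proof.
rewrite !inE negb_or => /andP[y20 y21] ex.
apply: (runs_seq (T2 := x * 4 + 5) (Q1 := fun M1 w1 => w1 = w /\ M1 = update M 20 0 0)).
- by apply: runs_store; split.
- by lia.
move=> M1 w1 _ [-> ->] {M1 w1}; set M1 := update _ _ _ _.
apply: (runs_seq (T2 := 1) (Q1 := fun M2 w2 => w2 = w /\ M2 20 0%N = (x * M1 y 0%N)%N)).
- apply: (@runs_weaken _ _ _ _ _ (fun M2 w2 => w2 = w /\ M2 20 0%N = ((x - 0) * M1 y 0%N)%N) _ _ (leqnn (x * (1 + 3) + 3))%N);
    last by move=> M2 w2 _ [-> ->]; rewrite subn0.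
  apply: (runs_for (Tb := 1) (Inv := fun i M2 w2 => w2 = w /\ M2 20 0%N = ((x - i) * M1 y 0%N)%N)).
  + by [].
  + exact: ex.
  + by move=> M2 ag; rewrite ag // /M1 updateE subnn.
  + move=> i M2 w2 ix ag ci [-> M2E]; apply: runs_store; split=> //.
    rewrite updateE /= M2E (ag y) ?inE ?negb_or ?y20 ?y21 //.
    by rewrite -{2}(mul1n (M1 y 0%N)) -mulnDl; congr (_ * _)%N; lia.
  + by move=> i M2 M3 w2 ag [-> M2E]; split=> //; rewrite ag.
  + by [].
- by lia.
move=> M2 w2 ag [-> M2E]; apply: runs_store; split=> //.
by rewrite updateE /= M2E /M1 update_other.
Qed.

(** The loop counter runs downwards, so the candidates are listed in decreasing order; this is where
    [rev (iota 0 B)] comes from. *)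
Definition Listing (B : expr) : prog :=
  Seq (assign 15 (Const 0))
    (For 22 B (If (Cell 13 (var 22))
                  (Seq (Store 14 (var 15) (var 22)) (assign 15 (Add (var 15) (Const 1))))
                  Skip)).

Definition Draw : prog :=
  Seq (assign 17 (Const 1)) (Seq (assign 16 (Const 0))
    (For 23 (var 3) (If (Sub (var 3) (var 17))
                        (Seq (Flip 20 (Const 0))
                        (Seq (assign 16 (Add (Add (var 16) (var 16)) (var 20)))
                             (assign 17 (Add (var 17) (var 17)))))
                        Skip))).

Definition Modulo : prog :=
  For 24 (var 16) (If (Sub (Add (var 16) (Const 1)) (var 15))
                      (assign 16 (Sub (var 16) (var 15)))
                      Skip).

Definition Choose (B : expr) : prog :=
  Seq (Listing B) (Seq Draw (Seq Modulo
    (Seq (If (var 15) (assign 18 (Cell 14 (var 16))) (assign 18 (Const 0)))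
         (Mult 7 (var 15))))).

Fixpoint draw (b : nat) (w : seq bool) : nat :=
  if b is b'.+1 then (draw b' w + draw b' w + nth false w b')%N else 0%N.

(** On the empty list the pick is the dummy 0. It does no harm, since the product is multiplied by
    [size s = 0] at the same moment. *)
Definition pick_nth (s : seq nat) (u : nat) : nat := nth 0%N s (u %% size s).

Lemma draw_lt b w : (draw b w < 2 ^ b)%N.
Proof. by elim: b => //= b IH; rewrite expnS; case: nth => /=; lia. Qed.

Lemma runs_listing B e M w : eval (update M 15 0 0) e = B ->
  runs (Listing e) M w (B * 8 + 6)
   (fun M1 w1 => let s := [seq i <- rev (iota 0 B) | M 13%N i != 0%N] in
      [/\ w1 = w, M1 15%N 0%N = size s & forall j, (j < size s)%N -> M1 14%N j = nth 0%N s j]).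
Proof.
move=> eB.
apply: (runs_seq (T2 := B * 8 + 4) (Q1 := fun M1 w1 => w1 = w /\ M1 = update M 15 0 0)).
- by apply: runs_store; split.
- by lia.
move=> M1 w1 _ [-> ->] {M1 w1}; set M1 := update _ _ _ _.
pose s k := [seq i <- rev (iota k (B - k)) | M 13%N i != 0%N].
apply: (@runs_weaken _ _ _ _ _ (fun M2 w2 => [/\ w2 = w, M2 15%N 0%N = size (s 0%N) &
   forall j, (j < size (s 0%N))%N -> M2 14%N j = nth 0%N (s 0%N) j]) _ _ (leqnn (B * 8 + 4))%N); last first.
  by rewrite /s subn0.
apply: (runs_for (Tb := 5) (Inv := fun k M2 w2 => [/\ w2 = w, M2 15%N 0%N = size (s k) &
   forall j, (j < size (s k))%N -> M2 14%N j = nth 0%N (s k) j])).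
- by [].
- exact: eB.
- move=> M2 ag; rewrite /s subnn /=; split=> //.
  by rewrite ag // updateE.
- move=> k M2 w2 kB ag ck [-> cE lE].
  have sS : s k = if M 13%N k != 0%N then rcons (s k.+1) k else s k.+1.
    rewrite /s (_ : (B - k = (B - k.+1).+1)%N); last by lia.
    by rewrite /= rev_cons filter_rcons.
  have F13 : M2 13%N = M 13%N by rewrite ag // /M1 update_other.
  apply: (runs_if (T := 4)); rewrite /= ck F13 => Fk; last first.
    apply: (runs_weaken (T := 1) (runs_skip (Q := fun M3 w3 => M3 = M2 /\ w3 = w) _)) => //.
    by move=> M3 w3 _ [-> ->]; rewrite sS Fk.
  apply: (runs_seq (T2 := 1) (Q1 := fun M3 w3 => w3 = w /\ M3 = update M2 14 (size (s k.+1)) k)).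
  + by apply: runs_store; rewrite /= cE ck.
  + by [].
  move=> M3 w3 _ [-> ->]; apply: runs_store; rewrite sS Fk; split=> //.
    by rewrite updateE /= update_other // cE size_rcons addn1.
  move=> j; rewrite size_rcons ltnS update_other // update_same nth_rcons => js.
  by case: eqP => [->|jn]; [rewrite ltnn | rewrite ltn_neqAle js andbT; case: eqP => // _; apply: lE; lia].
- by move=> k M2 M3 w2 ag [-> cE lE]; split=> //; [rewrite ag|move=> j js; rewrite ag // lE].
- by lia.
Qed.

Lemma runs_draw M w : let b := up_log 2 (M 3%N 0%N) in
  runs Draw M w (M 3%N 0%N * 11 + 9)
   (fun M1 w1 => w1 = drop b w /\ M1 16%N 0%N = draw b w).
Proof.
move=> b; set q := M 3%N 0%N.
have bq : (b <= q)%N by apply: up_log_min => //; apply/ltnW/ltn_expl.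
apply: (runs_seq (T2 := q * 11 + 7) (Q1 := fun M1 w1 => w1 = w /\ M1 = update M 17 0 1)).
- by apply: runs_store; split.
- by lia.
move=> M1 w1 _ [-> ->] {M1 w1}.
apply: (runs_seq (T2 := q * 11 + 4) (Q1 := fun M1 w1 => w1 = w /\ M1 = update (update M 17 0 1) 16 0 0)).
- by apply: runs_store; split.
- by lia.
move=> M1 w1 _ [-> ->] {M1 w1}; set M1 := update _ _ _ _.
(* [f] coins have been tossed: one in each round so far, until the range [2 ^ f] reaches [q]. As
   [b <= q], the [q] rounds suffice. *)
pose Inv i (M2 : memory) w2 := exists f, [/\ (f <= b)%N, (q - i <= f)%N \/ f = b,
   M2 17%N 0%N = (2 ^ f)%N, M2 16%N 0%N = draw f w & w2 = drop f w].
apply: (@runs_weaken _ _ _ _ _ (Inv 0%N) _ _ (leqnn _)); last first.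
  move=> M2 w2 _ [f [fb fq _ -> ->]]; have -> // : f = b.
  by case: fq => //; rewrite subn0 => qf; apply/eqP; rewrite eqn_leq fb (leq_trans bq).
apply: (runs_for (B := q) (Tb := 8) (Inv := Inv)).
- by [].
- by [].
- move=> M2 ag; exists 0%N; rewrite subnn drop0; split=> //; first by left.
    by rewrite ag // /M1 update_other // updateE.
  by rewrite ag // updateE.
- move=> i M2 w2 iq ag ci [f [fb fq E17 E16 ->]].
  have E3 : M2 3%N 0%N = q by rewrite ag.
  have fbE : (q - 2 ^ f != 0)%N = (f < b)%N.
    rewrite subn_eq0 -ltnNge; apply/idP/idP => [lt|lt].
      by rewrite ltnNge; apply/negP => bf; move: lt; rewrite ltnNge (leq_trans (up_logP q (ltnSn 1))) // leq_exp2l.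
    by rewrite ltnNge; apply/negP => le; move: lt; rewrite ltnNge up_log_min.
  apply: (runs_if (T := 7)); rewrite /= E17 E3 => c; last first.
    have {}c : f = b by apply/eqP; rewrite eqn_leq fb leqNgt -fbE c.
    apply: (runs_weaken (T := 1) (runs_skip (Q := fun M3 w3 => M3 = M2 /\ w3 = drop f w) _)) => //.
    by move=> M3 w3 _ [-> ->]; exists f; split=> //; right.
  have {}c : (f < b)%N by rewrite -fbE.
  apply: (runs_seq (T2 := 4) (Q1 := fun M3 w3 => w3 = drop f.+1 w /\ M3 = update M2 20 0 (nth false w f))).
  + by apply: runs_flip; rewrite /= -nth0 nth_drop addn0 -drop1 drop_drop add1n.
  + by [].
  move=> M3 w3 _ [-> ->] {M3 w3}.
  apply: (runs_seq (T2 := 1) (Q1 := fun M3 w3 => w3 = drop f.+1 w /\ M3 17%N 0%N = (2 ^ f)%N /\ M3 16%N 0%N = draw f.+1 w)).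
  + apply: runs_store; split=> //; rewrite updateE !update_other //; split=> //.
    by rewrite /= updateE !update_other // E16.
  + by [].
  move=> M3 w3 _ [-> [E17' E16']]; apply: runs_store; exists f.+1; split=> //.
  + by case: fq => fq; [left; lia | move: c; rewrite fq ltnn].
  + by rewrite updateE /= E17' expnS mul2n addnn.
- move=> i M2 M3 w2 ag [f [fb fq E17 E16 ->]]; exists f; split=> //; by rewrite ag.
- by lia.
Qed.

(** Each effective subtraction lowers the number by at least 1, so [u] rounds bring it below a
    positive [r]. For [r = 0] nothing changes, in accordance with [u %% 0 = u]. *)
Lemma runs_modulo M w : let u := M 16%N 0%N in let r := M 15%N 0%N in
  runs Modulo M w (u * 5 + 3)
   (fun M1 w1 => w1 = w /\ M1 16%N 0%N = (u %% r)%N).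
Proof.
move=> u r; pose Inv i (M1 : memory) (w1 : seq bool) := [/\ w1 = w, (M1 16%N 0%N %% r = u %% r)%N &
   (r == 0)%N || (M1 16%N 0%N <= maxn i r.-1)%N].
apply: (@runs_weaken _ _ _ _ _ (Inv 0%N) _ _ (leqnn _)); last first.
  move=> M1 w1 _ [-> mE le]; split=> //; rewrite -mE.
  case: (posnP r) mE le => [->|r0]; first by rewrite !modn0 .
  by move=> _ /= le; rewrite modn_small //; lia.
apply: (runs_for (B := u) (Tb := 2) (Inv := Inv)).
- by [].
- by [].
- by move=> M1 ag; split=> //; rewrite ag // ?leq_maxl ?orbT.
- move=> i M1 w1 iu ag ci [-> mE le]; have E15 : M1 15%N 0%N = r by rewrite ag.
  apply: (runs_if (T := 1)) => /=; rewrite E15 => c; last first.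
    by apply: runs_skip; split=> //; case: (r =P 0%N) le => //= r0 le; lia.
  apply: runs_store; split=> //; rewrite updateE /= E15; last first.
    by case: (r =P 0%N) le => //= r0 le; lia.
  have le2 : (r <= M1 16 0)%N by lia.
  by rewrite -mE -[in RHS](subnK le2) modnDr.
- by move=> i M1 M2 w1 ag [-> mE le]; split=> //; rewrite ag.
- by lia.
Qed.

Lemma runs_choose B e M w : let b := up_log 2 (M 3%N 0%N) in
  let s := [seq i <- rev (iota 0 B) | M 13%N i != 0%N] in
  eval (update M 15 0 0) e = B ->
  runs (Choose e) M w (B * 12 + M 3%N 0%N * 11 + 2 ^ b * 5 + 40)
   (fun M1 w1 => [/\ w1 = drop b w, M1 18%N 0%N = pick_nth s (draw b w) &
      M1 7%N 0%N = (size s * M 7%N 0%N)%N]).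
Proof.
move=> b s eB; set q := M 3%N 0%N.
have sB : (size s <= B)%N by rewrite size_filter (leq_trans (count_size _ _)) // size_rev size_iota.
apply: (runs_seq (T2 := B * 4 + q * 11 + 2 ^ b * 5 + 32) (runs_listing w eB)).
- by lia.
move=> M1 w1 ag1 [-> c1 l1]; rewrite -/s in c1 l1.
apply: (runs_seq (T2 := B * 4 + 2 ^ b * 5 + 20) (runs_draw M1 w)).
- by rewrite ag1 // -/q; lia.
move=> M2 w2 ag2; rewrite ag1 // -/q -/b => -[-> u2].
apply: (runs_seq (T2 := B * 4 + 16) (runs_modulo M2 (drop b w))).
- by have := draw_lt b w; rewrite u2; lia.
move=> M3 w3 ag3 [->]; rewrite u2 ag2 // c1 => u3.
have E15 : M3 15%N 0%N = size s by rewrite ag3 // ag2.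
apply: (runs_seq (T2 := B * 4 + 8) (Q1 := fun M4 w4 => w4 = drop b w /\ M4 = update M3 18 0 (pick_nth s (draw b w)))).
- apply: (runs_if (T := 1)) => /=; rewrite E15 => c; apply: runs_store; split=> //=.
    by rewrite u3 ag3 // ag2 // /pick_nth l1 // ltn_mod lt0n.
  by rewrite /pick_nth (size0nil c) nth_nil.
- by lia.
move=> M4 w4 _ [-> ->] {M4 w4}; set M4 := update _ _ _ _.
apply: (runs_weaken (T' := B * 4 + 8) (runs_mult (y := 7) (e := var 15) (M := M4) (x := size s) (drop b w) _ _)) => //.
- by move: sB; lia.
move=> M5 w5 ag5 [-> ->]; split=> //; first by rewrite ag5 // updateE.
by rewrite /M4 update_other // ag3 // ag2 // ag1.
Qed.

Definition Fill (e : expr) : prog := For 25 e (Store 13 (var 25) (Const 1)).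

Lemma runs_fill B e M w : eval M e = B ->
  runs (Fill e) M w (B * 4 + 3)
    (fun M1 w1 => w1 = w /\ forall i, i < B -> M1 13 i = 1).
Proof.
move=> eB.
apply: (@runs_weaken _ _ _ _ _ (fun M1 w1 => w1 = w /\ forall i, 0 <= i < B -> M1 13 i = 1) _ _ (leqnn _)); last by [].
apply: (runs_for (B := B) (Tb := 1) (Inv := fun j (M1 : memory) w1 =>
  w1 = w /\ forall i, j <= i < B -> M1 13 i = 1)) => //.
- by move=> M1 _; split=> // i; case: leqP => //= /leq_trans H /H; rewrite ltnn.
- move=> j M1 w1 jB ag ej [-> H]; apply: runs_store; split=> // i ij; rewrite update_same /= ej.
  by case: eqP => // ij'; apply: H; lia.
- by move=> j M1 M2 w1 ag [-> H]; split=> // i ij; rewrite ag // H.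
Qed.

Definition VertexFlags : prog :=
  Seq (Fill (Cell 0 (Const 0)))
    (For 26 (var 8) (Store 13 (Cell 10 (var 26)) (Const 0))).

(** Flags start at 1 and are only cleared. The outer test asks whether the earlier step precedes the
    current column: if so, its vertex must be adjacent to the new one; otherwise its row is
    occupied. Array 12 caches the vertex times [n], which keeps multiplications out of the loop. *)
Definition RowFlags : prog :=
  Seq (Fill (var 2))
    (For 26 (var 8)
      (If (Sub (var 9) (var 26))
        (If (Cell 1 (Add (Cell 12 (var 26)) (Cell 10 (var 8))))
          Skip (Store 13 (Cell 11 (var 26)) (Const 0)))
        (Store 13 (Cell 11 (var 26)) (Const 0)))).

Definition stores (n : nat) (M : memory) (h : seq (nat * nat)) : Prop :=
  M 8 0 = size h /\ forall s, s < size h ->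
    let: (v, i) := nth (0, 0) h s in [/\ M 10 s = v, M 11 s = i & M 12 s = v * n].

Definition vcand (n : nat) (h : seq (nat * nat)) : seq nat :=
  [seq v <- rev (iota 0 n) | v \notin map fst h].

(** [size h %/ N * N] is the first step of the current column. *)
Definition rcand (N : nat) (g : nat -> nat -> bool) (h : seq (nat * nat)) (v : nat) : seq nat :=
  [seq i <- rev (iota 0 N) | all (fun s => ((nth (0, 0) h s).2 == i) ==>
       (s < size h %/ N * N) && g (nth (0, 0) h s).1 v) (iota 0 (size h))].

Lemma runs_vertex_flags n h M w : M 0 0 = n -> stores n M h ->
  runs VertexFlags M w (n * 4 + size h * 4 + 10)
    (fun M1 w1 => w1 = w /\ forall v, v < n -> M1 13 v = (v \notin map fst h)).
Proof.
move=> en [et hs].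
apply: (runs_seq (T2 := size h * 4 + 3) (runs_fill w (e := Cell 0 (Const 0)) (B := n) en)).
- by lia.
move=> M1 w1 ag1 [-> F1].
apply: (@runs_weaken _ _ _ _ _ (fun M1 w1 => w1 = w /\ forall v, v < n -> M1 13 v = (v \notin map fst (drop 0 h))) _ _ (leqnn _)); last by rewrite drop0.
apply: (runs_for (B := size h) (Tb := 1) (Inv := fun j (M2 : memory) w2 =>
  w2 = w /\ forall v, v < n -> M2 13 v = (v \notin map fst (drop j h)))) => //.
- by rewrite /= ag1.
- by move=> M2 ag2; split=> // v vn; rewrite ag2 // F1 // drop_size.
- move=> j M2 w2 jh ag2 ej [-> H]; apply: runs_store; split=> // v vn.
  rewrite update_same /= ej (drop_nth (0, 0) jh) /= inE negb_or.
  have := hs j jh; case E: nth => [a c] [e10 _ _].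
  by rewrite ag2 // ag1 // e10 /= H //; case: eqP.
- by move=> j M2 M3 w2 ag2 [-> H]; split=> // v vn; rewrite ag2 // H.
Qed.

Lemma runs_row_flags n N h v M w : M 2 0 = N -> stores n M h ->
  M 10 (size h) = v -> M 9 0 = size h %/ N * N ->
  runs RowFlags M w (N * 4 + size h * 6 + 10)
    (fun M1 w1 => w1 = w /\ forall i, i < N -> M1 13 i =
       all (fun s => ((nth (0, 0) h s).2 == i) ==>
         (s < size h %/ N * N) && (M 1 ((nth (0, 0) h s).1 * n + v)%N != 0)) (iota 0 (size h))).
Proof.
move=> eN [et hs] ev ec.
apply: (runs_seq (T2 := size h * 6 + 3) (runs_fill w (e := var 2) (B := N) eN)).
- by lia.
move=> M1 w1 ag1 [-> F1].
pose ok i s := ((nth (0, 0) h s).2 == i) ==>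
  (s < size h %/ N * N) && (M 1 ((nth (0, 0) h s).1 * n + v)%N != 0).
apply: (@runs_weaken _ _ _ _ _ (fun M2 w2 => w2 = w /\ forall i, i < N -> M2 13 i = all (ok i) (iota 0 (size h - 0))) _ _ (leqnn _));
  last by move=> M2 w2 _; rewrite subn0.
apply: (runs_for (B := size h) (Tb := 3) (Inv := fun j (M2 : memory) w2 =>
  w2 = w /\ forall i, i < N -> M2 13 i = all (ok i) (iota j (size h - j)))) => //.
- by rewrite /= ag1.
- by move=> M2 ag2; split=> // i iN; rewrite ag2 // F1 // subnn.
- move=> j M2 w2 jh ag2 ej [-> H].
  have allS i : all (ok i) (iota j (size h - j)) = ok i j && all (ok i) (iota j.+1 (size h - j.+1)).
    by rewrite (_ : size h - j = (size h - j.+1).+1)%N //; lia.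
  have := hs j jh; case E: nth => [a c] [e10 e11 e12].
  have zero w3 : (j < size h %/ N * N) && (M 1 (a * n + v)%N != 0) = false ->
      runs (Store 13 (Cell 11 (var 26)) (Const 0)) M2 w3 1 (fun M3 w4 =>
       w4 = w3 /\ forall i, i < N -> M3 13 i = all (ok i) (iota j (size h - j))).
    move=> F; apply: runs_store; split=> // i iN; rewrite update_same /= ej allS {1}/ok E /= F implybF.
    by rewrite ag2 // ag1 // e11 H // eq_sym; case: eqP.
  apply: (runs_if (T := 2)) => /=; rewrite ej ag2 // ag1 // ec => c1; last first.
    apply: (runs_weaken (zero w _)) => //.
    by apply/negbTE; rewrite negb_and -leqNgt -subn_eq0 c1.
  have {}c1 : j < size h %/ N * N by lia.
  apply: (runs_if (T := 1)) => /=; rewrite ej !ag2 // !ag1 // e12 et ev => c2.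
    apply: runs_skip; split=> // i iN.
    by rewrite allS {1}/ok E /= c1 c2 implybT H.
  by apply: zero; rewrite c2 andbF.
- by move=> j M2 M3 w2 ag2 [-> H]; split=> // i iN; rewrite ag2 // H.
Qed.

Definition Step : prog :=
  Seq (If (Sub (var 2) (Sub (var 8) (var 9))) Skip (assign 9 (var 8)))
  (Seq VertexFlags
  (Seq (Choose (Cell 0 (Const 0)))
  (Seq (Store 10 (var 8) (var 18))
  (Seq RowFlags
  (Seq (Choose (var 2))
  (Seq (Store 11 (var 8) (var 18))
  (Seq (assign 19 (Cell 0 (Const 0)))
  (Seq (Mult 19 (Cell 10 (var 8)))
  (Seq (Store 12 (var 8) (var 19))
       (assign 8 (Add (var 8) (Const 1)))))))))))).

Lemma pick_nth_leq s n u : all (fun i => i < n) s -> pick_nth s u <= n.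
Proof.
move=> /allP sn; rewrite /pick_nth; case: (ltnP (u %% size s) (size s)) => h.
  by apply/ltnW/sn/mem_nth.
by rewrite nth_default.
Qed.

Definition step_time n q b := (n * 100 + q * 30 + 2 ^ b * 20 + 200)%N.

(** Array 9 is moved only at the start of a step, so after the last step of a column it is still one
    column behind; hence the non-strict bound [M 9 0 + N]. Divisibility by [N] then identifies the
    updated value as [size h %/ N * N]. *)
Lemma runs_step n N q h M w : M 0 0 = n -> M 2 0 = N -> M 3 0 = q -> 0 < N <= n ->
  size h < n -> stores n M h ->
  N %| M 9 0 -> M 9 0 <= size h <= M 9 0 + N ->
  let b := up_log 2 q in
  let s1 := vcand n h in let v := pick_nth s1 (draw b w) in
  let w1 := drop b w in
  let s2 := rcand N (fun a c => M 1 (a * n + c)%N != 0) h v in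
  let i := pick_nth s2 (draw b w1) in
  runs Step M w (step_time n q b) (fun M1 w2 => [/\ w2 = drop b w1, stores n M1 (rcons h (v, i)),
    N %| M1 9 0, M1 9 0 <= size (rcons h (v, i)) <= M1 9 0 + N &
    M1 7 0 = size s2 * (size s1 * M 7 0)]).
Proof.
move=> en eN eq /andP[N0 Nn] hn hst dc lc b s1 v w1 s2 i.
have vn : v <= n.
  by apply: pick_nth_leq; rewrite all_filter; apply/allP => j; rewrite mem_rev mem_iota => /andP[_ jn]; apply/implyP.
pose Tc := n * 12 + q * 11 + 2 ^ b * 5 + 40.
apply: (runs_seq (T2 := n * 40 + Tc * 2 + 100) (Q1 := fun M1 w1 => w1 = w /\ M1 9 0 = size h %/ N * N)).
- have mE c : N %| c -> c <= size h < c + N -> size h %/ N * N = c.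
    move=> /dvdnP[a ->]; rewrite -mulSnr => /andP[l1 l2]; congr (_ * _).
    by apply/eqP; rewrite eqn_leq leq_divRL // l1 andbT -ltnS ltn_divLR.
  have et := hst.1; apply: (runs_if (T := 1)) => /=; rewrite eN et => c1.
    by apply: runs_skip; split=> //; rewrite (mE (M 9 0)) //; lia.
  apply: runs_store; split=> //; rewrite updateE /= et (mE (size h)) //; last by lia.
  have -> : size h = M 9 0 + N by lia.
  by rewrite dvdn_addr.
- by rewrite /step_time /Tc; lia.
move=> M1 _ ag1 [-> c1].
have st1 : stores n M1 h by move: hst; rewrite /stores !ag1.
apply: (runs_seq (T2 := n * 30 + Tc * 2 + 80) (runs_vertex_flags w (n := n) _ st1)).
- by rewrite ag1.
- by rewrite /Tc; lia.
move=> M2 _ ag2 [-> F2].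
have q2 : M2 3 0 = q by rewrite ag2 // ag1.
apply: (runs_seq (T2 := n * 30 + Tc + 70) (runs_choose (B := n) (e := Cell 0 (Const 0)) (M := M2) w _)).
- by rewrite /= update_other // ag2 // ag1.
- by rewrite q2 -/b /Tc; lia.
move=> M3 w3 ag3; rewrite q2 -/b.
rewrite (_ : [seq j <- _ | _] = s1); last first.
  by apply: eq_in_filter => j; rewrite mem_rev mem_iota => /andP[_ jn]; rewrite F2 // eqb0 negbK.
case=> -> e18 e7; rewrite -/v -/w1 in e18 *.
apply: (runs_seq (T2 := n * 30 + Tc + 65) (Q1 := fun M4 w4 => w4 = w1 /\ M4 = update M3 10 (size h) v)).
- by apply: runs_store; rewrite /= e18 ag3 // ag2 // st1.1.
- by lia.
move=> M4 _ _ [-> ->] {M4}; set M4 := update _ _ _ _.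
have old a : a \notin [:: 10] -> M4 a = M3 a by rewrite inE => H; rewrite /M4 update_other.
have st4 : stores n M4 h.
  case: st1 => e1 st1; split=> [|s sh]; first by rewrite old // ag3 // ag2.
  have := st1 s sh; case: nth => a c.
  by rewrite {1}/M4 update_same ltn_eqF // !old // !ag3 // !ag2.
apply: (runs_seq (T2 := n * 20 + Tc + 50) (runs_row_flags w1 (N := N) (v := v) _ st4 _ _)).
- by rewrite old // ag3 // ag2 // ag1.
- by rewrite /M4 update_same eqxx.
- by rewrite old // ag3 // ag2.
- by lia.
move=> M5 _ ag5 [-> F5].
have q5 : M5 3 0 = q by rewrite ag5 // old // ag3.
apply: (runs_seq (T2 := n * 20 + 40) (runs_choose (B := N) (e := var 2) (M := M5) w1 _)).
- by rewrite /= update_other // ag5 // old // ag3 // ag2 // ag1.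
- by rewrite q5 -/b /Tc; lia.
move=> M6 w6 ag6; rewrite q5 -/b.
rewrite (_ : [seq j <- _ | _] = s2); last first.
  apply: eq_in_filter => j; rewrite mem_rev mem_iota => /andP[_ jn]; rewrite F5 // eqb0 negbK.
  by rewrite old // ag3 // ag2 // ag1.
case=> -> e18' e7'; rewrite -/i in e18' *.
have t6 : M6 8 0 = size h by rewrite ag6 // ag5 // st4.1.
apply: (runs_seq (T2 := n * 20 + 35) (Q1 := fun M7 w7 => w7 = drop b w1 /\ M7 = update M6 11 (size h) i)).
- by apply: runs_store; rewrite /= e18' t6.
- by lia.
move=> M7 _ _ [-> ->] {M7}; set M7 := update _ _ _ _.
apply: (runs_seq (T2 := n * 20 + 30) (Q1 := fun M8 w8 => w8 = drop b w1 /\ M8 = update M7 19 0 n)).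
- by apply: runs_store; rewrite /= {2}/M7 update_other // ag6 // ag5 // old // ag3 // ag2 // ag1 // en.
- by lia.
move=> M8 _ _ [-> ->] {M8}; set M8 := update _ _ _ _.
have old8 a : a \notin [:: 11; 19] -> M8 a = M6 a.
  by rewrite !inE negb_or => /andP[a1 a2]; rewrite /M8 update_other // /M7 update_other.
apply: (runs_seq (T2 := 10) (runs_mult (y := 19) (e := Cell 10 (var 8)) (x := v) (M := M8) (drop b w1) _ _)).
- by [].
- by rewrite /= update_other // old8 // update_other // old8 // t6 ag6 // ag5 // /M4 update_same eqxx.
- by lia.
move=> M9 _ ag9 [->]; rewrite {1}/M8 updateE => e19.
apply: (runs_seq (T2 := 1) (Q1 := fun M10 w10 => w10 = drop b w1 /\ M10 = update M9 12 (size h) (v * n))).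
- by apply: runs_store; rewrite /= e19 ag9 // old8 // t6.
- by [].
move=> M10 _ _ [-> ->] {M10}; set M10 := update _ _ _ _.
have old10 a : a \notin [:: 20; 21; 20; 19; 12] -> M10 a = M8 a.
  by move=> H; rewrite /M10 update_other ?ag9 //; apply: contra H; rewrite !inE;
    case: (a == 12); case: (a == 19); case: (a == 20); case: (a == 21).
apply: runs_store; rewrite /= (old10 8) // old8 // t6 addn1; split=> //.
- split; first by rewrite updateE size_rcons.
  move=> s; rewrite size_rcons ltnS nth_rcons !update_other // => sh.
  rewrite (old10 10) // (old10 11) // {1}/M10 update_same (old8 10) //.
  rewrite {1}/M8 update_other // {1}/M7 update_same ag6 // ag5 //.
  case: (ltngtP s (size h)) sh => // [sh _|-> _]; last first.
    by rewrite /M4 update_same eqxx.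
  have := st4.2 s sh; case: nth => a c; rewrite ag9 // old8 // !ag6 // !ag5 //.
- by rewrite update_other // old10 // old8 // ag6 // ag5 // old // ag3 // ag2 // c1 dvdn_mull.
- rewrite update_other // old10 // old8 // ag6 // ag5 // old // ag3 // ag2 // c1 size_rcons.
  by rewrite leqW ?leq_divM //= -mulSnr -ltn_divLR.
- by rewrite update_other // old10 // old8 // e7' ag5 // old // e7 ag2 // ag1.
Qed.

(** A step reads [b + b] coins, one draw for the vertex and one for the row. A trial that gets stuck
    is not cut off: it continues with dummy picks and product 0, so that all trials read equally
    many coins. *)
Fixpoint trial (n N b : nat) (g : nat -> nat -> bool) (d : nat) (h : seq (nat * nat))
    (w : seq bool) : nat :=
  if d is d'.+1 then
    let s1 := vcand n h in let v := pick_nth s1 (draw b w) in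
    let s2 := rcand N g h v in let i := pick_nth s2 (draw b (drop b w)) in
    size s1 * size s2 * trial n N b g d' (rcons h (v, i)) (drop (b + b) w)
  else 1.

Fixpoint sums (n N b : nat) (g : nat -> nat -> bool) (T : nat) (w : seq bool) : nat :=
  if T is T'.+1 then trial n N b g n [::] w + sums n N b g T' (drop (n * (b + b)) w)
  else 0.

Definition Trial : prog :=
  Seq (assign 7 (Const 1)) (Seq (assign 8 (Const 0)) (Seq (assign 9 (Const 0))
    (Seq (For 27 (Cell 0 (Const 0)) Step) (assign 6 (Add (var 6) (var 7)))))).

Lemma runs_trial n N q M w : M 0 0 = n -> M 2 0 = N -> M 3 0 = q ->
  (0 < n -> 0 < N <= n) ->
  let b := up_log 2 q in
  runs Trial M w (n * (step_time n q b + 3) + 20)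
    (fun M1 w1 => w1 = drop (n * (b + b)) w /\ M1 6 0 =
      M 6 0 + trial n N b (fun a c => M 1 (a * n + c)%N != 0) n [::] w).
Proof.
move=> en eN eq Nn b; set g := fun a c => _ != 0; set Ts := step_time n q b.
apply: (runs_seq (T2 := n * (Ts + 3) + 15) (Q1 := fun M1 w1 => w1 = w /\ M1 = update M 7 0 1)).
- by apply: runs_store.
- by lia.
move=> M1 _ _ [-> ->] {M1}.
apply: (runs_seq (T2 := n * (Ts + 3) + 10) (Q1 := fun M1 w1 => w1 = w /\ M1 = update (update M 7 0 1) 8 0 0)).
- by apply: runs_store.
- by lia.
move=> M1 _ _ [-> ->] {M1}; set M1 := update _ _ _ _.
apply: (runs_seq (T2 := n * (Ts + 3) + 6) (Q1 := fun M2 w1 => w1 = w /\ M2 = update M1 9 0 0)).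
- by apply: runs_store.
- by lia.
move=> M2 _ _ [-> ->] {M2}; set M2 := update _ _ _ _.
have old a : a \notin [:: 7; 8; 9] -> M2 a = M a.
  by rewrite !inE !negb_or => /and3P[a7 a8 a9]; rewrite /M2 /M1 !update_other.
(* The product so far times the value of the rest of the trial is invariant, and so is the coin
   suffix that will remain at the end. *)
pose Inv i (M3 : memory) (w3 : seq bool) := exists h, [/\ size h = n - i, stores n M3 h,
   N %| M3 9 0 /\ M3 9 0 <= size h <= M3 9 0 + N,
   M3 7 0 * trial n N b g i h w3 = trial n N b g n [::] w &
   drop (i * (b + b)) w3 = drop (n * (b + b)) w].
apply: (runs_seq (T2 := 1) (Q1 := Inv 0)).
- apply: (runs_for (B := n) (Tb := Ts) (T := n * (Ts + 3) + 3) (Inv := Inv)).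
  + by [].
  + by rewrite /= old.
  + move=> M3 ag3; exists [::]; rewrite /stores !ag3 // /M2 updateE update_other //; split=> //.
    * by rewrite subnn.
    * by rewrite /M1 update_other // update_other // updateE mul1n.
  + move=> i M3 w3 lin ag3 ei [h [szh sth [dc lc] tE wE]].
    have en3 : M3 0 0 = n by rewrite ag3 // old.
    have eN3 : M3 2 0 = N by rewrite ag3 // old.
    have eq3 : M3 3 0 = q by rewrite ag3 // old.
    have e13 : M3 1 = M 1 by rewrite ag3 // old.
    have Nn' : 0 < N <= n by apply: Nn; exact: leq_ltn_trans lin.
    apply: (runs_weaken (runs_step w3 en3 eN3 eq3 Nn' _ sth dc lc)) => //; first by rewrite szh; lia.
    move=> M4 w4 ag4; rewrite e13 -/g => -[-> st4 dc4 lc4 e7].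
    eexists; split; [|exact: st4| |rewrite -tE /=|].
    * by rewrite size_rcons szh; lia.
    * by [].
    * by rewrite e7 drop_drop; set x := trial _ _ _ _ _ _ _; rewrite mulnCA !mulnA [X in X * _]mulnC; congr (_ * _); rewrite -!mulnA mulnCA.
    * by rewrite drop_drop drop_drop -wE; congr drop; lia.
  + move=> i M3 M4 w3 ag [h [szh [st1 st2] [dc lc] tE wE]]; exists h; rewrite /stores !ag //; split=> //.
  + by [].
- by lia.
move=> M3 w3 ag3 [h [_ _ _ tE wE]]; apply: runs_store; split; first by rewrite -wE drop0.
by rewrite updateE /= -tE /= muln1 ag3 // old.
Qed.

(** Division by counting: [k] is added until [n] is reached. The loop makes [n] rounds, the later
    ones being idle. *)
Definition Rows : prog :=
  Seq (assign 2 (Const 0)) (Seq (assign 8 (Const 0))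
    (For 27 (Cell 0 (Const 0)) (If (Sub (Cell 0 (Const 0)) (var 8))
      (Seq (assign 8 (Add (var 8) (Cell 0 (Const 1)))) (assign 2 (Add (var 2) (Const 1))))
      Skip))).

Lemma runs_rows n k M w : M 0 0 = n -> M 0 1 = k -> 0 < k -> k %| n ->
  runs Rows M w (n * 8 + 10) (fun M1 w1 => w1 = w /\ M1 2 0 = n %/ k).
Proof.
move=> en ek k0 kn.
apply: (runs_seq (T2 := n * 8 + 7) (Q1 := fun M1 w1 => w1 = w /\ M1 = update M 2 0 0)).
- by apply: runs_store.
- by lia.
move=> M1 _ _ [-> ->] {M1}.
apply: (runs_seq (T2 := n * 8 + 3) (Q1 := fun M1 w1 => w1 = w /\ M1 = update (update M 2 0 0) 8 0 0)).
- by apply: runs_store.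
- by lia.
move=> M1 _ _ [-> ->] {M1}; set M1 := update _ _ _ _.
have old a : a \notin [:: 2; 8] -> M1 a = M a.
  by rewrite !inE !negb_or => /andP[a2 a8]; rewrite /M1 !update_other.
pose Inv i (M3 : memory) (w3 : seq bool) := [/\ w3 = w, M3 2 0 = minn (n - i) (n %/ k) & M3 8 0 = M3 2 0 * k].
apply: (@runs_weaken _ _ _ _ _ (Inv 0) _ _ (leqnn _)); last first.
  by move=> M2 w2 _ [-> e2 _]; rewrite e2 subn0; split=> //; apply/minn_idPr; exact: leq_div.
apply: (runs_for (B := n) (Tb := 4) (Inv := Inv)).
- by [].
- by rewrite /= old.
- move=> M2 ag2; have e8 : M2 8 0 = 0 by rewrite ag2 // updateE.
  have e2 : M2 2 0 = 0 by rewrite ag2 // /M1 update_other // updateE.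
  by split; rewrite ?e2 ?e8 // subnn min0n.
- move=> i M2 w2 lin ag2 ei [-> e2 e8].
  have eq8 : (n - M2 8 0 != 0) = (M2 2 0 < n %/ k).
    by rewrite e8 ltn_divRL // -subn_gt0 lt0n.
  apply: (runs_if (T := 3)) => /=; rewrite ag2 // old // en => c; last first.
    apply: (runs_weaken (T := 1) (runs_skip (Q := fun M3 w3 => M3 = M2 /\ w3 = w) _)) => //.
    move=> M3 w3 _ [-> ->]; split=> //; rewrite e2; move: (eq8); rewrite c eqxx e2 /=; lia.
  move: (c); rewrite eq8 => lt.
  apply: (runs_seq (T2 := 1) (Q1 := fun M3 w3 => w3 = w /\ M3 = update M2 8 0 (M2 8 0 + k))).
  + by apply: runs_store; rewrite /= (ag2 0) // old // ek.
  + by [].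
  move=> M3 _ _ [-> ->] {M3}; apply: runs_store; split=> //.
  + by rewrite updateE /= update_other // e2; move: lt; rewrite e2; lia.
  + by rewrite update_other // updateE updateE /= update_other // e8 addn1 mulSn addnC.
- by move=> i M2 M3 w2 ag [-> e2 e8]; split; rewrite // !ag.
- by lia.
Qed.

Lemma runs_mult_rep c e e' y M w B x : c \notin [:: 20; 21; y] -> y \notin [:: 20; 21] ->
  eval M e = B ->
  (forall M1, agree_off [:: c; 20; 21; y] M M1 -> eval (update M1 20 0 0) e' = x) ->
  runs (For c e (Mult y e')) M w (B * (x * 4 + 11) + 3)
    (fun M1 w1 => w1 = w /\ M1 y 0 = x ^ B * M y 0).
Proof.
move=> cN yN eB ex.
have cy : y != c by move: cN; rewrite !inE !negb_or => /and3P[_ _]; rewrite eq_sym.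
apply: (@runs_weaken _ _ _ _ _ (fun M1 w1 => w1 = w /\ M1 y 0 = x ^ (B - 0) * M y 0) _ _ (leqnn _));
  last by rewrite subn0.
apply: (runs_for (B := B) (Tb := x * 4 + 8) (Inv := fun i (M1 : memory) w1 => w1 = w /\ M1 y 0 = x ^ (B - i) * M y 0)).
- by move: cN; rewrite /= !inE !negb_or => /and3P[-> -> ->].
- by [].
- by move=> M1 ag; rewrite ag ?inE // subnn mul1n.
- move=> i M1 w1 iB ag ei [-> yE].
  apply: (runs_weaken (runs_mult (x := x) w yN _)) => //.
    apply: ex => a aN; apply: ag; apply: contra aN; rewrite /= !inE.
    by case: (a == c); case: (a == 20); case: (a == 21); case: (a == y).
  by move=> M2 w2 _ [-> ->]; split=> //; rewrite yE mulnA -expnS; congr (_ ^ _ * _); lia.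
- by move=> i M1 M2 w1 ag [-> yE]; split=> //; rewrite ag // inE.
- by lia.
Qed.

Definition FactMult (e : expr) : prog := For 29 e (Mult 5 (Add (var 29) (Const 1))).

Lemma runs_fact_mult e M w x : eval M e = x ->
  runs (FactMult e) M w (x * (x * 4 + 11) + 3)
    (fun M1 w1 => w1 = w /\ M1 5 0 = x`! * M 5 0).
Proof.
move=> ex.
apply: (@runs_weaken _ _ _ _ _ (fun M1 w1 => w1 = w /\ 0`! * M1 5 0 = x`! * M 5 0) _ _ (leqnn _));
  last by move=> M1 w1 _ [-> <-]; rewrite mul1n.
apply: (runs_for (B := x) (Tb := x * 4 + 8) (Inv := fun i (M1 : memory) w1 => w1 = w /\ i`! * M1 5 0 = x`! * M 5 0)).
- by [].
- by [].
- by move=> M1 ag; rewrite ag.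
- move=> i M1 w1 iB ag ei [-> yE].
  apply: (runs_weaken (runs_mult (x := i + 1) (y := 5) w _ _)) => //.
  + by rewrite /= update_other // ei.
  + by lia.
  move=> M2 w2 _ [-> ->]; split=> //.
  by rewrite -yE factS addn1 mulnCA mulnA.
- by move=> i M1 M2 w1 ag [-> yE]; split=> //; rewrite ag.
- by lia.
Qed.

Lemma runs_fact_mult_rep e e' M w B x : eval M e = B ->
  (forall M1, agree_off [:: 5; 20; 21; 27; 29] M M1 -> eval M1 e' = x) ->
  runs (For 27 e (FactMult e')) M w (B * (x * (x * 4 + 11) + 6) + 3)
    (fun M1 w1 => w1 = w /\ M1 5 0 = x`! ^ B * M 5 0).
Proof.
move=> eB ex.
apply: (@runs_weaken _ _ _ _ _ (fun M1 w1 => w1 = w /\ M1 5 0 = x`! ^ (B - 0) * M 5 0) _ _ (leqnn _));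
  last by rewrite subn0.
apply: (runs_for (B := B) (Tb := x * (x * 4 + 11) + 3) (Inv := fun i (M1 : memory) w1 => w1 = w /\ M1 5 0 = x`! ^ (B - i) * M 5 0)).
- by [].
- by [].
- by move=> M1 ag; rewrite ag // subnn mul1n.
- move=> i M1 w1 iB ag ei [-> yE].
  apply: (runs_weaken (runs_fact_mult (x := x) w _)) => //.
    apply: ex => a aN; apply: ag; apply: contra aN; rewrite /= !inE.
    by case: (a == 5); case: (a == 20); case: (a == 21); case: (a == 27); case: (a == 29).
  by move=> M2 w2 _ [-> ->]; split=> //; rewrite yE mulnA -expnS; congr (_ ^ _ * _); lia.
- by move=> i M1 M2 w1 ag [-> yE]; split=> //; rewrite ag.
- by lia.
Qed.

(** Array 5 ends as the number of trials times [N! * N!^k * k!^N], the number of leaves that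
    represent one clique cover ([leaves_covers]). The inputs [n] and [k] are overwritten by the
    answer only at the very end. *)
Definition Main (D : nat) : prog :=
  Seq Rows
  (Seq (assign 3 (Const 8))
  (Seq (For 27 (Const 2) (Mult 3 (Cell 0 (Const 0))))
  (Seq (Mult 3 (Cell 0 (Const 2)))
  (Seq (assign 4 (Const 1))
  (Seq (For 27 (Const D) (Mult 4 (Cell 0 (Const 0))))
  (Seq (For 27 (Const 2) (Mult 4 (Cell 0 (Const 2))))
  (Seq (assign 6 (Const 0))
  (Seq (For 28 (var 4) Trial)
  (Seq (assign 5 (var 4))
  (Seq (For 27 (var 2) (FactMult (Cell 0 (Const 1))))
  (Seq (For 27 (Cell 0 (Const 1)) (FactMult (var 2)))
  (Seq (FactMult (var 2))
  (Seq (Store 0 (Const 0) (var 6))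
       (Store 0 (Const 1) (var 5))))))))))))))).

(** A trial makes [2 n] draws, each biased by a factor within [n / 2^b] of 1. The 8 gives
    [2 n * n / 2^b <= 1 / (4 m)], so that the mean of a trial has relative bias at most
    [1 / (2 m)]. *)
Definition bound (n m : nat) : nat := m * (n ^ 2 * 8).

Definition nbits (n m : nat) : nat := up_log 2 (bound n m).

Definition trials (D n m : nat) : nat := m ^ 2 * n ^ D.

Definition fact_time (x : nat) : nat := x * (x * 4 + 11) + 6.

Definition main_time (D n k m : nat) : nat :=
  n * 20 + m * 20 + D * (n * 4 + 11) +
  trials D n m * (n * (step_time n (bound n m) (nbits n m) + 3) + 30) +
  n * fact_time k + k * fact_time n + fact_time n + 300.

Lemma runs_main D n k m M w : M 0 0 = n -> M 0 1 = k -> M 0 2 = m -> 0 < k -> k %| n ->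
  runs (Main D) M w (main_time D n k m) (fun M1 w1 =>
    M1 0 0 = sums n (n %/ k) (nbits n m) (fun a c => M 1 (a * n + c)%N != 0) (trials D n m) w /\
    M1 0 1 = (n %/ k)`! * ((n %/ k)`! ^ k * (k`! ^ (n %/ k) * trials D n m))).
Proof.
move=> en ek em k0 kn; set N := n %/ k; set b := nbits n m; set g := fun a c => _ != 0.
have Nn : N <= n by exact: leq_div.
have N0 : 0 < n -> 0 < N by move=> n0; rewrite divn_gt0 // dvdn_leq.
set T := trials D n m; set Ts := n * (step_time n (bound n m) b + 3) + 20.
have le1 : N * (fact_time k) <= n * fact_time k by rewrite leq_mul.
have le2 : k * (fact_time N) <= k * fact_time n.
  by rewrite leq_mul // /fact_time leq_add // leq_mul // leq_add // leq_mul.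
have le3 : fact_time N <= fact_time n.
  by rewrite /fact_time leq_add // leq_mul // leq_add // leq_mul.
pose rest := T * (Ts + 3) + N * fact_time k + k * fact_time N + fact_time N.
have timeE : n * 20 + m * 20 + D * (n * 4 + 11) + rest + 200 <= main_time D n k m.
  by rewrite /main_time /rest -/b -/T /Ts; nia.
apply: runs_weaken timeE (fun M1 w1 _ => id).
apply: (runs_seq (T2 := n * 12 + m * 20 + D * (n * 4 + 11) + rest + 180) (runs_rows w en ek k0 kn)).
- by lia.
move=> M1 _ ag1 [-> e2].
apply: (runs_seq (T2 := n * 12 + m * 20 + D * (n * 4 + 11) + rest + 170)
  (Q1 := fun M2 w1 => w1 = w /\ M2 = update M1 3 0 8)).
- by apply: runs_store.
- by lia.
move=> M2 _ _ [-> ->] {M2}; set M2 := update _ _ _ _.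
have old2 a : a != 3 -> M2 a = M1 a by move=> H; rewrite /M2 update_other.
apply: (runs_seq (T2 := n * 4 + m * 20 + D * (n * 4 + 11) + rest + 140)
   (runs_mult_rep (e := Const 2) (B := 2) (x := n) w _ _ (erefl _) _)) => //.
- by move=> M3 ag; rewrite /= update_other // ag // old2 // ag1.
- by lia.
move=> M3 _ ag3 [->]; rewrite {1}/M2 updateE => e3.
apply: (runs_seq (T2 := n * 4 + m * 12 + D * (n * 4 + 11) + rest + 110)
   (runs_mult (y := 3) (x := m) w _ _)) => //.
- by rewrite /= update_other // ag3 // old2 // ag1.
- by lia.
move=> M4 _ ag4 [->]; rewrite e3 => e3'.
apply: (runs_seq (T2 := n * 4 + m * 12 + D * (n * 4 + 11) + rest + 105)
  (Q1 := fun M5 w1 => w1 = w /\ M5 = update M4 4 0 1)).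
- by apply: runs_store.
- by lia.
move=> M5 _ _ [-> ->] {M5}; set M5 := update _ _ _ _.
have old5 a : a \notin [:: 2; 3; 4; 8; 20; 21; 27] -> M5 a = M a.
  rewrite !inE !negb_or => /and5P[a2 a3 a4 a8 /and3P[a20 a21 a27]].
  rewrite /M5 update_other // ag4 ?ag3 ?old2 ?ag1 //= ?inE ?negb_or ?a2 ?a3 ?a4 ?a8 ?a20 ?a21 ?a27 //.
apply: (runs_seq (T2 := m * 12 + rest + 95)
   (runs_mult_rep (e := Const D) (B := D) (x := n) w _ _ (erefl _) _)) => //.
- by move=> M6 ag; rewrite /= update_other // ag // old5.
- by lia.
move=> M6 _ ag6 [->]; rewrite {1}/M5 updateE muln1 => e4.
apply: (runs_seq (T2 := rest + 60)
   (runs_mult_rep (e := Const 2) (B := 2) (x := m) w _ _ (erefl _) _)) => //.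
- by move=> M7 ag; rewrite /= update_other // ag // ag6 // old5.
- by lia.
move=> M7 _ ag7 [->]; rewrite e4 -/(trials D n m) -/T => e4'.
apply: (runs_seq (T2 := rest + 55)
  (Q1 := fun M8 w1 => w1 = w /\ M8 = update M7 6 0 0)).
- by apply: runs_store.
- by lia.
move=> M8 _ _ [-> ->] {M8}; set M8 := update _ _ _ _.
have old8 a : a \notin [:: 2; 3; 4; 6; 8; 20; 21; 27] -> M8 a = M a.
  rewrite !inE !negb_or => /and5P[a2 a3 a4 a6 /and4P[a8 a20 a21 a27]].
  rewrite /M8 update_other // ag7 ?ag6 ?old5 //= ?inE ?negb_or ?a2 ?a3 ?a4 ?a6 ?a8 ?a20 ?a21 ?a27 //.
have M82 : M8 2 0 = N.
  by rewrite /M8 update_other // ag7 // ag6 // /M5 update_other // ag4 // ag3 // old2.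
have M83 : M8 3 0 = bound n m.
  by rewrite /M8 update_other // ag7 // ag6 // /M5 update_other.
have M84 : M8 4 0 = T by rewrite /M8 update_other.
pose Inv i (M9 : memory) (w9 : seq bool) := M9 6 0 + sums n N b g i w9 = sums n N b g T w.
apply: (runs_seq (T2 := rest - T * (Ts + 3) + 45) (Q1 := Inv 0)).
- apply: (runs_for (B := T) (Tb := Ts) (T := T * (Ts + 3) + 3) (Inv := Inv)).
  + by [].
  + by [].
  + by move=> M9 ag9; rewrite /Inv ag9 // /M8 updateE.
  + move=> i M9 w9 iT ag9 ei tE.
    have e0 : M9 0 0 = n by rewrite ag9 // old8.
    have e2' : M9 2 0 = N by rewrite ag9.
    have e3'' : M9 3 0 = bound n m by rewrite ag9.
    have e1 : M9 1 = M 1 by rewrite ag9 // old8.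
    have N0n : 0 < n -> 0 < N <= n by move=> n0; rewrite N0.
    apply: (runs_weaken (runs_trial w9 e0 e2' e3'' N0n)) => // M10 w10 _.
    by rewrite e1 -/g => -[-> e6]; rewrite /Inv e6 -tE /= addnA.
  + by move=> i M9 M10 w9 ag; rewrite /Inv ag.
  + by [].
- by rewrite /rest; lia.
move=> M9 w9 ag9; rewrite /Inv /= addn0 => e6.
apply: (runs_seq (T2 := rest - T * (Ts + 3) + 40)
  (Q1 := fun M10 w1 => w1 = w9 /\ M10 = update M9 5 0 T)).
- by apply: runs_store; rewrite /= ag9 // M84.
- by lia.
move=> M10 _ _ [-> ->] {M10}; set M10 := update _ _ _ _.
have M10k : M10 0 1 = k by rewrite /M10 update_other // ag9 // old8.
have M102 : M10 2 0 = N by rewrite /M10 update_other // ag9.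
apply: (runs_seq (T2 := k * fact_time N + fact_time N + 30)
   (runs_fact_mult_rep (x := k) (B := N) (e := var 2) w9 _ _)) => //.
- by move=> M11 ag; rewrite /= ag.
- by rewrite /rest -/(fact_time k); lia.
move=> M11 _ ag11 [->]; rewrite {1}/M10 updateE => e5.
apply: (runs_seq (T2 := fact_time N + 20)
   (runs_fact_mult_rep (x := N) (B := k) (e := Cell 0 (Const 1)) w9 _ _)) => //.
- by rewrite /= ag11.
- by move=> M12 ag; rewrite /= ag // ag11.
- by rewrite -/(fact_time N); lia.
move=> M12 _ ag12 [->]; rewrite e5 => e5'.
apply: (runs_seq (T2 := 10) (runs_fact_mult (x := N) (e := var 2) w9 _)).
- by rewrite /= ag12 // ag11.
- by rewrite /fact_time; lia.
move=> M13 _ ag13 [->]; rewrite e5' => e5''.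
apply: (runs_seq (T2 := 1)
  (Q1 := fun M14 w1 => w1 = w9 /\ M14 = update M13 0 0 (M13 6 0))).
- by apply: runs_store.
- by [].
move=> M14 _ _ [-> ->]; apply: runs_store; split.
  by rewrite update_same /= updateE ag13 // ag12 // ag11 // /M10 update_other.
by rewrite update_same /= update_other.
Qed.

(** * Polynomial running time *)

(** [0 < m] makes the base positive, so degrees can be raised; [k <= K] lets [k] count as a
    constant. *)
Definition poly_bounded (K : nat) (f : nat -> nat -> nat -> nat) : Prop :=
  exists C d, forall n k m, 0 < m -> k <= K -> f n k m <= C * (n + m) ^ d.

Lemma poly_bounded_le K f g : poly_bounded K g -> (forall n k m, f n k m <= g n k m) ->
  poly_bounded K f.
Proof.
by move=> [C [d H]] fg; exists C, d => n k m m0 kK; apply: leq_trans (fg _ _ _) (H _ _ _ _ _).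
Qed.

Lemma poly_bounded_const K c : poly_bounded K (fun _ _ _ => c).
Proof. by exists c, 0 => n k m _ _; rewrite muln1. Qed.

Lemma poly_bounded_n K : poly_bounded K (fun n _ _ => n).
Proof. by exists 1, 1 => n k m _ _; rewrite mul1n leq_addr. Qed.

Lemma poly_bounded_m K : poly_bounded K (fun _ _ m => m).
Proof. by exists 1, 1 => n k m _ _; rewrite mul1n leq_addl. Qed.

Lemma poly_bounded_k K : poly_bounded K (fun _ k _ => k).
Proof. by exists K, 0 => n k m _ kK; rewrite muln1. Qed.

Lemma poly_bounded_add K f g : poly_bounded K f -> poly_bounded K g ->
  poly_bounded K (fun n k m => f n k m + g n k m).
Proof.
move=> [C [d Hf]] [C' [d' Hg]]; exists (C + C'), (d + d') => n k m m0 kK.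
have s0 : 0 < n + m by rewrite addn_gt0 m0 orbT.
by rewrite mulnDl leq_add //; [apply: leq_trans (Hf _ _ _ m0 kK) _ | apply: leq_trans (Hg _ _ _ m0 kK) _];
  rewrite leq_mul // leq_pexp2l // ?leq_addr ?leq_addl.
Qed.

Lemma poly_bounded_mul K f g : poly_bounded K f -> poly_bounded K g ->
  poly_bounded K (fun n k m => f n k m * g n k m).
Proof.
move=> [C [d Hf]] [C' [d' Hg]]; exists (C * C'), (d + d') => n k m m0 kK.
by rewrite expnD mulnACA leq_mul ?Hf ?Hg.
Qed.

Lemma poly_bounded_exp K f D : poly_bounded K f -> poly_bounded K (fun n k m => f n k m ^ D).
Proof.
move=> Hf; elim: D => [|D IH]; first exact: poly_bounded_const.
apply: (@poly_bounded_le _ _ (fun n k m => f n k m * f n k m ^ D)); first exact: poly_bounded_mul.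
by move=> n k m; rewrite expnS.
Qed.

Ltac poly_bounded := repeat first
  [ exact: poly_bounded_n | exact: poly_bounded_m | exact: poly_bounded_k
  | exact: poly_bounded_const | assumption
  | apply: poly_bounded_add | apply: poly_bounded_mul | apply: poly_bounded_exp ].

Lemma nbits_leq n m : nbits n m <= bound n m.
Proof. by apply: up_log_min => //; apply/ltnW/ltn_expl. Qed.

(** [Modulo] takes time proportional to the number drawn, so [2 ^ b] itself must be polynomial, not
    only [b]. Rounding up to a power of two at most doubles a positive bound; the [+ 1] is for the
    bound 0. *)
Lemma exp_nbits_leq n m : 2 ^ nbits n m <= bound n m * 2 + 1.
Proof.
rewrite /nbits; case: (leqP (bound n m) 1) => [|b1].
  by case: (bound n m) => [|[|]].
rewrite -(prednK (_ : 0 < up_log 2 (bound n m))) ?up_log_gt0 // expnS mulnC.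
by rewrite (leq_trans _ (leq_addr _ _)) // leq_mul2r /= ltnW // up_log_gtn.
Qed.

(** The second summand counts the coins read: [t] is both the time limit and the number of coins
    supplied. *)
Lemma main_time_poly D K : exists C d, forall n k m, 0 < m -> k <= K ->
  main_time D n k m + trials D n m * (n * (nbits n m + nbits n m)) <= C * (n + m) ^ d.
Proof.
have Hb : poly_bounded K (fun n _ m => bound n m) by rewrite /bound; poly_bounded.
have Hn : poly_bounded K (fun n _ m => nbits n m).
  by apply: (poly_bounded_le Hb) => n _ m; exact: nbits_leq.
have He : poly_bounded K (fun n _ m => 2 ^ nbits n m).
  apply: (@poly_bounded_le _ _ (fun n _ m => bound n m * 2 + 1)); first by poly_bounded.
  by move=> n _ m; exact: exp_nbits_leq.
have HT : poly_bounded K (fun n _ m => trials D n m) by rewrite /trials; poly_bounded.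
change (poly_bounded K (fun n k m =>
  main_time D n k m + trials D n m * (n * (nbits n m + nbits n m)))).
by rewrite /main_time /step_time /fact_time; poly_bounded.
Qed.

Local Open Scope ring_scope.

(** * Averages over the coin tosses *)

(** Averaging coin by coin makes it easy to split off the coins of one draw or of one trial
    ([cmean_add]); [cmeanE] leads back to tuples. *)
Fixpoint cmean (R : realType) (t : nat) (f : seq bool -> R) : R :=
  if t is t'.+1 then
    (cmean t' (fun w => f (true :: w)) + cmean t' (fun w => f (false :: w))) / 2
  else f [::].

Lemma cmeanE (R : realType) t (f : seq bool -> R) :
  cmean t f = (\sum_(w : t.-tuple bool) f w) / 2 ^+ t.
Proof.
elim: t f => [|t IH] f /=.
  rewrite expr0 divr1 (big_pred1 [tuple]) // => w; apply/esym/eqP.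
  by rewrite tuple0.
rewrite !IH exprS invfM mulrA -mulrDl mulrAC; congr (_ / _); congr (_ / _).
rewrite (reindex (fun q : bool * t.-tuple bool => [tuple of q.1 :: q.2])) /=; last first.
  exists (fun w => (thead w, [tuple of behead w])) => [[c w] _|w _] /=.
    by rewrite theadE; congr pair; apply: val_inj.
  by apply: val_inj => /=; case/tupleP: w => c w.
rewrite -(pair_bigA _ (fun (c : bool) (w : t.-tuple bool) => f (c :: w))) /=.
by rewrite big_bool.
Qed.

Lemma eq_cmean (R : realType) t (f g : seq bool -> R) :
  (forall w, size w = t -> f w = g w) -> cmean t f = cmean t g.
Proof.
elim: t f g => [|t IH] f g fg /=; first exact: fg.
by congr ((_ + _) / _); apply: IH => w wt; apply: fg; rewrite /= wt.
Qed.

Lemma cmean_le (R : realType) t (f g : seq bool -> R) :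
  (forall w, size w = t -> f w <= g w) -> cmean t f <= cmean t g.
Proof.
elim: t f g => [|t IH] f g fg /=; first exact: fg.
by rewrite ler_pM2r ?invr_gt0 // lerD // IH // => w wt; apply: fg; rewrite /= wt.
Qed.

Lemma cmean_const (R : realType) t (c : R) : cmean t (fun=> c) = c.
Proof. by elim: t => //= t ->; field. Qed.

Lemma cmeanD (R : realType) t (f g : seq bool -> R) :
  cmean t (fun w => f w + g w) = cmean t f + cmean t g.
Proof. by elim: t f g => [|t IH] f g //=; rewrite !IH; field. Qed.

Lemma cmeanZ (R : realType) t (c : R) (f : seq bool -> R) :
  cmean t (fun w => c * f w) = c * cmean t f.
Proof. by elim: t f => [|t IH] f //=; rewrite !IH; field. Qed.

Lemma cmean_ge0 (R : realType) t (f : seq bool -> R) : (forall w, 0 <= f w) -> 0 <= cmean t f.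
Proof. by move=> f0; rewrite -(cmean_const t (0 : R)) cmean_le. Qed.

Lemma cmean_add (R : realType) s t (f : seq bool -> R) :
  cmean (s + t) f = cmean s (fun u => cmean t (fun v => f (u ++ v))).
Proof. by elim: s f => [|s IH] f //=; rewrite !IH. Qed.

Lemma draw_cat b u v : (b <= size u)%N -> draw b (u ++ v) = draw b u.
Proof. by elim: b => //= b IH bu; rewrite nth_cat bu IH // ltnW. Qed.

Lemma big_ord_double (R : realType) n (f : nat -> R) :
  \sum_(u < n + n) f u = \sum_(u < n) (f (u + u)%N + f (u + u).+1).
Proof.
elim: n => [|n IH]; first by rewrite !big_ord0.
by rewrite addSn addnS !big_ord_recr /= IH -addrA.
Qed.

Lemma cmean_draw (R : realType) b (f : nat -> R) :
  cmean b (fun w => f (draw b w)) = (\sum_(u < 2 ^ b) f u) / 2 ^+ b.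
Proof.
elim: b f => [|b IH] f; first by rewrite /= big_ord_recl big_ord0 addr0 expr0 divr1.
(* The last coin is the lowest bit of the number, so it is the one split off. *)
rewrite -addn1 cmean_add.
rewrite (@eq_cmean _ _ _ (fun u => (f (draw b u + draw b u)%N + f (draw b u + draw b u).+1) / 2)); last first.
  move=> u bu; rewrite /= addn1 /= !nth_cat bu ltnn subnn /= !draw_cat ?bu //.
  by rewrite addn0 addn1 addrC.
rewrite (IH (fun u => (f (u + u)%N + f (u + u).+1) / 2)) -mulr_suml.
by rewrite addn1 expnS mul2n -addnn big_ord_double exprS invfM mulrA.
Qed.

Lemma sum_mod_mul (R : realType) q r (f : nat -> R) :
  \sum_(u < q * r) f (u %% r)%N = q%:R * \sum_(j < r) f j.
Proof.
elim: q => [|q IH]; first by rewrite mul0n big_ord0 mul0r.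
rewrite mulSnr big_split_ord /= IH -natr1 mulrDl mul1r; congr (_ + _).
by apply: eq_bigr => j _; rewrite modnMDl modn_small.
Qed.

(** [U] lies between consecutive multiples of [r], and on a multiple of [r] the residue is exactly
    uniform. *)
Lemma sum_mod_bounds (R : realType) U r (f : nat -> R) : (0 < r)%N -> (forall j, 0 <= f j) ->
  (U %/ r)%:R * \sum_(j < r) f j <= \sum_(u < U) f (u %% r)%N
     <= (U %/ r).+1%:R * \sum_(j < r) f j.
Proof.
move=> r0 f0; rewrite -!sum_mod_mul.
have mono a b : (a <= b)%N -> \sum_(u < a) f (u %% r)%N <= \sum_(u < b) f (u %% r)%N.
  by move=> /subnKC <-; rewrite big_split_ord /= lerDl sumr_ge0.
by rewrite !mono ?leq_divM // ltnW // ltn_ceil.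
Qed.

(** The size [r] of the list times the probability of a candidate differs from 1 by at most
    [r / 2^b <= n / 2^b]. For the empty list all three terms vanish. *)
Lemma cmean_pick_bounds (R : realType) n b s (f : nat -> R) : (size s <= n)%N ->
  (forall j, 0 <= f j) -> forall x : R, x = n%:R / 2 ^+ b ->
  (1 - x) * (\sum_(c <- s) f c) <=
    (size s)%:R * cmean b (fun w => f (pick_nth s (draw b w))) <= (1 + x) * \sum_(c <- s) f c.
Proof.
move=> sn f0 x ->; set r := size s; set S := \sum_(c <- s) f c.
have S0 : 0 <= S by exact: sumr_ge0.
have U0 : 0 < 2 ^+ b :> R by rewrite exprn_gt0.
have [r0|r0] := posnP r.
  by rewrite /S (size0nil r0) big_nil r0 !mulr0 mul0r lexx.
rewrite (cmean_draw b (fun u => f (pick_nth s u))) /pick_nth -/r.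
have := sum_mod_bounds (2 ^ b) r0 (fun j => f0 (nth 0%N s j)).
have -> : \sum_(j < r) f (nth 0%N s j) = S by rewrite /S (big_nth 0%N) big_mkord.
set A := \sum_(u < _) _ => /andP[lo hi].
have e2 : (2 ^ b)%N%:R = 2 ^+ b :> R by rewrite natrX.
have rn : r%:R <= n%:R :> R by rewrite ler_nat.
have q1 : 2 ^+ b - n%:R <= r%:R * (2 ^ b %/ r)%:R :> R.
  have : (2 ^ b)%N%:R <= (r * (2 ^ b %/ r) + n)%:R :> R.
    by rewrite ler_nat {1}(divn_eq (2 ^ b) r) mulnC leq_add2l (leq_trans (ltnW (ltn_pmod _ r0))).
  by rewrite e2 natrD natrM => h; rewrite lerBlDr.
have q2 : r%:R * (2 ^ b %/ r).+1%:R <= 2 ^+ b + n%:R :> R.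
  rewrite -natrM mulnS natrD addrC lerD // -e2 ler_nat mulnC; exact: leq_divM.
rewrite mulrA ler_pdivlMr // ler_pdivrMr //.
have -> : (1 - n%:R / 2 ^+ b) * S * 2 ^+ b = (2 ^+ b - n%:R) * S by field; rewrite lt0r_neq0.
have -> : (1 + n%:R / 2 ^+ b) * S * 2 ^+ b = (2 ^+ b + n%:R) * S by field; rewrite lt0r_neq0.
have r0' : 0 <= r%:R :> R by [].
apply/andP; split.
  apply: le_trans (ler_wpM2r S0 q1) _; rewrite -mulrA; exact: ler_wpM2l.
by apply: le_trans (ler_wpM2l r0' hi) _; rewrite mulrA; exact: ler_wpM2r.
Qed.

(** A sum over the leaves of the search tree of the product of [f] over all branching numbers:
    [f r = r ^ 0] counts the leaves, [f r = r ^ 1] adds up the estimates [X] returned at them. *)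
Fixpoint tree (R : realType) (n N : nat) (g : nat -> nat -> bool) (f : nat -> R) (d : nat)
    (h : seq (nat * nat)) : R :=
  if d is d'.+1 then
    \sum_(v <- vcand n h) \sum_(i <- rcand N g h v)
      f (size (vcand n h)) * f (size (rcand N g h v)) * tree n N g f d' (rcons h (v, i))
  else 1.

Lemma tree_ge0 (R : realType) n N g (f : nat -> R) d h : (forall r, 0 <= f r) ->
  0 <= tree n N g f d h.
Proof.
by move=> f0; elim: d h => //= d IH h; do 2 apply: sumr_ge0 => ? _; rewrite !mulr_ge0.
Qed.

Lemma size_vcand n h : (size (vcand n h) <= n)%N.
Proof. by rewrite size_filter (leq_trans (count_size _ _)) // size_rev size_iota. Qed.

Lemma size_rcand N g h v : (size (rcand N g h v) <= N)%N.
Proof. by rewrite size_filter (leq_trans (count_size _ _)) // size_rev size_iota. Qed.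

(** With exact draws a leaf is reached with probability [1 / X], so in the moment of order [e + 1]
    it weighs [X ^ e]. Two draws per step give the exponent [d + d]; [x <= 1] keeps the lower
    factors nonnegative. *)
Lemma cmean_trial_bounds (R : realType) n N b g e d h : (N <= n)%N ->
  let x := n%:R / 2 ^+ b : R in x <= 1 ->
  (1 - x) ^+ (d + d) * tree n N g (fun r => r%:R ^+ e) d h <=
    cmean (d * (b + b)) (fun w => (trial n N b g d h w)%:R ^+ e.+1) <=
  (1 + x) ^+ (d + d) * tree n N g (fun r => r%:R ^+ e) d h.
Proof.
move=> Nn x x1; have x0 : 0 <= x by rewrite divr_ge0 // exprn_ge0.
have y0 : 0 <= 1 - x by rewrite subr_ge0.
have z0 : 0 <= 1 + x by rewrite addr_ge0.
elim: d h => [|d IH] h; first by rewrite /= expr1n expr0 !mul1r lexx.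
rewrite mulSn -addnA !cmean_add.
set s1 := vcand n h.
pose E2 v i : R := cmean (d * (b + b)) (fun w => (trial n N b g d (rcons h (v, i)) w)%:R ^+ e.+1).
pose E1 v := (size (rcand N g h v))%:R ^+ e * ((size (rcand N g h v))%:R *
   cmean b (fun w => E2 v (pick_nth (rcand N g h v) (draw b w)))).
have -> : cmean b (fun u => cmean (b + d * (b + b))
     (fun v => (trial n N b g d.+1 h (u ++ v))%:R ^+ e.+1)) =
   cmean b (fun u => (size s1)%:R ^+ e.+1 * E1 (pick_nth s1 (draw b u))).
  apply: eq_cmean => u bu; rewrite cmean_add /E1 [X in _ = _ * X]mulrA -exprSr mulrA -cmeanZ.
  apply: eq_cmean => u' bu'; rewrite /E2 -cmeanZ; apply: eq_cmean => w _.
  rewrite /= !draw_cat ?bu // -/s1 [drop b _]drop_size_cat // draw_cat ?bu' //.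
  by rewrite catA drop_size_cat ?size_cat ?bu ?bu' // !natrM !exprMn.
have E20 v i : 0 <= E2 v i by apply: cmean_ge0 => w; rewrite exprn_ge0.
have E10 v : 0 <= E1 v by rewrite !mulr_ge0 ?exprn_ge0 // cmean_ge0.
rewrite cmeanZ exprSr -mulrA.
have /andP[lo1 hi1] := cmean_pick_bounds (size_vcand n h) E10 (erefl x).
have rn v : (size (rcand N g h v) <= n)%N by exact: leq_trans (size_rcand _ _ _ _) Nn.
have S0 : 0 <= (size s1)%:R ^+ e :> R by rewrite exprn_ge0.
have expE (y : R) : y ^+ (d.+1 + d.+1) = y * (y * y ^+ (d + d)).
  by rewrite addSn addnS !exprS.
rewrite -/s1 -/x in lo1 hi1.
apply/andP; split.
- apply: le_trans (ler_wpM2l S0 lo1); rewrite expE /= -/s1 -mulrA [X in _ <= X]mulrCA; apply: ler_wpM2l => //.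
  rewrite !mulr_sumr; apply: ler_sum => v _; rewrite mulr_sumr.
  have /andP[lo2 _] := cmean_pick_bounds (rn v) (E20 v) (erefl x).
  apply: le_trans (ler_wpM2l S0 (ler_wpM2l _ lo2)); last by rewrite exprn_ge0.
  rewrite !mulr_sumr; apply: ler_sum => i _; have /andP[lo3 _] := IH (rcons h (v, i)).
  rewrite -!mulrA [X in X <= _](_ : _ = (size s1)%:R ^+ e * ((size (rcand N g h v))%:R ^+ e *
    ((1 - x) * ((1 - x) ^+ (d + d) * tree n N g (fun r => r%:R ^+ e) d (rcons h (v, i)))))); last by ring.
  by rewrite !(ler_wpM2l, exprn_ge0).
- apply: le_trans (ler_wpM2l S0 hi1) _; rewrite expE /= -/s1 -mulrA [X in X <= _]mulrCA; apply: ler_wpM2l => //.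
  rewrite !mulr_sumr; apply: ler_sum => v _; rewrite mulr_sumr.
  have /andP[_ hi2] := cmean_pick_bounds (rn v) (E20 v) (erefl x).
  apply: le_trans (ler_wpM2l S0 (ler_wpM2l _ hi2)) _; first by rewrite exprn_ge0.
  rewrite !mulr_sumr; apply: ler_sum => i _; have /andP[_ hi3] := IH (rcons h (v, i)).
  rewrite -!mulrA [X in _ <= X](_ : _ = (size s1)%:R ^+ e * ((size (rcand N g h v))%:R ^+ e *
    ((1 + x) * ((1 + x) ^+ (d + d) * tree n N g (fun r => r%:R ^+ e) d (rcons h (v, i)))))); last by ring.
  by rewrite !(ler_wpM2l, exprn_ge0).
Qed.

Lemma drop_cat_le (T : Type) k (u v : seq T) : (k <= size u)%N -> drop k (u ++ v) = drop k u ++ v.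
Proof.
rewrite drop_cat leq_eqVlt => /orP[/eqP ->|-> //].
by rewrite ltnn subnn drop0 drop_size.
Qed.

Lemma trial_cat n N b g d h u v : (d * (b + b) <= size u)%N ->
  trial n N b g d h (u ++ v) = trial n N b g d h u.
Proof.
elim: d h u => //= d IH h u; rewrite mulSn => le.
have bu : (b + b <= size u)%N by rewrite (leq_trans _ le) ?leq_addr.
have bu' : (b <= size u)%N by rewrite (leq_trans _ bu) ?leq_addr.
rewrite draw_cat // drop_cat_le // draw_cat ?size_drop ?leq_subRL //.
by rewrite drop_cat_le // IH // size_drop leq_subRL.
Qed.

Lemma sums_cat n N b g T u v : (T * (n * (b + b)) <= size u)%N ->
  sums n N b g T (u ++ v) = sums n N b g T u.
Proof.
elim: T u => //= T IH u; rewrite mulSn => le.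
have bu : (n * (b + b) <= size u)%N by rewrite (leq_trans _ le) ?leq_addr.
by rewrite trial_cat // drop_cat_le // IH // size_drop leq_subRL.
Qed.

(** The trials read disjoint blocks of coins, so the cross terms vanish and the variances add up;
    each variance is at most the second moment. *)
Lemma cmean_sums_moments (R : realType) n N b g T (mu : R) :
  let f w : R := (trial n N b g n [::] w)%:R in
  let F := (n * (b + b))%N in mu = cmean F f ->
  let S T w : R := (sums n N b g T w)%:R - T%:R * mu in
  cmean (T * F) (S T) = 0 /\
  cmean (T * F) (fun w => S T w ^+ 2) <= T%:R * cmean F (fun w => f w ^+ 2).
Proof.
move=> f F muE S.
have SE k u v : size u = F -> S k.+1 (u ++ v) = (f u - mu) + S k v.
  move=> uF; rewrite /S /f /= trial_cat ?uF // drop_size_cat ?uF // natrD -natr1 mulrDl mul1r.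
  by ring.
have E1 : cmean F (fun u => f u - mu) = 0.
  by rewrite cmeanD cmean_const -muE subrr.
have E2 : cmean F (fun u => (f u - mu) ^+ 2) <= cmean F (fun u => f u ^+ 2).
  have -> : cmean F (fun u => (f u - mu) ^+ 2) =
      cmean F (fun u => f u ^+ 2 + ((- 2 * mu) * f u + mu ^+ 2)).
    by apply: eq_cmean => u _; ring.
  rewrite cmeanD cmeanD cmeanZ cmean_const -muE gerDl.
  rewrite (_ : _ + _ = - mu ^+ 2); last by ring.
  by rewrite oppr_le0 sqr_ge0.
have S0 w : S 0%N w = 0 by rewrite /S mul0r subrr.
clearbody S; elim: T => [|T [IH1 IH2]].
  by rewrite /= S0 expr0n /= mul0r lexx.
rewrite mulSn !cmean_add; split.
  rewrite -E1; apply: eq_cmean => u uF.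
  by rewrite (eq_cmean (g := fun v => (f u - mu) + S T v)) ?cmeanD ?cmean_const ?IH1 ?addr0 // => v _; rewrite SE.
rewrite (eq_cmean (g := fun u => (f u - mu) ^+ 2 + cmean (T * F) (fun w => S T w ^+ 2))); last first.
  move=> u uF; rewrite (eq_cmean (g := fun v => (f u - mu) ^+ 2 + ((2 * (f u - mu)) * S T v + S T v ^+ 2))); last first.
    by move=> v _; rewrite SE //; ring.
  by rewrite cmeanD cmean_const cmeanD cmeanZ IH1 mulr0 add0r.
rewrite cmeanD cmean_const -natr1 mulrDl mul1r addrC.
by rewrite lerD.
Qed.

(** Half of [eps] pays for the bias, the other half is the threshold [T * (eps / 2) * L] in
    Chebyshev's inequality. The second moment of a trial is at most [(1 + eta) * M <= 2 * M];
    dividing [T * (2 * M)] by the squared threshold produces the 8. *)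
Lemma cmean_sums_success (R : realType) n N b g T t (eta eps : R) : (N <= n)%N ->
  let x := n%:R / 2 ^+ b : R in x <= 1 ->
  (1 + x) ^+ (n + n) <= 1 + eta -> 1 - eta <= (1 - x) ^+ (n + n) ->
  0 < eps -> eta <= eps / 2 -> eta <= 1 -> (0 < T)%N -> (T * (n * (b + b)) <= t)%N ->
  let L := tree n N g (fun r => r%:R ^+ 0) n [::] : R in
  let M := tree n N g (fun r => r%:R ^+ 1) n [::] : R in 0 < L ->
  1 - 8 * M / (T%:R * eps ^+ 2 * L ^+ 2) <=
  cmean t (fun w => ((`|(sums n N b g T w)%:R / T%:R - L| <= eps * L)%R)%:R).
Proof.
move=> Nn x x1 hi lo eps0 etae eta1 T0 tF L M L0.
set F := (n * (b + b))%N; pose f w : R := (trial n N b g n [::] w)%:R.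
pose mu := cmean F f; pose s := cmean F (fun w => f w ^+ 2).
have M0 : 0 <= M by apply: tree_ge0 => r; rewrite exprn_ge0.
have TR : 0 < T%:R :> R by rewrite ltr0n.
have muL : `|mu - L| <= eta * L.
  have /andP[] := cmean_trial_bounds g 0 n [::] Nn x1; rewrite -/L -/F -/x => l1 l2.
  have {}l1 : (1 - eta) * L <= mu by apply: le_trans l1; apply: ler_wpM2r; [exact: ltW | exact: lo].
  have {}l2 : mu <= (1 + eta) * L.
    by apply: le_trans l2 _; apply: ler_wpM2r; [exact: ltW | exact: hi].
  by rewrite ler_norml; apply/andP; split; lra.
have sM : s <= 2 * M.
  have /andP[_ l2] := cmean_trial_bounds g 1 n [::] Nn x1.
  apply: le_trans l2 _; apply: ler_wpM2r => //; apply: le_trans hi _; lra.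
have [_ var] := @cmean_sums_moments R n N b g T mu erefl.
rewrite -/F -/f -/s in var.
pose S w : R := (sums n N b g T w)%:R - T%:R * mu.
pose a := T%:R * (eps / 2 * L).
have a0 : 0 < a by rewrite !mulr_gt0 // invr_gt0.
rewrite -(subnKC tF) cmean_add.
rewrite (eq_cmean (g := fun w => ((`|(sums n N b g T w)%:R / T%:R - L| <= eps * L)%R)%:R)); last first.
  move=> u uF; rewrite -[RHS](cmean_const (t - T * (n * (b + b)))); apply: eq_cmean => v _.
  by rewrite sums_cat ?uF.
(* Chebyshev pointwise: the indicator of success is at least [1 - S ^ 2 / a ^ 2]. *)
apply: (@le_trans _ _ (cmean (T * F) (fun w => 1 + - (a ^+ 2)^-1 * S w ^+ 2))).
  rewrite cmeanD cmean_const cmeanZ lerD2l -mulNr mulNr mulNr lerN2.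
  apply: le_trans (ler_wpM2l _ var) _; first by rewrite invr_ge0 exprn_ge0 // ltW.
  apply: (@le_trans _ _ ((a ^+ 2)^-1 * (T%:R * (2 * M)))).
    by apply: ler_wpM2l; [rewrite invr_ge0 exprn_ge0 // ltW | exact: ler_wpM2l].
  rewrite /a le_eqVlt; apply/orP; left; apply/eqP; field.
  by rewrite !lt0r_neq0.
apply: cmean_le => w _; set D := `|_|; case: (lerP D (eps * L)) => [_|bad] /=.
  by rewrite mulNr gerDl oppr_le0 mulr_ge0 ?invr_ge0 ?sqr_ge0.
rewrite mulNr subr_le0 mulrC ler_pdivlMr ?exprn_gt0 // mul1r.
rewrite -(real_normK (num_real (S w))) ler_sqr ?nnegrE ?normr_ge0 ?ltW //.
have -> : S w = T%:R * ((sums n N b g T w)%:R / T%:R - mu).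
  by rewrite /S; field; rewrite lt0r_neq0.
rewrite normrM (gtr0_norm TR) /a ltr_pM2l //.
have := ler_distD mu ((sums n N b g T w)%:R / T%:R) L; rewrite -/D => tri.
have etaL : eta * L <= eps / 2 * L by rewrite ler_pM2r.
by move: bad muL tri etaL; lra.
Qed.

(** * Independent random subsets *)

(** The random graph is the case [D = pairs n]; with [D = setT] the same measure describes the
    bipartite graphs of the columns. *)
Definition bweight (R : realType) (q : R) (I : finType) (D A : {set I}) : R :=
  \prod_(e in D) (if e \in A then q else 1 - q).

Definition bmean (R : realType) (q : R) (I : finType) (D : {set I}) (F : {set I} -> R) : R :=
  \sum_(A in powerset D) bweight q D A * F A.

Lemma sum_powerset_prod (R : realType) (I : finType) (D : {set I}) (x y : I -> R) :
  \sum_(A in powerset D) \prod_(e in D) (if e \in A then x e else y e) =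
  \prod_(e in D) (x e + y e).
Proof.
rewrite [RHS]big_mkcond /=.
rewrite (eq_bigr (fun e => (if e \in D then x e else 0) + (if e \in D then y e else 1))); last first.
  by move=> e _; case: ifP => // _; rewrite add0r.
rewrite bigA_distr /= big_mkcond [RHS]big_mkcond /=; apply: eq_bigr => A _.
rewrite powersetE; case: ifPn => [/subsetP AD|/subsetPn[e eA eD]].
  rewrite big_mkcond /=; apply: eq_bigr => e _.
  by have [eA|eA] := boolP (e \in A); [rewrite (AD _ eA) | case: ifP].
by rewrite (bigD1 e) //= eA (negPf eD) mul0r.
Qed.

Lemma bmean_const (R : realType) (q : R) (I : finType) (D : {set I}) (c : R) :
  bmean q D (fun=> c) = c.
Proof.
rewrite /bmean -mulr_suml /bweight sum_powerset_prod big1 ?mul1r // => e _; ring.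
Qed.

Lemma bmeanD (R : realType) (q : R) (I : finType) (D : {set I}) (F G : {set I} -> R) :
  bmean q D (fun A => F A + G A) = bmean q D F + bmean q D G.
Proof. by rewrite /bmean -big_split; apply: eq_bigr => A _; rewrite mulrDr. Qed.

Lemma bmeanZ (R : realType) (q : R) (I : finType) (D : {set I}) (c : R) (F : {set I} -> R) :
  bmean q D (fun A => c * F A) = c * bmean q D F.
Proof. by rewrite /bmean mulr_sumr; apply: eq_bigr => A _; rewrite mulrCA. Qed.

Lemma bmean_sum (R : realType) (q : R) (I J : finType) (D : {set I}) (P : pred J)
    (F : J -> {set I} -> R) :
  bmean q D (fun A => \sum_(j | P j) F j A) = \sum_(j | P j) bmean q D (F j).
Proof. by rewrite /bmean exchange_big; apply: eq_bigr => A _; rewrite mulr_sumr. Qed.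

Lemma eq_bmean (R : realType) (q : R) (I : finType) (D : {set I}) (F G : {set I} -> R) :
  (forall A : {set I}, A \subset D -> F A = G A) -> bmean q D F = bmean q D G.
Proof. by move=> FG; apply: eq_bigr => A; rewrite powersetE => /FG ->. Qed.

Lemma bweight_ge0 (R : realType) (q : R) (I : finType) (D A : {set I}) : 0 <= q <= 1 ->
  0 <= bweight q D A.
Proof.
by move=> /andP[q0 q1]; apply: prodr_ge0 => e _; case: ifP => // _; rewrite subr_ge0.
Qed.

Lemma bmean_le (R : realType) (q : R) (I : finType) (D : {set I}) (F G : {set I} -> R) :
  0 <= q <= 1 -> (forall A : {set I}, A \subset D -> F A <= G A) -> bmean q D F <= bmean q D G.
Proof.
move=> q01 FG; apply: ler_sum => A; rewrite powersetE => /FG.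
by apply: ler_wpM2l; exact: bweight_ge0.
Qed.

(** The event is imposed by giving weight 0 to the absence of an element of [B], which keeps the sum
    in product form. *)
Lemma bmean_superset (R : realType) (q : R) (I : finType) (D B : {set I}) : B \subset D ->
  bmean q D (fun A => (B \subset A)%:R) = q ^+ #|B|.
Proof.
move=> BD; transitivity (\sum_(A in powerset D) \prod_(e in D)
    (if e \in A then q else if e \in B then 0 else 1 - q)).
  apply: eq_bigr => A _; case: (boolP (B \subset A)) => [/subsetP BA|/subsetPn[e eB eA]] /=.
    rewrite mulr1; apply: eq_bigr => e _; case: ifPn => // eA.
    by case: ifPn => // /BA; rewrite (negPf eA).
  by rewrite mulr0 (bigD1 e) ?(subsetP BD) //= (negPf eA) eB mul0r.
rewrite sum_powerset_prod (bigID (mem B)) /= [X in _ * X]big1 ?mulr1; last first.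
  by move=> e /andP[_ /negPf ->]; ring.
rewrite (eq_bigl (fun e => e \in B)); last first.
  by move=> e /=; have [/(subsetP BD) ->|] := boolP (e \in B); rewrite ?andbF.
by rewrite -prodr_const; apply: eq_bigr => e ->; rewrite addr0.
Qed.

(** Expanding the product leaves events of the form that a union of blocks lies in [A]; disjointness
    multiplies their probabilities. Affine factors are general enough to express every function of
    the indicators. *)
Lemma bmean_indep (R : realType) (q : R) (I C : finType) (D : {set I}) (B : C -> {set I})
    (a b : C -> R) :
  (forall c, B c \subset D) -> (forall c d e, e \in B c -> e \in B d -> c = d) ->
  bmean q D (fun A => \prod_c (b c * (B c \subset A)%:R + a c)) =
  \prod_c (b c * q ^+ #|B c| + a c).
Proof.
move=> BD Bdisj; under eq_bmean => A _ do rewrite bigA_distr /=.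
rewrite bmean_sum bigA_distr /=; apply: eq_bigr => J _.
pose U := \bigcup_(c in J) B c.
have UE : \prod_(c in J) q ^+ #|B c| = q ^+ #|U|.
  have -> : #|U| = (\sum_(c in J) #|B c|)%N.
    rewrite /U big_mkcond -sum1_card partition_disjoint_bigcup /=.
      rewrite [RHS]big_mkcond; apply: eq_bigr => c _.
      by case: ifP => _; rewrite sum1_card ?cards0.
    move=> c d /negP cd; rewrite -setI_eq0; apply/eqP/setP => e; rewrite !inE.
    apply/negbTE/negP => /andP[]; case: ifP; rewrite ?inE // => _ ec; case: ifP; rewrite ?inE // => _ ed.
    by apply: cd; rewrite (Bdisj _ _ _ ec ed).
  by rewrite expr_sum.
pose k := \prod_c (if c \in J then b c else a c).
transitivity (bmean q D (fun A => k * (U \subset A)%:R)).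
  apply: eq_bmean => A _; have -> : (U \subset A)%:R = \prod_(c in J) (B c \subset A)%:R :> R.
    case: (boolP (U \subset A)) => [/bigcupsP UA|/bigcupsP UA] /=.
      by rewrite big1 // => c /UA ->.
    case: (boolP [forall (c | c \in J), B c \subset A]) => [/forall_inP H|]; first by case: UA.
    by rewrite negb_forall_in => /exists_inP[c cJ /negPf cA]; rewrite (bigD1 c) //= cA mul0r.
  rewrite [X in _ * X]big_mkcond -big_split /=; apply: eq_bigr => c _.
  by case: ifP => // _; rewrite mulr1.
rewrite bmeanZ bmean_superset -?UE; last by apply/bigcupsP.
rewrite [X in _ * X]big_mkcond -big_split /=; apply: eq_bigr => c _.
by case: ifP => // _; rewrite mulr1.
Qed.

(** Containment of disjoint blocks gives independent events, so the derived random sets are again of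
    the kind averaged by [bmean], now with density [q ^ s c]. *)
Lemma bmean_blocks (R : realType) (q : R) (I J X : finType) (D : {set I})
    (B : J -> X -> {set I}) (s : J -> nat) (F : J -> {set X} -> R) :
  (forall c x, B c x \subset D) ->
  (forall c d x y e, e \in B c x -> e \in B d y -> c = d /\ x = y) ->
  (forall c x, #|B c x| = s c) ->
  bmean q D (fun A => \prod_c F c [set x | B c x \subset A]) =
  \prod_c bmean (q ^+ s c) setT (F c).
Proof.
move=> BD Bdisj Bs.
(* Interpolation: the product is the indicator of [S = Y], with a factor affine in the indicator of
   [x \in Y] for each [x], as required by [bmean_indep]. *)
have FE c (Y : {set X}) : F c Y = \sum_(S : {set X}) F c S *
    \prod_x ((if x \in S then 1 else -1) * (x \in Y)%:R + (if x \in S then 0 else 1)).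
  rewrite (bigD1 Y) //= [X in _ + X]big1 ?addr0; last first.
    move=> S; rewrite finset.eqEsubset negb_and => /orP[] /subsetPn[x xS xY].
      by rewrite (bigD1 x) //= xS (negPf xY) mulr0 add0r mul0r mulr0.
    by rewrite (bigD1 x) //= xS (negPf xY) mulr1 addNr mul0r mulr0.
  rewrite big1 ?mulr1 // => x _.
  by case: (x \in Y); rewrite ?mulr1 ?addr0 // mulr0 add0r.
under eq_bmean => A _.
  under eq_bigr => c _ do rewrite FE.
  rewrite bigA_distr_bigA /=.
  over.
rewrite bmean_sum.
transitivity (\prod_c \sum_(S : {set X}) F c S *
   \prod_x ((if x \in S then 1 else -1) * q ^+ s c + (if x \in S then 0 else 1))); last first.
  apply: eq_bigr => c _; rewrite /bmean; under [RHS]eq_bigl => S do rewrite powersetE subsetT.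
  apply: eq_bigr => S _; rewrite mulrC /bweight; congr (_ * _).
  under [RHS]eq_bigl => x do rewrite in_setT.
  by apply: eq_bigr => x _; case: ifP => _; ring.
rewrite bigA_distr_bigA /=; apply: eq_bigr => f _.
pose a (y : J * X) : R := if y.2 \in f y.1 then 0 else 1.
pose b (y : J * X) : R := if y.2 \in f y.1 then 1 else -1.
transitivity (bmean q D (fun A => (\prod_c F c (f c)) *
    \prod_y (b y * (B y.1 y.2 \subset A)%:R + a y))).
  apply: eq_bmean => A _; rewrite big_split /=; congr (_ * _).
  rewrite -(pair_bigA _ (fun c x => b (c, x) * (B c x \subset A)%:R + a (c, x))) /=.
  by apply: eq_bigr => c _; apply: eq_bigr => x _; rewrite inE.
rewrite bmeanZ (@bmean_indep _ _ _ _ D (fun y : J * X => B y.1 y.2)) //; last first.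
  by move=> [c x] [d y] e /= ec ed; have [-> ->] := Bdisj _ _ _ _ _ ec ed.
rewrite big_split /=; congr (_ * _).
rewrite -(pair_bigA _ (fun c x => b (c, x) * q ^+ #|B c x| + a (c, x))) /=.
by apply: eq_bigr => c _; apply: eq_bigr => x _; rewrite Bs.
Qed.

Lemma bmean_split (R : realType) (q : R) (I : finType) (i : I) (F : {set I} -> R) :
  bmean q setT F =
  q * bmean q setT (fun A => F (i |: A)) + (1 - q) * bmean q setT (fun A => F (A :\ i)).
Proof.
have sumE (f : {set I} -> R) : \sum_(A in powerset setT) f A =
    \sum_(A : {set I} | i \notin A) (f (i |: A) + f A).
  under eq_bigl => A do rewrite powersetE subsetT.
  rewrite (bigID (fun A : {set I} => i \in A)) big_split /=; congr (_ + _).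
  rewrite (reindex_onto (fun A => i |: A) (fun A => A :\ i)) /=; last by move=> A; exact: setD1K.
  apply: eq_bigl => A; rewrite setU11 /=; have [iA|iA] := boolP (i \in A).
    by apply/negbTE/negP => /eqP eA; move: iA; rewrite -eA !inE eqxx.
  by rewrite setU1K ?eqxx.
rewrite -!bmeanZ -bmeanD /bmean !sumE; apply: eq_bigr => A iA.
have wE (B : {set I}) : bweight q [set: I] B =
    (if i \in B then q else 1 - q) * \prod_(e | e != i) (if e \in B then q else 1 - q).
  rewrite /bweight (bigD1 i) ?inE //=; congr (_ * _).
  by apply: eq_bigl => e; rewrite inE.
have -> : bweight q setT (i |: A) = q * \prod_(e | e != i) (if e \in A then q else 1 - q).
  rewrite wE setU11; congr (_ * _); apply: eq_bigr => e /negPf ei.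
  by rewrite !inE ei.
rewrite wE (negPf iA) setUA setUid setU1K // (_ : A :\ i = A); first by ring.
by apply/setP => e; rewrite !inE; case: eqP => // ->; rewrite (negPf iA).
Qed.

(** * Binomial moments *)

Fixpoint binmean (R : realType) (q : R) (m : nat) (f : nat -> R) : R :=
  if m is m'.+1 then q * binmean q m' (fun r => f r.+1) + (1 - q) * binmean q m' f
  else f 0%N.

Lemma eq_binmean (R : realType) (q : R) m (f g : nat -> R) : f =1 g -> binmean q m f = binmean q m g.
Proof. by move=> fg; elim: m f g fg => [|m IH] f g fg /=; rewrite ?fg // (IH f g) // (IH _ (fun r => g r.+1)). Qed.

Lemma binmean_le (R : realType) (q : R) m (f g : nat -> R) : 0 <= q <= 1 ->
  (forall r, f r <= g r) -> binmean q m f <= binmean q m g.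
Proof.
move=> /andP[q0 q1]; elim: m f g => [|m IH] f g fg /=; first exact: fg.
by apply: lerD; apply: ler_wpM2l; rewrite ?subr_ge0 // IH.
Qed.

Lemma binmean_const (R : realType) (q : R) m (c : R) : binmean q m (fun=> c) = c.
Proof. by elim: m => //= m ->; ring. Qed.

Lemma binmeanD (R : realType) (q : R) m (f g : nat -> R) :
  binmean q m (fun r => f r + g r) = binmean q m f + binmean q m g.
Proof. by elim: m f g => //= m IH f g; rewrite !IH; ring. Qed.

Lemma binmeanZ (R : realType) (q : R) m c (f : nat -> R) :
  binmean q m (fun r => c * f r) = c * binmean q m f.
Proof. by elim: m f => //= m IH f; rewrite !IH; ring. Qed.

Lemma bmean_card (R : realType) (q : R) (I : finType) (B : {set I}) (f : nat -> R) :
  bmean q setT (fun A => f #|A :&: B|) = binmean q #|B| f.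
Proof.
move Dm: #|B| => m; elim: m B Dm f => [|m IH] B Dm f.
  rewrite (eq_bmean q (G := fun=> f 0%N)) ?bmean_const // => A _.
  by rewrite (cards0_eq Dm) finset.setI0 cards0.
have /card_gt0P[i iB] : (0 < #|B|)%N by rewrite Dm.
have Di : #|B :\ i| = m by move: Dm; rewrite (cardsD1 i B) iB add1n => -[].
rewrite (bmean_split q i) /= -(IH _ Di (fun r => f r.+1)) -(IH _ Di f).
congr (_ * _ + _ * _); apply: eq_bmean => A _; congr f.
  by rewrite -[in LHS](finset.setD1K iB) -finset.setUIr cardsU1 !inE eqxx andbF /= add1n.
by apply: eq_card => e; rewrite !inE; case: (e == i); rewrite ?andbF.
Qed.

(** Given that [i] belongs to [A], the other elements of [B] in [A] are binomial with one trial
    fewer. *)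
Lemma bmean_mem_card (R : realType) (q : R) (I : finType) (B : {set I}) i (f : nat -> R) :
  i \in B -> bmean q setT (fun A => (i \in A)%:R * f #|A :&: B|) =
    q * binmean q #|B|.-1 (fun r => f r.+1).
Proof.
move=> iB; rewrite (bmean_split q i) (eq_bmean q (F := fun A => (i \in A :\ i)%:R * _) (G := fun=> 0)); last first.
  by move=> A _; rewrite !inE eqxx mul0r.
rewrite bmean_const mulr0 addr0 (cardsD1 i B) iB add1n /= -bmean_card; congr (_ * _).
apply: eq_bmean => A _; rewrite setU11 mul1r; congr f.
by rewrite -[in LHS](finset.setD1K iB) -finset.setUIr cardsU1 !inE eqxx andbF /= add1n.
Qed.

(** The size-bias identity of the binomial law; applied to functions with a factor [1 / r] it
    removes a denominator. *)
Lemma binmean_size_bias (R : realType) (q : R) m (f : nat -> R) :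
  m.+1%:R * q * binmean q m (fun r => f r.+1) = binmean q m.+1 (fun r => r%:R * f r).
Proof.
elim: m f => [|m IH] f; first by rewrite /=; ring.
have -> : binmean q m.+2 (fun r => r%:R * f r) = q * binmean q m.+1 (fun r => r.+1%:R * f r.+1) +
   (1 - q) * binmean q m.+1 (fun r => r%:R * f r) by [].
rewrite -IH [X in _ = q * X + _](eq_binmean _ _ (g := fun r => r%:R * f r.+1 + f r.+1)); last first.
  by move=> r /=; rewrite -natr1; ring.
rewrite binmeanD -(IH (fun r => f r.+1)) /= -[m.+2%:R]natr1; ring.
Qed.

(** Size biasing applied to [f r / r]; the only loss is the term [r = 0]. *)
Lemma binmean_div_le (R : realType) (q : R) m (f : nat -> R) : 0 < q <= 1 ->
  (forall r, 0 <= f r) ->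
  binmean q m (fun r => f r.+1 / r.+1%:R) <= binmean q m.+1 f / (m.+1%:R * q).
Proof.
move=> /andP[q0 q1] f0; rewrite ler_pdivlMr ?mulr_gt0 // mulrC.
rewrite (binmean_size_bias q m (fun r => f r / r%:R)).
apply: binmean_le => [|r]; first by rewrite ltW.
have [->|r0] := eqVneq r 0%N; first by rewrite mul0r.
by rewrite mulrC divfK // pnatr_eq0.
Qed.

Lemma binmean_gt0 (R : realType) (q : R) m : binmean q m (fun r => (0 < r)%N%:R) = 1 - (1 - q) ^+ m.
Proof.
elim: m => [|m IH] /=; first by rewrite subrr.
by rewrite IH binmean_const exprS; ring.
Qed.

Lemma binmean_inv (R : realType) (q : R) m : 0 < q ->
  q * binmean q m (fun r => r.+1%:R^-1) = (1 - (1 - q) ^+ m.+1) / m.+1%:R.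
Proof.
move=> q0; rewrite -binmean_gt0.
have := binmean_size_bias q m (fun r => r%:R^-1).
rewrite (eq_binmean (f := fun r => r%:R * r%:R^-1) _ _ (g := fun r => (0 < r)%N%:R)).
  by move=> <-; rewrite -mulrA [RHS]mulrC mulKf ?pnatr_eq0.
by move=> [|r]; rewrite ?mul0r //= divff // pnatr_eq0.
Qed.

(* From 1/y^2 <= 1/(y (y+1)) + 3/(y (y+1) (y+2)) for y >= 1: the leading term must
   be exact, since the bounds for all m are multiplied together. *)
Lemma binmean_inv_sqr (R : realType) (q : R) m : 0 < q <= 1 ->
  q * binmean q m (fun r => r.+1%:R^-1 ^+ 2) <=
  (m.+1%:R ^+ 2 * q)^-1 * (1 + 3 / (m.+1%:R * q)).
Proof.
move=> q01; have /andP[q0 q1] := q01.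
have m0 : 0 < m.+1%:R :> R by [].
have b1 k : binmean q k (fun r => r.+1%:R^-1) <= (k.+1%:R * q)^-1.
  have := binmean_div_le k q01 (f := fun=> 1) (fun=> ler01).
  by rewrite binmean_const div1r; under eq_binmean => r do rewrite div1r.
have b2 k : binmean q k (fun r => r.+2%:R^-1 / r.+1%:R) <= (k.+1%:R * q)^-1 * (k.+1%:R * q)^-1.
  apply: le_trans (@binmean_div_le _ q k (fun r => r.+1%:R^-1) q01 _) _ => //.
  rewrite ler_pM2r ?invr_gt0 ?mulr_gt0 //; apply: le_trans (b1 _) _.
  by rewrite lef_pV2 ?posrE ?mulr_gt0 // ler_pM2r // ler_nat.
have b3 : binmean q m (fun r => r.+3%:R^-1 / r.+2%:R / r.+1%:R) <=
    (m.+1%:R * q)^-1 * (m.+1%:R * q)^-1 * (m.+1%:R * q)^-1.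
  apply: le_trans (@binmean_div_le _ q m (fun r => r.+2%:R^-1 / r.+1%:R) q01 _) _ => //.
  rewrite ler_pM2r ?invr_gt0 ?mulr_gt0 //; apply: le_trans (b2 _) _.
  by rewrite ler_pM ?invr_ge0 ?mulr_ge0 ?(ltW q0) // lef_pV2 ?posrE ?mulr_gt0 // ler_pM2r // ler_nat.
have step : binmean q m (fun r => r.+1%:R^-1 ^+ 2) <=
    binmean q m (fun r => r.+2%:R^-1 / r.+1%:R + 3 * (r.+3%:R^-1 / r.+2%:R / r.+1%:R)).
  apply: binmean_le => [|r]; first by rewrite ltW.
  set y : R := r.+1%:R; have y0 : 0 < y by rewrite ltr0n.
  have -> : r.+2%:R = y + 1 :> R by rewrite natr1.
  have -> : r.+3%:R = y + 2 :> R by rewrite -[r.+3]addn2 natrD.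
  rewrite -subr_ge0.
  have -> : (y + 1)^-1 / y + 3 * ((y + 2)^-1 / (y + 1) / y) - y^-1 ^+ 2 =
     (2 * (y - 1)) / (y ^+ 2 * (y + 1) * (y + 2)).
    by field; rewrite ?lt0r_neq0 //; lra.
  apply: divr_ge0; first by rewrite mulr_ge0 // subr_ge0 ler1n.
  by rewrite !mulr_ge0 ?exprn_ge0 ?addr_ge0 // ltW.
apply: (@le_trans _ _ (q * ((m.+1%:R * q)^-1 * (m.+1%:R * q)^-1 +
   3 * ((m.+1%:R * q)^-1 * (m.+1%:R * q)^-1 * (m.+1%:R * q)^-1)))).
  rewrite ler_pM2l //; apply: le_trans step _; rewrite binmeanD binmeanZ.
  by apply: lerD; [exact: b2 | rewrite ler_pM2l].
by rewrite le_eqVlt; apply/orP; left; apply/eqP; field; rewrite !lt0r_neq0.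
Qed.

Lemma binmean_succ (R : realType) (q : R) m : binmean q m (fun r => r.+1%:R) = 1 + m%:R * q.
Proof.
rewrite (eq_binmean _ _ (g := fun r => r%:R * 1 + 1)); last by move=> r /=; rewrite -natr1 mulr1.
rewrite binmeanD binmean_const addrC; congr (_ + _); case: m => [|m]; first by rewrite /= !mul0r.
by rewrite -(binmean_size_bias q m (fun=> 1)) binmean_const mulr1.
Qed.

(** * Hall's theorem *)

(** Induction on the size of [A], after Halmos and Vaughan: a proper nonempty subset without surplus
    is matched on its own, and its neighbourhood is removed for the rest; if there is none, any
    single edge can be fixed. The element [u0] supplies a function when [A] is empty. *)
Lemma hall_matching (T U : finType) (u0 : U) (nb : T -> {set U}) (A : {set T}) :
  (forall S : {set T}, S \subset A -> #|S| <= #|\bigcup_(x in S) nb x|)%N ->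
  exists f : T -> U, {in A &, injective f} /\ {in A, forall x, f x \in nb x}.
Proof.
have [m] := ubnP #|A|; elim: m => // m IH in A nb * => /ltnSE Am hall.
have [A0|[x xA]] := set_0Vmem A.
  by exists (fun=> u0); split=> [y z|y]; rewrite A0 inE.
have [tight|loose] := boolP [exists S : {set T},
    [&& S \subset A, S != set0, S != A & #|\bigcup_(x in S) nb x| <= #|S|]%N].
- case/existsP: tight => S /and4P[SA S0 SnA tight].
  have ltSA : (#|S| < #|A|)%N by rewrite proper_card // properEneq SnA.
  have [||f1 [f1i f1n]] := IH S nb; first exact: leq_trans ltSA Am.
    by move=> S' S'S; apply: hall; exact: subset_trans SA.
  pose NS := \bigcup_(x in S) nb x.
  have [||f2 [f2i f2n]] := IH (A :\: S) (fun z => nb z :\: NS).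
  + apply: leq_trans Am; rewrite proper_card //.
    have [y yS] := set0Pn _ S0; apply/properP; split; first exact: subsetDl.
    by exists y; [exact: (subsetP SA) | rewrite inE yS].
  + move=> S' S'AS; have /subsetP S'AS' := S'AS.
    have dis : [disjoint S' & S].
      by rewrite -setI_eq0; apply/eqP/setP => y; rewrite !inE; apply/negbTE/negP => /andP[/S'AS'];
        rewrite inE => /andP[/negP].
    have := hall (S' :|: S); rewrite subUset SA andbT.
    have S'A : S' \subset A by apply: subset_trans S'AS (subsetDl _ _).
    move=> /(_ S'A); rewrite cardsU; move: dis; rewrite -setI_eq0 => /eqP ->.
    rewrite cards0 subn0 bigcup_setU -/NS.
    have -> : \bigcup_(x in S') nb x :|: NS = (\bigcup_(x in S') (nb x :\: NS)) :|: NS.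
      apply/setP => y; rewrite !inE; have [yN|yN] := boolP (y \in NS); rewrite ?orbT // !orbF.
      by apply/bigcupP/bigcupP => -[z zS yz]; exists z => //; move: yz; rewrite inE ?yN => // /andP[].
    move=> le; have := leq_trans le (leq_card_setU _ NS).1.
    by move=> /leq_trans/(_ (leq_add (leqnn _) tight)); rewrite leq_add2r.
  exists (fun z => if z \in S then f1 z else f2 z); split=> [y z yA zA|z zA].
  + have inN t : t \in S -> f1 t \in NS by move=> tS; apply/bigcupP; exists t; rewrite ?f1n.
    have outN t : t \in A -> t \notin S -> f2 t \notin NS.
      by move=> tA tS; have := f2n t; rewrite !inE tA tS => /(_ isT) /andP[].
    case: ifPn => yS; case: ifPn => zS e.
    * exact: f1i.
    * by move: (outN _ zA zS); rewrite -e inN.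
    * by move: (outN _ yA yS); rewrite e inN.
    * by apply: f2i; rewrite // inE ?yS ?zS.
  + case: ifPn => zS; first exact: f1n.
    by have := f2n z; rewrite !inE zA zS => /(_ isT) /andP[].
(* The surplus of one in every proper nonempty subset survives the removal of a single [y]. *)
have lt (S : {set T}) : S \subset A -> S != set0 -> S != A -> (#|S| < #|\bigcup_(x in S) nb x|)%N.
  move=> SA S0 SnA; rewrite ltnNge; apply: contra loose => le.
  by apply/existsP; exists S; rewrite SA S0 SnA.
have /card_gt0P[y yx] : (0 < #|nb x|)%N.
  by have := hall [set x]; rewrite sub1set xA cards1 big_set1 => /(_ isT).
have [||f [fi fn]] := IH (A :\ x) (fun z => nb z :\ y).
- by rewrite (leq_trans _ Am) // [X in (_ < X)%N](cardsD1 x) xA.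
- move=> S SAx; have [->|S0] := eqVneq S set0; first by rewrite cards0.
  have SA : S \subset A by apply: subset_trans SAx (subsetDl _ _).
  have SnA : S != A.
    by apply/eqP => e; have := subsetP SAx x; rewrite e xA !inE eqxx => /(_ isT).
  have := lt S SA S0 SnA.
  have -> : \bigcup_(z in S) (nb z :\ y) = (\bigcup_(z in S) nb z) :\ y.
    apply/setP => z; rewrite !inE; apply/bigcupP/andP => [[t tS]|[zy /bigcupP[t tS zt]]].
      by rewrite !inE => /andP[-> zt]; split=> //; apply/bigcupP; exists t.
    by exists t => //; rewrite !inE zy.
  by rewrite [X in (_ < X)%N](cardsD1 y); case: (y \in _) => /=; lia.
exists (fun z => if z == x then y else f z); split=> [z t zA tA|z zA]; last first.
  by case: eqP => [->|/eqP zx] //; have := fn z; rewrite !inE zx zA => /(_ isT) /andP[].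
have ne u : u \in A -> u != x -> f u != y.
  by move=> uA ux; have := fn u; rewrite !inE ux uA => /(_ isT) /andP[].
case: (eqVneq z x) => [->|zx]; case: (eqVneq t x) => [->|tx] // e.
- by have := ne _ tA tx; rewrite -e eqxx.
- by have := ne _ zA zx; rewrite e eqxx.
- by apply: fi; rewrite // !inE ?zx ?tx.
Qed.

Lemma exists_subset_card (T : finType) (A : {set T}) k : (k <= #|A|)%N ->
  exists2 B : {set T}, B \subset A & #|B| = k.
Proof.
move=> kA; exists [set x in take k (enum A)].
  by apply/subsetP => x; rewrite inE => /mem_take; rewrite mem_enum.
rewrite cardsE; have /card_uniqP -> := take_uniq k (enum_uniq (mem A)).
by rewrite size_takel // -cardE.
Qed.

(** The Frobenius-König form of Hall's theorem: a violating [S] has no edge to the rows of [s @: T]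
    outside its neighbourhood. These rows are trimmed so that the two sides add up to exactly
    [#|T|.+1], which leaves one block shape per size of [S] in the union bound. *)
Lemma no_completion_empty_block (I : finType) (T : {set I}) (s : {perm I}) (e : rel I) :
  ~~ [exists r : {perm I}, perm_on T r && [forall a in T, e a (s (r a))]] ->
  exists S Q : {set I}, [/\ S \subset T, Q \subset s @: T, #|S| + #|Q| = #|T|.+1 &
    forall a i, a \in S -> i \in Q -> ~~ e a i]%N.
Proof.
move=> none; pose nb a := [set i in s @: T | e a i].
have [T0|[u0 u0T]] := set_0Vmem T.
  case/negP: none; apply/existsP; exists 1%g; rewrite perm_on1; apply/forall_inP => a.
  by rewrite T0 inE.
have [/forallP hall|] := boolP [forall S : {set I}, (S \subset T) ==> (#|S| <= #|\bigcup_(x in S) nb x|)%N].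
  have [|f [fi fn]] := @hall_matching _ _ u0 nb T; first by move=> S; move: (hall S) => /implyP.
  have fT a : a \in T -> f a \in s @: T by move=> /fn; rewrite inE => /andP[].
  have sfT a : a \in T -> (s^-1)%g (f a) \in T.
    by move=> /fT/imsetP[b bT ->]; rewrite permK.
  pose h a := if a \in T then (s^-1)%g (f a) else a.
  have hi : injective h.
    move=> a b; rewrite /h; case: ifPn => aT; case: ifPn => bT.
    - by move=> /perm_inj /fi ->.
    - by move=> eab; move: bT; rewrite -eab sfT.
    - by move=> eab; move: aT; rewrite eab sfT.
    - by [].
  case/negP: none; apply/existsP; exists (perm hi); apply/andP; split.
    by apply/subsetP => a; rewrite inE permE /h; case: ifP; rewrite ?eqxx.
  apply/forall_inP => a aT; rewrite permE /h aT permKV.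
  by have := fn a aT; rewrite inE => /andP[].
rewrite negb_forall => /existsP[S]; rewrite negb_imply -ltnNge => /andP[ST lt].
set NS := \bigcup_(x in S) nb x in lt.
have NST : NS \subset s @: T.
  by apply/bigcupsP => a _; apply/subsetP => i; rewrite inE => /andP[].
have cT : #|s @: T| = #|T| by rewrite card_imset //; exact: perm_inj.
have ltT := subset_leq_card ST.
have [|Q QS cQ] := @exists_subset_card _ (s @: T :\: NS) (#|T|.+1 - #|S|)%N.
  by rewrite cardsD (setIidPr NST) cT; lia.
exists S, Q; split=> //; first by apply: subset_trans QS (subsetDl _ _).
  by rewrite cQ; lia.
move=> a i aS iQ; apply/negP => eai.
have := subsetP QS _ iQ; rewrite inE => /andP[/negP iN iT]; apply: iN.
by apply/bigcupP; exists a => //; rewrite inE iT.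
Qed.

(** * A random bipartite graph between the steps and the rows of a column *)

Section Column.

Variables (R : realType) (N : nat).

Implicit Types (q : R) (Y : {set 'I_N * 'I_N}) (s r : {perm 'I_N}).

Definition row_of Y (a : 'I_N) : {set 'I_N} := [set i | (a, i) \in Y].

(** [s] maps a step to its row, so [(s^-1) i] is the step at which row [i] is taken. *)
Definition free s (a : 'I_N) : {set 'I_N} := [set i | (a <= (s^-1)%g i)%N].

Lemma mem_free s a : s a \in free s a.
Proof. by rewrite inE permK. Qed.

Lemma card_free s a : #|free s a| = (N - a)%N.
Proof.
have -> : free s a = s @: [set b : 'I_N | (a <= b)%N].
  apply/setP => i; rewrite inE; apply/idP/imsetP => [ai|[b ab ->]].
    by exists ((s^-1)%g i); rewrite ?inE // permKV.
  by rewrite permK; rewrite inE in ab.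
rewrite card_imset; last exact: perm_inj.
have := cardsC [set b : 'I_N | (b < a)%N]; rewrite card_ord.
have -> : ~: [set b : 'I_N | (b < a)%N] = [set b : 'I_N | (a <= b)%N].
  by apply/setP => b; rewrite !inE -leqNgt.
have -> : #|[set b : 'I_N | (b < a)%N]| = a.
  rewrite -sum1_card; under eq_bigl => b do rewrite inE.
  by rewrite -(big_ord_widen N (fun=> 1%N)) ?sum1_card ?card_ord // ltnW.
by move=> e; have := congr1 (subn^~ (a : nat)) e; rewrite addKn.
Qed.

Lemma bmean_rows q (F : 'I_N -> {set 'I_N} -> R) :
  bmean q setT (fun Y => \prod_a F a (row_of Y a)) = \prod_a bmean q setT (F a).
Proof.
have := @bmean_blocks R q _ 'I_N 'I_N [set: 'I_N * 'I_N] (fun a i => [set (a, i)]) (fun=> 1%N) F.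
rewrite expr1 => <- //.
- by apply: eq_bmean => Y _; apply: eq_bigr => a _; congr F; apply/setP => i; rewrite !inE sub1set.
- by move=> c d x y e; rewrite !inE => /eqP -> /eqP [].
- by move=> c x; rewrite cards1.
Qed.

Definition hit s Y a : R := (s a \in row_of Y a)%:R.

Definition nfree s Y a : nat := #|row_of Y a :&: free s a|.

(** For a fixed [s], step [a] looks only at row [a] of the matrix [Y]. Once the entry at [s a] is
    present, the number of admissible rows is one plus a binomial over the other [N - a - 1] free
    rows. *)
Lemma bmean_column q (P : pred 'I_N) (f : nat -> R) s :
  bmean q setT (fun Y => \prod_(a | P a) (hit s Y a * f (nfree s Y a))) =
  \prod_(a | P a) (q * binmean q (N - a).-1 (fun m => f m.+1)).
Proof.
rewrite big_mkcond /=.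
pose F a (A : {set 'I_N}) : R := if P a then (s a \in A)%:R * f #|A :&: free s a| else 1.
rewrite (eq_bmean q (G := fun Y => \prod_a F a (row_of Y a))); last first.
  by move=> Y _; rewrite big_mkcond.
rewrite bmean_rows; apply: eq_bigr => a _; rewrite /F; case: ifP => _; last exact: bmean_const.
by rewrite (bmean_mem_card q f (mem_free s a)) card_free.
Qed.

(** In [r * s] the permutation [r] acts first, so it redistributes among the steps of [T] the rows
    that [s] assigns to them. *)
Definition completions s Y (T : {set 'I_N}) : nat :=
  #|[set r | perm_on T r && [forall a in T, (r * s)%g a \in row_of Y a]]|.

(** The union bound over the empty blocks of [no_completion_empty_block], with [j] steps and
    [l + 1 - j] rows; [x] is the probability of a missing entry. *)
Definition block_bound (x : R) (l : nat) : R :=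
  \sum_(j < l.+1) 'C(l, j)%:R * 'C(l, l.+1 - j)%:R * x ^+ (j * (l.+1 - j)).

(* By Hall's theorem a missing completion leaves an empty block of [Y], and
   the average of an empty block factorises over the rows of [Y]. *)
Lemma bmean_completions_ge q (P : pred 'I_N) (f : nat -> R) s (T : {set 'I_N}) :
  0 <= q <= 1 -> (forall m, 0 <= f m) -> (forall a, P a = (a \notin T)) ->
  (\prod_(a | P a) (q * binmean q (N - a).-1 (fun m => f m.+1))) *
     (1 - block_bound (1 - q) #|T|) <=
  bmean q setT (fun Y => \prod_(a | P a) (hit s Y a * f (nfree s Y a)) *
     (0 < completions s Y T)%N%:R).
Proof.
move=> q01 f0 PT; set G := \prod_(a | P a) _.
pose g Y := \prod_(a | P a) (hit s Y a * f (nfree s Y a)).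
pose ok (S Q : {set 'I_N}) := [&& S \subset T, Q \subset s @: T & (#|S| + #|Q| == #|T|.+1)%N].
pose emp (S Q : {set 'I_N}) Y : R := \prod_(a in S) (row_of Y a :&: Q == set0)%:R.
have g0 Y : 0 <= g Y by apply: prodr_ge0 => a _; rewrite mulr_ge0.
have main : bmean q setT (fun Y => g Y + - 1 * \sum_(z : {set 'I_N} * {set 'I_N} | ok z.1 z.2) g Y * emp z.1 z.2 Y)
    <= bmean q setT (fun Y => g Y * (0 < completions s Y T)%N%:R).
  apply: bmean_le => // Y _; have [pos|] := posnP (completions s Y T); last first.
    move=> _; rewrite mulr1 mulN1r gerDl oppr_le0 sumr_ge0 // => z _.
    by rewrite mulr_ge0 // prodr_ge0.
  have [|S [Q [ST QT card H]]] := @no_completion_empty_block _ T s (fun a i => i \in row_of Y a).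
    apply/negP => /existsP[r rP]; have : (0 < completions s Y T)%N.
      apply/card_gt0P; exists r; rewrite inE; move: rP => /andP[-> /forall_inP rP] /=.
      by apply/forall_inP => a aT; rewrite permM; exact: rP.
    by rewrite pos.
  rewrite mulr0 mulN1r subr_le0 (bigD1 (S, Q)) /=; last by rewrite /ok ST QT card eqxx.
  have -> : emp S Q Y = 1.
    rewrite /emp big1 // => a aS; suff -> : row_of Y a :&: Q == set0 by [].
    apply/eqP/setP => i; rewrite !inE; apply/negbTE/negP => /andP[iY iQ].
    by have := H _ _ aS iQ; rewrite inE iY.
  by rewrite mulr1 lerDl sumr_ge0 // => z _; rewrite mulr_ge0 // prodr_ge0.
apply: le_trans main; rewrite bmeanD bmeanZ bmean_sum bmean_column -/G mulN1r mulrBr mulr1.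
rewrite lerD2l lerN2.
have one (z : {set 'I_N} * {set 'I_N}) : ok z.1 z.2 ->
    bmean q setT (fun Y => g Y * emp z.1 z.2 Y) = G * (1 - q) ^+ (#|z.1| * (#|T|.+1 - #|z.1|)).
  case: z => S Q /= /and3P[ST QT /eqP card].
  pose F a (A : {set 'I_N}) : R := if P a then (s a \in A)%:R * f #|A :&: free s a|
     else if a \in S then (A :&: Q == set0)%:R else 1.
  rewrite (eq_bmean q (G := fun Y => \prod_a F a (row_of Y a))); last first.
    move=> Y _; rewrite /g /emp [X in _ * X = _]big_mkcond [X in X * _ = _]big_mkcond -big_split.
    apply: eq_bigr => a _ /=; rewrite /F PT; have [aS|aS] := boolP (a \in S).
      by rewrite (subsetP ST) //= mul1r.
    by rewrite mulr1.
  rewrite bmean_rows.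
  have FE a : bmean q setT (F a) = (if P a then q * binmean q (N - a).-1 (fun m => f m.+1) else 1)
     * (if a \in S then (1 - q) ^+ #|Q| else 1).
    rewrite /F PT; have [aS|aS] := boolP (a \in S); last first.
      rewrite mulr1; case: ifP => _; last exact: bmean_const.
      by rewrite (bmean_mem_card q f (mem_free s a)) card_free.
    rewrite (subsetP ST) //= mul1r.
    rewrite (eq_bmean q (G := fun A => (fun m => (m == 0%N)%:R) #|A :&: Q|)); last first.
      by move=> A _; rewrite cards_eq0.
    rewrite (bmean_card q Q (fun m => (m == 0%N)%:R)).
    elim: #|Q| => [|m IH] /=; first by rewrite expr0.
    by rewrite IH binmean_const exprS; ring.
  under eq_bigr => a _ do rewrite FE.
  rewrite big_split -!big_mkcond /= -/G; congr (_ * _).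
  by rewrite prodr_const -card addKn mulnC exprM.
rewrite (eq_bigr _ one) -mulr_sumr.
have G0 : 0 <= G.
  have /andP[q0 q1] := q01.
  apply: prodr_ge0 => a _; rewrite mulr_ge0 //.
  by rewrite -(binmean_const q (N - a).-1 (0 : R)); apply: binmean_le.
apply: ler_wpM2l => //; rewrite /block_bound le_eqVlt; apply/orP; left; apply/eqP.
have cT : #|s @: T| = #|T| by rewrite card_imset //; exact: perm_inj.
rewrite (partition_big (fun z : {set 'I_N} * {set 'I_N} => inord #|z.1| : 'I_(#|T|.+1)) xpredT) //=.
apply: eq_bigr => j _.
pose Sj := [set S : {set 'I_N} | S \subset T & #|S| == j].
pose Qj := [set Q : {set 'I_N} | Q \subset s @: T & #|Q| == (#|T|.+1 - j)%N].
rewrite (eq_bigl (fun z : {set 'I_N} * {set 'I_N} => (z.1 \in Sj) && (z.2 \in Qj))); last first.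
  move=> [S Q] /=; rewrite /ok !inE; have [ST /=|//] := boolP (S \subset T).
  have := subset_leq_card ST; have ltj := ltn_ord j => leS.
  rewrite -val_eqE /= inordK ?ltnS // andbC; case: eqP => //= eS; congr (_ && _).
  by apply/eqP/eqP; lia.
rewrite -(pair_big (mem Sj) (mem Qj) (fun S Q => (1 - q) ^+ (#|S| * (#|T|.+1 - #|S|)))) /=.
rewrite (eq_bigr (fun=> 'C(#|T|, #|T|.+1 - j)%:R * (1 - q) ^+ (j * (#|T|.+1 - j)))); last first.
  move=> S; rewrite inE => /andP[_ /eqP ->]; rewrite sumr_const cards_draws cT.
  by rewrite mulr_natl.
by rewrite sumr_const /Sj cards_draws -[RHS]mulrA [RHS]mulr_natl.
Qed.

End Column.

(** The Weierstrass product inequality; the bounds 0 and 1 on the product are carried through the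
    induction. *)
Lemma prod_one_sub_ge (R : realType) (I : finType) (P : pred I) (x : I -> R) :
  (forall i, 0 <= x i <= 1) -> 1 - \sum_(i | P i) x i <= \prod_(i | P i) (1 - x i).
Proof.
move=> x01; suff : 1 - \sum_(i | P i) x i <= \prod_(i | P i) (1 - x i) /\
   0 <= \prod_(i | P i) (1 - x i) <= 1 by case.
elim/big_rec2: _ => [|i y z _ [IH /andP[z0 z1]]]; first by rewrite subr0 ler01 !lexx.
have /andP[i0 i1] := x01 i.
have h : 0 <= x i * (1 - z) by rewrite mulr_ge0 // subr_ge0.
split; first by move: h; rewrite mulrBr mulr1 mulrBl mul1r; lra.
by rewrite mulr_ge0 ?subr_ge0 //= mulr_ile1 ?subr_ge0 // gerBl.
Qed.

Lemma bernoulli_ineq (R : realType) (x : R) k : 0 <= x -> 1 + k%:R * x <= (1 + x) ^+ k.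
Proof.
move=> x0; elim: k => [|k IH]; first by rewrite mul0r addr0 expr0.
have h : (1 + x) * (1 + k%:R * x) <= (1 + x) * (1 + x) ^+ k.
  by apply: ler_wpM2l => //; rewrite addr_ge0.
rewrite exprS -natr1; apply: le_trans h.
have -> : (1 + x) * (1 + k%:R * x) = 1 + (k%:R + 1) * x + k%:R * x * x by ring.
by rewrite lerDl !mulr_ge0.
Qed.

(** For [c = 1] the product telescopes to [(n + 1) / (n - d + 1)]; for [c <= S], Bernoulli's
    inequality bounds each factor by the [S]-th power of the corresponding one. *)
Lemma prod_harmonic_le (R : realType) n d (c : R) S : (d <= n)%N -> 0 <= c <= S%:R ->
  \prod_(a < d) (1 + c / (n - a)%:R) <= n.+1%:R ^+ S.
Proof.
move=> dn /andP[c0 cS].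
have tele : \prod_(a < d) (1 + ((n - a)%:R : R)^-1) = n.+1%:R / (n - d).+1%:R.
  elim: d dn => [|d IH] dn; first by rewrite big_ord0 subn0 divff // pnatr_eq0.
  rewrite big_ord_recr /= IH; last exact: ltnW.
  have -> : (n - d = (n - d.+1).+1)%N by lia.
  rewrite -[(n - d.+1).+2%:R]natr1.
  by field; rewrite nat1r natr1 !pnatr_eq0.
apply: (@le_trans _ _ ((\prod_(a < d) (1 + ((n - a)%:R : R)^-1)) ^+ S)).
  rewrite -prodrXl; apply: ler_prod => a _; have p0 : 0 <= ((n - a)%:R : R)^-1 by rewrite invr_ge0.
  rewrite addr_ge0 ?divr_ge0 //=; apply: le_trans (bernoulli_ineq _ p0).
  by rewrite lerD2l ler_wpM2r.
rewrite tele; apply: lerXn2r; rewrite ?nnegrE ?divr_ge0 //.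
by rewrite ler_pdivrMr // ler_peMr // ler1n.
Qed.

Lemma geometric_tail (R : realType) (q : R) n d : (d <= n)%N ->
  q * \sum_(a < d) (1 - q) ^+ (n - a) + (1 - q) ^+ n.+1 = (1 - q) ^+ (n - d).+1.
Proof.
elim: d => [|d IH] dn; first by rewrite big_ord0 mulr0 add0r subn0.
rewrite big_ord_recr /= mulrDr addrAC IH; last exact: ltnW.
have -> : (n - d = (n - d.+1).+1)%N by lia.
by rewrite [in LHS]exprS; ring.
Qed.

Lemma prod_ffact (R : realType) n d : (d <= n)%N ->
  \prod_(a < d) ((n - a)%:R : R) * (n - d)`!%:R = n`!%:R.
Proof.
by move=> dn; rewrite -natr_prod -ffact_prod -natrM ffact_fact.
Qed.

(** * The weights on one column: total weight and squared weights *)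

Section Kernel.

Variables (R : realType) (N l : nat).
Hypothesis lN : (l <= N)%N.

Implicit Types (q : R) (Y : {set 'I_N * 'I_N}) (s r : {perm 'I_N}).

Definition tail : {set 'I_N} := [set a : 'I_N | (N - l <= a)%N].

Lemma card_tail : #|tail| = l.
Proof.
have := cardsC [set b : 'I_N | (b < N - l)%N]; rewrite card_ord.
have -> : ~: [set b : 'I_N | (b < N - l)%N] = tail.
  by apply/setP => b; rewrite !inE -leqNgt.
have -> : #|[set b : 'I_N | (b < N - l)%N]| = (N - l)%N.
  rewrite -sum1_card; under eq_bigl => b do rewrite inE.
  by rewrite -(big_ord_widen N (fun=> 1%N)) ?sum1_card ?card_ord // leq_subr.
by move=> e; apply/eqP; rewrite -(eqn_add2l (N - l)) e subnK.
Qed.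

Definition prefix (j : nat) (f : nat -> R) s Y : R :=
  \prod_(a : 'I_N | (a < j)%N) (hit R s Y a * f (nfree s Y a)).

Definition covers s Y (T : {set 'I_N}) : bool := [forall a in T, s a \in row_of Y a].

(* The probability that the process produces [s] on the graph [Y]: all but the last
   [l] steps are uniform among the admissible rows, the rest is a uniform completion. *)
Definition kernel s Y : R :=
  prefix (N - l) (fun m => m%:R^-1) s Y * ((covers s Y tail)%:R / (completions s Y tail)%:R).

Lemma perm_on_fix (T : {set 'I_N}) r a : perm_on T r -> a \notin T -> r a = a.
Proof. by move=> rT aT; apply: (out_perm rT). Qed.

Lemma free_mul (j : nat) r s (a : 'I_N) : perm_on [set b : 'I_N | (j <= b)%N] r -> (a <= j)%N ->
  free (r * s)%g a = free s a.
Proof.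
move=> rT aj; apply/setP => i; rewrite !inE invMg permM; set b := (s^-1)%g i.
have rVT : perm_on [set b : 'I_N | (j <= b)%N] (r^-1)%g by rewrite perm_onV.
have [bT|bT] := boolP (b \in [set b : 'I_N | (j <= b)%N]); last by rewrite (perm_on_fix rVT).
have : (r^-1)%g b \in [set b : 'I_N | (j <= b)%N] by rewrite (perm_closed _ rVT).
by move: bT; rewrite !inE => jb jrb; rewrite (leq_trans aj jb) (leq_trans aj jrb).
Qed.

(** Rearranging the rows of later steps changes neither the earlier choices nor the sets of rows
    free at them. *)
Lemma prefix_mul j f r s Y : perm_on [set b : 'I_N | (j <= b)%N] r ->
  prefix j f (r * s)%g Y = prefix j f s Y.
Proof.
move=> rT; apply: eq_bigr => a aj; have e : (r * s)%g a = s a.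
  by rewrite permM (perm_on_fix rT) // inE -ltnNge.
by rewrite /hit /nfree (free_mul _ rT (ltnW aj)) e.
Qed.

Lemma completions_mul r s Y (T : {set 'I_N}) : perm_on T r ->
  completions (r * s)%g Y T = completions s Y T.
Proof.
move=> rT; rewrite /completions -[LHS](card_imset _ (mulIg r)); apply: eq_card => r'.
rewrite inE; apply/imsetP/idP => [[t]|/andP[r'T H]].
  by rewrite inE => /andP[tT H] ->; rewrite perm_onM //= -mulgA.
exists (r' * r^-1)%g; last by rewrite mulgKV.
by rewrite inE perm_onM ?perm_onV //= mulgA mulgKV.
Qed.

(** [s] is replaced by its translates under all permutations of the tail. Neither [G] nor the number
    of completions changes, and the translates that cover the tail are exactly the completions, so
    the denominator cancels. *)
Lemma sum_tail_average (G : {perm 'I_N} -> R) Y :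
  (forall r s, perm_on tail r -> G (r * s)%g = G s) ->
  \sum_s G s * ((covers s Y tail)%:R / (completions s Y tail)%:R) =
  l`!%:R^-1 * \sum_s G s * (0 < completions s Y tail)%N%:R.
Proof.
move=> Ginv; pose F s := G s * ((covers s Y tail)%:R / (completions s Y tail)%:R).
have l0 : l`!%:R != 0 :> R by rewrite pnatr_eq0 -lt0n fact_gt0.
apply: (mulfI l0); rewrite mulrA divff // mul1r -/F.
have -> : l`!%:R * \sum_s F s = \sum_(r | perm_on tail r) \sum_s F (r * s)%g.
  rewrite -[in LHS]card_tail -card_perm mulr_natl -sumr_const; apply: eq_bigr => r _.
  by rewrite (reindex_inj (mulgI r)).
rewrite exchange_big; apply: eq_bigr => s _.
have -> : \sum_(r | perm_on tail r) F (r * s)%g =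
   \sum_(r | perm_on tail r) G s / (completions s Y tail)%:R * (covers (r * s)%g Y tail)%:R.
  by apply: eq_bigr => r rT; rewrite /F Ginv // completions_mul // -mulrA [_^-1 * _]mulrC.
rewrite -mulr_sumr -mulrA; congr (_ * _).
have -> : \sum_(r | perm_on tail r) (covers (r * s)%g Y tail)%:R = (completions s Y tail)%:R :> R.
  rewrite /completions -sum1_card natr_sum big_mkcond [RHS]big_mkcond; apply: eq_bigr => r _.
  by rewrite inE /covers; case: perm_on => //=; case: [forall _ in _, _].
have [->|c0] := posnP; first by rewrite mulr0.
by rewrite mulVf // pnatr_eq0 -lt0n.
Qed.

(* Composing [s] with the transpositions (j c), j <= c, moves [s j] over all free
   rows without changing the first [j] factors. *)
Lemma sum_prefix_le j Y : (j <= N)%N -> \sum_s prefix j (fun m => m%:R^-1) s Y <= (N - j)`!%:R.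
Proof.
elim: j => [|j IH] jN.
  rewrite subn0 -card_Sn -sum1_card natr_sum big_mkcond; apply: ler_sum => s _.
  by rewrite /prefix big_pred0.
have Nj0 : (0 < N - j)%N by rewrite subn_gt0.
rewrite -(ler_pM2l (x := (N - j)%:R)) ?ltr0n //.
rewrite -natrM (_ : ((N - j) * (N - j.+1)`! = (N - j)`!)%N); last first.
  by rewrite (_ : N - j = (N - j.+1).+1)%N //; lia.
apply: le_trans (IH (ltnW jN)).
pose jj := Ordinal jN; set J := [set b : 'I_N | (j <= b)%N].
set p := fun m : nat => m%:R^-1.
have pS s : prefix j.+1 p s Y = prefix j p s Y * (hit R s Y jj * p (nfree s Y jj)).
  rewrite /prefix (bigD1 jj) ?leqnn //= mulrC; congr (_ * _).
  by apply: eq_bigl => a; rewrite ltnS ltn_neqAle -val_eqE /= andbC.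
have cJ : #|J| = (N - j)%N by rewrite -(card_free 1%g jj); apply: eq_card => i; rewrite !inE invg1 perm1.
have tJ c : c \in J -> perm_on J (tperm jj c).
  move=> cJ'; apply/subsetP => b; rewrite inE; apply: contraR => bJ; apply/eqP; rewrite tpermD //.
    by apply: contra bJ => /eqP <-; rewrite inE leqnn.
  by apply: contra bJ => /eqP <-.
have -> : (N - j)%:R * \sum_s prefix j.+1 p s Y =
    \sum_s prefix j p s Y * \sum_(c in J) (hit R (tperm jj c * s)%g Y jj * p (nfree s Y jj)).
  rewrite -cJ mulr_natl -sumr_const.
  under [RHS]eq_bigr => s _ do rewrite mulr_sumr.
  rewrite [RHS]exchange_big; apply: eq_bigr => c cJ'.
  rewrite (reindex_inj (mulgI (tperm jj c))); apply: eq_bigr => s _.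
  by rewrite pS prefix_mul ?tJ // /nfree (free_mul _ (tJ _ cJ')).
apply: ler_sum => s _; rewrite -[leRHS]mulr1; apply: ler_wpM2l.
  by apply: prodr_ge0 => a _; rewrite mulr_ge0 ?invr_ge0.
rewrite -mulr_suml (_ : \sum_(c in J) _ = (nfree s Y jj)%:R).
  by have [->|m0] := posnP (nfree s Y jj); rewrite /p ?mul0r // divff // pnatr_eq0 -lt0n.
rewrite /nfree -sum1_card natr_sum [RHS]big_mkcond [LHS]big_mkcond [RHS](reindex_inj (@perm_inj _ s)).
apply: eq_bigr => c _.
rewrite /hit !inE permK permM tpermL /=; case: (j <= c)%N; rewrite ?andbF ?andbT //.
by case: (_ \in _).
Qed.

Lemma kernel_ge0 s Y : 0 <= kernel s Y.
Proof.
rewrite /kernel mulr_ge0 ?divr_ge0 //; apply: prodr_ge0 => a _.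
by rewrite mulr_ge0 ?invr_ge0.
Qed.

Lemma sum_kernel_le1 Y : \sum_s kernel s Y <= 1.
Proof.
rewrite /kernel sum_tail_average; last by move=> r s rT; apply: prefix_mul.
rewrite mulrC ler_pdivrMr ?ltr0n ?fact_gt0 // mul1r.
have := sum_prefix_le Y (leq_subr l N); rewrite subKn //; apply: le_trans.
apply: ler_sum => s _; rewrite ler_piMr ?lern1 ?leq_b1 //.
by apply: prodr_ge0 => a _; rewrite mulr_ge0 ?invr_ge0.
Qed.

Lemma big_bulk (x : nat -> R) :
  \prod_(a : 'I_N | (a < N - l)%N) x a = \prod_(a < N - l) x a.
Proof. by rewrite -(big_ord_widen N) // leq_subr. Qed.

(** Two losses. Before the tail the process is stuck if no free row is admissible, and the
    probabilities [(1 - q) ^ (N - a)] sum to at most [(1 - q) ^ l / q]; in the tail a completion may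
    be missing. *)
Lemma bmean_kernel_ge q : 0 < q <= 1 ->
  1 - ((1 - q) ^+ l / q + block_bound (1 - q) l) <= bmean q setT (fun Y => \sum_s kernel s Y).
Proof.
move=> q01; have /andP[q0 q1] := q01; have q01' : 0 <= q <= 1 by rewrite ltW.
rewrite (eq_bmean q (G := fun Y => l`!%:R^-1 * \sum_s prefix (N - l) (fun m => m%:R^-1) s Y *
    (0 < completions s Y tail)%N%:R)); last first.
  by move=> Y _; rewrite /kernel sum_tail_average // => r s rT; apply: prefix_mul.
rewrite bmeanZ bmean_sum.
set x := 1 - q; have x0 : 0 <= x by rewrite subr_ge0.
have x1 : x <= 1 by rewrite gerBl ltW.
set P := \prod_(a : 'I_N | (a < N - l)%N) (q * binmean q (N - a).-1 (fun m => m.+1%:R^-1)).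
have PE : P * N`!%:R = l`!%:R * \prod_(a < N - l) (1 - x ^+ (N - a)).
  rewrite /P (eq_bigr (fun a : 'I_N => (1 - x ^+ (N - a)) / (N - a)%:R)); last first.
    by move=> a _; rewrite binmean_inv // prednK // subn_gt0.
  rewrite (big_bulk (fun a => (1 - x ^+ (N - a)) / (N - a)%:R)) big_split /= prodfV.
  rewrite -(prod_ffact R (leq_subr l N)) subKn //.
  have F0 : \prod_(a < N - l) (N - a)%:R != 0 :> R.
    apply/prodf_neq0 => a _; rewrite pnatr_eq0 -lt0n subn_gt0.
    by apply: leq_trans (ltn_ord a) (leq_subr _ _).
  by field.
have low : P * (1 - block_bound x l) * N`!%:R <=
    \sum_s bmean q setT (fun Y => prefix (N - l) (fun m => m%:R^-1) s Y * (0 < completions s Y tail)%N%:R).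
  rewrite mulr_natr -card_Sn -sumr_const big_mkcond; apply: ler_sum => s _ /=.
  have := @bmean_completions_ge R N q (fun a => (a < N - l)%N) (fun m => m%:R^-1) s tail q01'.
  rewrite card_tail; apply.
    by move=> m; rewrite invr_ge0.
  by move=> a; rewrite inE ltnNge.
have l0 : 0 < l`!%:R :> R by rewrite ltr0n fact_gt0.
apply: le_trans (ler_wpM2l _ low); last by rewrite invr_ge0 ltW.
rewrite mulrAC PE -mulrA mulKf ?lt0r_neq0 //.
have x01 a : 0 <= x ^+ a <= 1 by rewrite exprn_ge0 // exprn_ile1.
have p1 := @prod_one_sub_ge R 'I_(N - l) xpredT (fun a => x ^+ (N - a)) (fun a => x01 _).
have p2 : \sum_(a < N - l) x ^+ (N - a) <= x ^+ l / q.
  rewrite ler_pdivlMr // mulrC.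
  have := geometric_tail q (leq_subr l N); rewrite subKn // -/x => e.
  have : q * \sum_(a < N - l) x ^+ (N - a) <= x ^+ l.+1.
    by rewrite -e lerDl exprn_ge0.
  by move=> h; apply: le_trans h _; rewrite exprS ler_piMl // exprn_ge0.
have b0 : 0 <= block_bound x l by apply: sumr_ge0 => j _; rewrite !mulr_ge0 // exprn_ge0.
have pr1 : \prod_(a < N - l) (1 - x ^+ (N - a)) <= 1.
  apply: prodr_ile1 => a _; have /andP[? ?] := x01 (N - a)%N; apply/andP; split; lra.
nra.
Qed.

(** Over [N!] permutations, with the average [1 / l!] for the tail, the leading terms
    [1 / (N - a) ^ 2] give [(N! / l!) * (l! / N!) ^ 2 = l! / N!]. The corrections form the power of
    [N + 1] by [prod_harmonic_le]. *)
Lemma bmean_kernel_sqr_le q S : 0 < q <= 1 -> 3 / q <= S%:R ->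
  bmean q setT (fun Y => \sum_s kernel s Y ^+ 2) <= l`!%:R * N.+1%:R ^+ S / (N`!%:R * q ^+ N).
Proof.
move=> q01 qS; have /andP[q0 q1] := q01; have q01' : 0 <= q <= 1 by rewrite ltW.
pose f m : R := m%:R^-1 ^+ 2.
have l0 : 0 < l`!%:R :> R by rewrite ltr0n fact_gt0.
have pre0 s Y : 0 <= prefix (N - l) f s Y.
  by apply: prodr_ge0 => a _; rewrite mulr_ge0 ?exprn_ge0 ?invr_ge0.
(* The tail factor is 0 or the inverse of a positive integer, so its square is at most itself, and
   the tail can be averaged as in the first moment. *)
apply: (@le_trans _ _ (bmean q setT (fun Y => \sum_s prefix (N - l) f s Y *
    ((covers s Y tail)%:R / (completions s Y tail)%:R)))).
  apply: bmean_le => // Y _; apply: ler_sum => s _; rewrite /kernel exprMn.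
  have -> : prefix (N - l) (fun m => m%:R^-1) s Y ^+ 2 = prefix (N - l) f s Y.
    rewrite -prodrXl; apply: eq_bigr => a _; rewrite exprMn; congr (_ * _).
    by rewrite /hit; case: (_ \in _); rewrite ?expr1n ?expr0n.
  apply: ler_wpM2l => //; set c := completions _ _ _.
  have [->|c0] := posnP c; first by rewrite invr0 mulr0 expr0n.
  case: (covers _ _ _); last by rewrite !mul0r expr0n.
  rewrite !mul1r expr2 ler_piMl ?invr_ge0 // invf_le1 ?ltr0n // ler1n //.
apply: (@le_trans _ _ (l`!%:R^-1 * \sum_s bmean q setT (fun Y => prefix (N - l) f s Y))).
  rewrite -bmean_sum -bmeanZ; apply: bmean_le => // Y _.
  rewrite sum_tail_average; last by move=> r s rT; apply: prefix_mul.
  apply: ler_wpM2l; first by rewrite invr_ge0 ltW.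
  by apply: ler_sum => s _; rewrite ler_piMr // lern1 leq_b1.
have NN : \sum_(s : {perm 'I_N}) 1 = N`!%:R :> R.
  rewrite sumr_const; congr _%:R; rewrite -card_Sn; exact: eq_card.
set P := \prod_(a < N - l) (((N - a)%:R ^+ 2 * q)^-1 * (1 + 3 / q / (N - a)%:R)).
have fin s : bmean q setT (fun Y => prefix (N - l) f s Y) <= 1 * P.
  rewrite /prefix bmean_column mul1r /P.
  rewrite -(big_bulk (fun a => ((N - a)%:R ^+ 2 * q)^-1 * (1 + 3 / q / (N - a)%:R))).
  apply: ler_prod => a aNl; apply/andP; split.
    rewrite mulr_ge0 //; first exact: ltW.
    rewrite -(binmean_const q (N - a).-1 (0 : R)); apply: binmean_le => // m.
    by rewrite exprn_ge0 // invr_ge0.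
  have e : (N - a = (N - a).-1.+1)%N by rewrite prednK // subn_gt0.
  rewrite [in leRHS]e; set m := (N - a).-1; apply: le_trans (binmean_inv_sqr _ q01) _.
  rewrite le_eqVlt; apply/orP; left; apply/eqP; field.
  by rewrite nat1r pnatr_eq0 lt0r_neq0.
apply: (@le_trans _ _ (l`!%:R^-1 * (N`!%:R * P))).
  apply: ler_wpM2l; first by rewrite invr_ge0 ltW.
  by rewrite -NN mulr_suml; apply: ler_sum => s _; exact: fin.
have F0 : 0 < \prod_(a < N - l) ((N - a)%:R : R).
  apply: prodr_gt0 => a _; rewrite ltr0n subn_gt0.
  by apply: leq_trans (ltn_ord a) (leq_subr _ _).
have H := prod_harmonic_le (leq_subr l N) (c := 3 / q) (S := S).
have {}H : \prod_(a < N - l) (1 + 3 / q / (N - a)%:R) <= N.+1%:R ^+ S.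
  by apply: H; rewrite qS andbT divr_ge0 // ltW.
set p := \prod_(a < N - l) ((N - a)%:R : R) in F0.
have PE : P = p ^- 2 / q ^+ (N - l) * \prod_(a < N - l) (1 + 3 / q / (N - a)%:R).
  rewrite /P big_split /=; congr (_ * _); rewrite prodfV big_split /= prodrXl -/p.
  by rewrite prodr_const card_ord invfM.
have NE : N`!%:R = p * l`!%:R by rewrite -(prod_ffact R (leq_subr l N)) subKn.
rewrite PE NE.
have qq : q ^+ N <= q ^+ (N - l) by rewrite ler_wiXn2l ?leq_subr // ltW.
have Q0 : 0 < q ^+ N by rewrite exprn_gt0.
have Q0' : 0 < q ^+ (N - l) by rewrite exprn_gt0.
apply: (@le_trans _ _ (p^-1 / q ^+ N * N.+1%:R ^+ S)); last first.
  by rewrite le_eqVlt; apply/orP; left; apply/eqP; field; rewrite !lt0r_neq0.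
set X := \prod_(a < _) _ in H *.
have -> : l`!%:R^-1 * (p * l`!%:R * (p ^- 2 / q ^+ (N - l) * X)) = p^-1 / q ^+ (N - l) * X.
  by field; rewrite !lt0r_neq0.
have X0 : 0 <= X.
  apply: prodr_ge0 => a _; rewrite addr_ge0 // divr_ge0 // divr_ge0 //; exact: ltW.
apply: ler_pM => //; first by rewrite divr_ge0 ?invr_ge0 ?ltW.
by rewrite ler_pM2l ?invr_gt0 // lef_pV2.
Qed.

End Kernel.

(** * The random graph *)

Lemma set2_eq (T : finType) (a b c d : T) : [set a; b] = [set c; d] ->
  a = c /\ b = d \/ a = d /\ b = c.
Proof.
move=> /setP e; have := e a; have := e b; have := e c; have := e d.
rewrite !inE !eqxx ?orbT /= => d1 c1 /esym b1 /esym a1.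
case/orP: a1 => /eqP ac.
  by case/orP: d1 => /eqP da; [case/orP: b1 => /eqP bd; left; split; congruence | left].
by case/orP: c1 => /eqP ca; [case/orP: b1 => /eqP bd; right; split; congruence | right].
Qed.

Section Columns.

Variables (R : realType) (n N k : nat).

Implicit Types (p : R) (vs : {ffun 'I_k * 'I_N -> 'I_n}) (rs : {ffun 'I_k -> {perm 'I_N}}).

(* [vs (c, a)] is the vertex treated at step [a] of column [c], and [rs c a]
   the row in which it is put. *)
Definition member vs rs (c : 'I_k) (i : 'I_N) : 'I_n := vs (c, ((rs c)^-1)%g i).

(* The edges that allow the vertex of step [x.1] of column [c] to join row [x.2]. *)
Definition needed vs rs (c : 'I_k) (x : 'I_N * 'I_N) : {set {set 'I_n}} :=
  [set [set vs (c, x.1); member vs rs d x.2] | d : 'I_k in [set d : 'I_k | (d < c)%N]].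

Definition available vs rs (G : {set {set 'I_n}}) (c : 'I_k) : {set 'I_N * 'I_N} :=
  [set x | needed vs rs c x \subset G].

Lemma member_inj vs rs (c d : 'I_k) (i j : 'I_N) : injective vs ->
  member vs rs c i = member vs rs d j -> c = d /\ i = j.
Proof. by move=> vsI /vsI [cd]; rewrite cd => /perm_inj ->. Qed.

Lemma vs_member vs rs (c d : 'I_k) (a i : 'I_N) : injective vs ->
  vs (c, a) = member vs rs d i -> c = d.
Proof. by move=> vsI /vsI []. Qed.

Lemma card_needed vs rs (c : 'I_k) (x : 'I_N * 'I_N) : injective vs -> #|needed vs rs c x| = c.
Proof.
move=> vsI; rewrite card_in_imset.
  rewrite -sum1_card; under eq_bigl => b do rewrite inE.
  by rewrite -(big_ord_widen k (fun=> 1%N)) ?sum1_card ?card_ord // ltnW.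
move=> d d'; rewrite !inE => dc dc' /set2_eq [[_ /(member_inj vsI)[]] //|[e _]].
by move: dc'; rewrite (vs_member vsI e) ltnn.
Qed.

Lemma needed_pairs vs rs (c : 'I_k) (x : 'I_N * 'I_N) : injective vs ->
  needed vs rs c x \subset pairs n.
Proof.
move=> vsI; apply/subsetP => e /imsetP[d]; rewrite inE => dc ->; rewrite inE cards2.
by case: (vs (c, x.1) =P member vs rs d x.2) => // e'; move: dc; rewrite (vs_member vsI e') ltnn.
Qed.

(** The endpoint in the later column is the vertex being placed, the other one is a member of the
    row in question; so an edge is inspected for a single step and a single row. This is the
    freshness of the edges. *)
Lemma needed_disjoint vs rs (c d : 'I_k) (x y : 'I_N * 'I_N) e : injective vs ->
  e \in needed vs rs c x -> e \in needed vs rs d y -> c = d /\ x = y.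
Proof.
move=> vsI /imsetP[c' cc' ->] /imsetP[d' dd' e']; move: cc' dd' e'.
rewrite !inE => cc' dd' /set2_eq [[/vsI[cd ab] e2]|[e1 e2]].
  by split=> //; case: x y ab e2 => [a i] [b j] /= -> /(member_inj vsI)[_ ->].
have c1 := vs_member vsI e1; have c2 := vs_member vsI (esym e2).
by move: dd'; rewrite -c1 c2 => /(ltn_trans cc'); rewrite ltnn.
Qed.

(** In column [c] every row already has [c] members, so an entry of its bipartite graph is present
    with probability [p ^ c]. *)
Lemma mean_columns p vs rs (F : 'I_k -> {set 'I_N * 'I_N} -> R) : injective vs ->
  bmean p (pairs n) (fun G => \prod_c F c (available vs rs G c)) =
  \prod_(c < k) bmean (p ^+ c) setT (F c).
Proof.
move=> vsI; apply: (@bmean_blocks R p _ _ _ (pairs n) (needed vs rs) (fun c : 'I_k => c : nat)).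
- by move=> c x; apply: needed_pairs.
- by move=> c d x y e; apply: needed_disjoint.
- by move=> c x; apply: card_needed.
Qed.

Definition total (F : {perm 'I_N} -> {set 'I_N * 'I_N} -> R) (G : {set {set 'I_n}}) : R :=
  \sum_(vs : {ffun 'I_k * 'I_N -> 'I_n} | injectiveb vs)
    \sum_(rs : {ffun 'I_k -> {perm 'I_N}}) \prod_c F (rs c) (available vs rs G c).

Lemma card_vs : n = (k * N)%N ->
  \sum_(vs : {ffun 'I_k * 'I_N -> 'I_n} | injectiveb vs) 1 = n`!%:R :> R.
Proof.
move=> en; rewrite sumr_const; congr _%:R.
have := card_inj_ffuns ('I_k * 'I_N)%type 'I_n; rewrite card_prod !card_ord -en ffactnn => <-.
by rewrite cardsE; apply: eq_card.
Qed.

(** For fixed [vs] and [rs] the columns are independent, with laws that depend on [c] alone; the sum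
    over [rs] then distributes over the product. *)
Lemma mean_total p (F : {perm 'I_N} -> {set 'I_N * 'I_N} -> R) : n = (k * N)%N ->
  bmean p (pairs n) (total F) =
  n`!%:R * \prod_(c < k) bmean (p ^+ c) setT (fun Y => \sum_s F s Y).
Proof.
move=> en; rewrite /total bmean_sum -card_vs // mulr_suml; apply: eq_bigr => vs /injectiveP vsI.
rewrite bmean_sum mul1r.
under eq_bigr => rs _ do rewrite (@mean_columns p vs rs (fun c => F (rs c)) vsI).
under [RHS]eq_bigr => c _ do rewrite bmean_sum.
by rewrite bigA_distr_bigA.
Qed.

Definition mul_at (c : 'I_k) (s : {perm 'I_N}) rs : {ffun 'I_k -> {perm 'I_N}} :=
  [ffun d => if d == c then (s * rs d)%g else rs d].

Lemma available_mul_at vs rs G (c d : 'I_k) s : (c <= d)%N ->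
  available vs (mul_at d s rs) G c = available vs rs G c.
Proof.
move=> cd; apply/setP => x; rewrite !inE.
suff -> : needed vs (mul_at d s rs) c x = needed vs rs c x by [].
apply: eq_in_imset => e; rewrite inE => ec; congr [set _; _].
by rewrite /member ffunE; case: eqP => // ed; move: ec; rewrite ed ltnNge cd.
Qed.

(** The graph of a column depends on the rows chosen in earlier columns, so the last column is
    summed first. Translating one coordinate of [rs] by all permutations keeps the sums over full
    families [rs], at the cost of a factor [N!] per column. *)
Lemma sum_columns_le1 vs G (F : {perm 'I_N} -> {set 'I_N * 'I_N} -> R) :
  (forall s Y, 0 <= F s Y) -> (forall Y, \sum_s F s Y <= 1) ->
  \sum_(rs : {ffun 'I_k -> {perm 'I_N}}) \prod_c F (rs c) (available vs rs G c) <= 1.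
Proof.
move=> F0 F1; pose S j := \sum_(rs : {ffun 'I_k -> {perm 'I_N}})
  \prod_(c : 'I_k | (c < j)%N) F (rs c) (available vs rs G c).
have N0 : 0 < N`!%:R :> R by rewrite ltr0n fact_gt0.
have SS j : (j < k)%N -> N`!%:R * S j.+1 <= S j.
  move=> jk; pose c0 := Ordinal jk.
  have -> : N`!%:R * S j.+1 = \sum_(s : {perm 'I_N})
      \sum_rs \prod_(c : 'I_k | (c < j.+1)%N) F (mul_at c0 s rs c) (available vs (mul_at c0 s rs) G c).
    rewrite (eq_bigr (fun=> S j.+1)); last first.
      move=> s _; rewrite /S [RHS](reindex_inj (h := mul_at c0 s)) // => rs rs' e.
      apply/ffunP => d; have := congr1 (fun f : {ffun _ -> _} => f d) e; rewrite !ffunE.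
      by case: eqP => // _; apply: mulgI.
    rewrite sumr_const mulr_natl; congr (_ *+ _); rewrite -card_Sn; exact: eq_card.
  rewrite exchange_big; apply: ler_sum => rs _.
  have P0 : 0 <= \prod_(c : 'I_k | (c < j)%N) F (rs c) (available vs rs G c).
    exact: prodr_ge0.
  rewrite -[leRHS]mulr1; apply: le_trans (ler_wpM2l P0 (F1 (available vs rs G c0))).
  rewrite mulr_sumr (reindex_inj (mulIg (rs c0)^-1%g)); apply: ler_sum => s _.
  rewrite (bigD1 c0) ?leqnn //= mulrC le_eqVlt; apply/orP; left; apply/eqP; congr (_ * _).
    rewrite (eq_bigl (fun c : 'I_k => (c < j)%N)); last first.
      by move=> c; rewrite ltnS ltn_neqAle -val_eqE /= andbC.
    apply: eq_bigr => c cj; rewrite available_mul_at; last exact: ltnW.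
    by rewrite ffunE; case: eqP => // cc; rewrite cc ltnn in cj.
  by rewrite available_mul_at // ffunE eqxx mulgKV.
have main j : (j <= k)%N -> N`!%:R ^+ j * S j <= N`!%:R ^+ k.
  elim: j => [|j IH] jk.
    rewrite expr0 mul1r /S; under eq_bigr => rs _ do rewrite big_pred0 //.
    rewrite sumr_const -natrX ler_nat (_ : #|_| = (N`! ^ k)%N) //.
    by rewrite -[in RHS](card_Sn N) -[in RHS](card_ord k) -card_ffun; exact: eq_card.
  rewrite exprSr -mulrA; apply: le_trans (IH (ltnW jk)).
  by apply: ler_wpM2l; [rewrite exprn_ge0 // ltW | exact: SS].
have := main k (leqnn k); rewrite -[leRHS]mulr1 ler_pM2l ?exprn_gt0 //.
apply: le_trans; rewrite le_eqVlt; apply/orP; left; apply/eqP.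
by apply: eq_bigr => rs _; apply: eq_bigl => c; rewrite ltn_ord.
Qed.

End Columns.

(** Cauchy-Schwarz for a 0-1 function [v] equal to 1 wherever [w] is nonzero, from the sum of the
    squares of [V * w i - s * v i]. If [V = 0], all the [w i] vanish. *)
Lemma sum_sqr_le (R : realType) (I : finType) (P : pred I) (v w : I -> R) :
  (forall i, v i * w i = w i) -> (forall i, v i * v i = v i) ->
  (\sum_(i | P i) w i) ^+ 2 <= (\sum_(i | P i) v i) * \sum_(i | P i) w i ^+ 2.
Proof.
move=> vw vv; set s := \sum_(i | P i) w i; set V := \sum_(i | P i) v i.
set Q := \sum_(i | P i) w i ^+ 2.
have V0 : 0 <= V by apply: sumr_ge0 => i _; rewrite -vv -expr2 sqr_ge0.
have : 0 <= \sum_(i | P i) (V * w i - s * v i) ^+ 2 by apply: sumr_ge0 => i _; exact: sqr_ge0.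
have -> : \sum_(i | P i) (V * w i - s * v i) ^+ 2 = V * (V * Q - s ^+ 2).
  rewrite (eq_bigr (fun i => V ^+ 2 * w i ^+ 2 + (- (2 * V * s) * w i + s ^+ 2 * v i))); last first.
    move=> i _; have e1 := vw i; have e2 := vv i.
    transitivity (V ^+ 2 * w i ^+ 2 - 2 * V * s * (v i * w i) + s ^+ 2 * (v i * v i)); first by ring.
    by rewrite e1 e2; ring.
  by rewrite !big_split /= -!mulr_sumr -/s -/V -/Q; ring.
have [VV|V1] := eqVneq V 0; last first.
  have {}V1 : 0 < V by rewrite lt_def V1.
  by rewrite pmulr_rge0 // subr_ge0.
move=> _; suff -> : s = 0 by rewrite expr0n /= VV mul0r.
have v0 i : P i -> v i = 0.
  move=> Pi; apply/eqP; move/eqP: VV; rewrite psumr_eq0; last first.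
    by move=> j _; rewrite -vv -expr2 sqr_ge0.
  by move=> /allP/(_ i (mem_index_enum i)); rewrite Pi.
by rewrite /s big1 // => i Pi; rewrite -vw v0 // mul0r.
Qed.

(** * Typical graphs: many leaves and a small second moment of the estimate *)

Section Typical.

Variables (R : realType) (n N k : nat).
Hypothesis nkN : n = (k * N)%N.
Hypothesis N0 : (0 < N)%N.

Implicit Types (p : R) (G : {set {set 'I_n}}).

(* [leaf_weight] is the sum over the leaves of the estimate returned there, that is,
   the second moment of the estimate. *)
Definition leaves G : R := total k (fun s Y => \prod_(a : 'I_N) hit R s Y a) G.

Definition leaf_weight G : R :=
  n`!%:R * total k (fun s Y => \prod_(a : 'I_N) (hit R s Y a * (nfree s Y a)%:R)) G.

Lemma total_ge0 (F : {perm 'I_N} -> {set 'I_N * 'I_N} -> R) G :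
  (forall s Y, 0 <= F s Y) -> 0 <= total k F G.
Proof. by move=> F0; apply: sumr_ge0 => vs _; apply: sumr_ge0 => rs _; apply: prodr_ge0. Qed.

Lemma leaf_weight_ge0 G : 0 <= leaf_weight G.
Proof.
by rewrite /leaf_weight mulr_ge0 // total_ge0 // => s Y; apply: prodr_ge0 => a _; rewrite mulr_ge0.
Qed.

(** A nonzero weight requires every step to be admissible, through [prefix] before the tail and
    through [covers] on it. *)
Lemma kernel_hit l s (Y : {set 'I_N * 'I_N}) :
  (\prod_a hit R s Y a) * kernel R l s Y = kernel R l s Y.
Proof.
have [[a aY]|H] := pselect (exists a, s a \notin row_of Y a); last first.
  rewrite big1 ?mul1r // => a _; rewrite /hit; case: (boolP (s a \in row_of Y a)) => // aY.
  by case: H; exists a.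
suff -> : kernel R l s Y = 0 by rewrite mulr0.
rewrite /kernel; have [aN|aN] := ltnP a (N - l).
  by rewrite /prefix (bigD1 a) //= /hit (negPf aY) !mul0r.
rewrite (_ : covers s Y (tail N l) = false) ?mul0r ?mulr0 //.
by apply/negbTE/forall_inPn; exists a; first by rewrite inE.
Qed.

Lemma hits_idem s (Y : {set 'I_N * 'I_N}) :
  (\prod_a hit R s Y a) * (\prod_a hit R s Y a) = \prod_a hit R s Y a.
Proof.
by rewrite -big_split; apply: eq_bigr => a _ /=; rewrite /hit -natrM; case: (_ \in _).
Qed.

Lemma total_kernel_sqr_le l G :
  total k (kernel R (N := N) l) G ^+ 2 <=
  leaves G * total k (fun (s : {perm 'I_N}) Y => kernel R l s Y ^+ 2) G.
Proof.
rewrite /leaves /total !pair_big_dep /=.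
under [X in _ <= _ * X]eq_bigr => z _ do rewrite prodrXl.
apply: sum_sqr_le => z; rewrite -big_split; apply: eq_bigr => c _ /=.
  exact: kernel_hit.
exact: hits_idem.
Qed.

(** The squared quantity is the mean number of leaves. The size-biased branching number at step [a]
    has mean [1 + (N - a - 1) q], which is [(N - a) q] times [1 + (1 - q) / q / (N - a)]; the latter
    factors are controlled by [prod_harmonic_le]. *)
Lemma mean_leaf_weight p S : 0 < p <= 1 -> (p ^+ k)^-1 <= S%:R ->
  bmean p (pairs n) leaf_weight <=
  (n`!%:R * \prod_(c < k) (N`!%:R * (p ^+ c) ^+ N)) ^+ 2 * (N.+1%:R ^+ S) ^+ k.
Proof.
move=> /andP[p0 p1] pS; rewrite bmeanZ mean_total // [leLHS]mulrA -expr2 exprMn -[leRHS]mulrA.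
apply: ler_wpM2l; first by rewrite exprn_ge0.
have pw (x : R) m : x ^+ m = \prod_(c < m) x by rewrite prodr_const card_ord.
rewrite -prodrXl [_ ^+ k]pw -big_split /=.
apply: ler_prod => c _; set q := p ^+ c.
have q0 : 0 < q by rewrite exprn_gt0.
have q1 : q <= 1 by rewrite exprn_ile1 // ltW.
rewrite bmean_sum.
have one s : bmean q setT (fun Y => \prod_(a : 'I_N) (hit R s Y a * (nfree s Y a)%:R)) =
     N`!%:R * q ^+ N * q ^+ N * \prod_(a < N) (1 + (1 - q) / q / (N - a)%:R).
  rewrite (@bmean_column R N q xpredT (fun m => m%:R) s).
  have -> : N`!%:R = \prod_(a < N) ((N - a)%:R : R).
    by rewrite -(prod_ffact R (leqnn N)) subnn mulr1.
  rewrite pw -!big_split /=; apply: eq_bigr => a _.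
  rewrite binmean_succ; have aN : (0 < N - a)%N by rewrite subn_gt0.
  have -> : (N - a)%:R = (N - a).-1%:R + 1 :> R by rewrite natr1 prednK.
  by field; rewrite natr1 pnatr_eq0 lt0r_neq0.
rewrite (eq_bigr _ (fun s _ => one s)) sumr_const (_ : #|_| = N`!); last first.
  by rewrite -card_Sn; exact: eq_card.
have H0 : 0 <= \prod_(a < N) (1 + (1 - q) / q / (N - a)%:R).
  apply: prodr_ge0 => a _; rewrite addr_ge0 // divr_ge0 // divr_ge0 ?subr_ge0 //; exact: ltW.
have H1 : \prod_(a < N) (1 + (1 - q) / q / (N - a)%:R) <= N.+1%:R ^+ S.
  apply: prod_harmonic_le => //; apply/andP; split.
    by rewrite divr_ge0 ?subr_ge0 // ltW.
  apply: le_trans pS; rewrite ler_pdivrMr //.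
  rewrite mulrC ler_pdivlMr ?exprn_gt0 //.
  have : p ^+ k <= q by apply: ler_wiXn2l; rewrite ?p1 ?(ltW p0) // ltnW.
  have : 0 < p ^+ k by rewrite exprn_gt0.
  by nra.
apply/andP; split.
  by rewrite mulrn_wge0 // !mulr_ge0 // exprn_ge0 // ltW.
rewrite -[leLHS]mulr_natl [leLHS]mulrA.
have -> : (N`!%:R * q ^+ N) ^+ 2 = N`!%:R * (N`!%:R * q ^+ N * q ^+ N) by ring.
apply: ler_wpM2l => //.
by rewrite !mulr_ge0 // exprn_ge0 // ltW.
Qed.

Definition defect (q : R) (l : nat) : R := (1 - q) ^+ l / q + block_bound (1 - q) l.

Lemma le_defect (q q' : R) l : 0 < q -> q <= q' -> q' <= 1 -> defect q' l <= defect q l.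
Proof.
move=> q0 qq q1; have x0 : 0 <= 1 - q' by rewrite subr_ge0.
have xx : 1 - q' <= 1 - q by rewrite lerD2l lerN2.
have mono m : (1 - q') ^+ m <= (1 - q) ^+ m.
  by apply: lerXn2r => //; rewrite nnegrE // (le_trans x0).
apply: lerD; last by apply: ler_sum => j _; rewrite ler_wpM2l // mulr_ge0.
apply: ler_pM => //; first exact: exprn_ge0.
  by rewrite invr_ge0 (le_trans (ltW q0)).
by rewrite lef_pV2 // posrE ?(lt_le_trans q0).
Qed.

Lemma mean_total_kernel_ge p l : 0 < p <= 1 -> (l <= N)%N ->
  1 - k%:R * defect (p ^+ k) l <= bmean p (pairs n) (fun G => total k (kernel R (N := N) l) G / n`!%:R).
Proof.
move=> /andP[p0 p1] lN.
have n0 : n`!%:R != 0 :> R by rewrite pnatr_eq0 -lt0n fact_gt0.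
rewrite (eq_bmean p (G := fun G => n`!%:R^-1 * total k (kernel R (N := N) l) G)); last first.
  by move=> G _; rewrite mulrC.
rewrite bmeanZ mean_total // mulKf //.
pose m (c : 'I_k) : R := bmean (p ^+ c) setT (fun Y : {set 'I_N * 'I_N} => \sum_s kernel R l s Y).
rewrite -[leRHS]/(\prod_c m c).
have m1 c : m c <= 1.
  rewrite -[leRHS](bmean_const (p ^+ c) [set: 'I_N * 'I_N]); apply: bmean_le.
    by rewrite exprn_ge0 ?exprn_ile1 // ltW.
  by move=> Y _; exact: sum_kernel_le1.
have m0 c : 0 <= m c.
  rewrite -[leLHS](bmean_const (p ^+ c) [set: 'I_N * 'I_N]); apply: bmean_le.
    by rewrite exprn_ge0 ?exprn_ile1 // ltW.
  by move=> Y _; apply: sumr_ge0 => s _; exact: kernel_ge0.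
have dm c : 1 - m c <= defect (p ^+ k) l.
  have q0 : 0 < p ^+ c by rewrite exprn_gt0.
  have q1 : p ^+ c <= 1 by rewrite exprn_ile1 // ltW.
  have q01 : 0 < p ^+ c <= 1 by rewrite q0.
  rewrite lerBlDr -lerBlDl; apply: le_trans (bmean_kernel_ge lN q01).
  rewrite lerD2l lerN2; apply: le_defect => //; first by rewrite exprn_gt0.
  by apply: ler_wiXn2l; rewrite ?p1 ?(ltW p0) // ltnW.
have -> : \prod_c m c = \prod_(c < k) (1 - (1 - m c)) by apply: eq_bigr => c _; rewrite subKr.
apply: le_trans (prod_one_sub_ge _ _) => [|c]; last first.
  by rewrite subr_ge0 m1 lerBlDr lerDl m0.
rewrite lerD2l lerN2 (_ : _ * _ = \sum_(c < k) defect (p ^+ k) l); last first.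
  by rewrite sumr_const card_ord mulr_natl.
by apply: ler_sum => c _; exact: dm.
Qed.

Lemma mean_total_kernel_sqr_le p l S : 0 < p <= 1 -> (l <= N)%N -> 3 / p ^+ k <= S%:R ->
  bmean p (pairs n) (fun G => total k (fun (s : {perm 'I_N}) Y => kernel R l s Y ^+ 2) G / n`!%:R) <=
  (l`!%:R * N.+1%:R ^+ S) ^+ k / \prod_(c < k) (N`!%:R * (p ^+ c) ^+ N).
Proof.
move=> /andP[p0 p1] lN pS.
have n0 : n`!%:R != 0 :> R by rewrite pnatr_eq0 -lt0n fact_gt0.
rewrite (eq_bmean p (G := fun G => n`!%:R^-1 * total k (fun (s : {perm 'I_N}) Y => kernel R l s Y ^+ 2) G)); last first.
  by move=> G _; rewrite mulrC.
rewrite bmeanZ mean_total // mulKf //.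
have pw (x : R) m : x ^+ m = \prod_(c < m) x by rewrite prodr_const card_ord.
rewrite [_ ^+ k]pw -prodfV -big_split /=; apply: ler_prod => c _.
have q0 : 0 < p ^+ c by rewrite exprn_gt0.
have q1 : p ^+ c <= 1 by rewrite exprn_ile1 // ltW.
have q01 : 0 < p ^+ c <= 1 by rewrite q0.
apply/andP; split.
  rewrite -[leLHS](bmean_const (p ^+ c) [set: 'I_N * 'I_N]); apply: bmean_le; first by rewrite ltW.
  by move=> Y _; apply: sumr_ge0 => s _; exact: sqr_ge0.
apply: (bmean_kernel_sqr_le lN q01); apply: le_trans pS.
rewrite ler_pM2l // lef_pV2 ?posrE ?exprn_gt0 //.
by apply: ler_wiXn2l; rewrite ?p1 ?(ltW p0) // ltnW.
Qed.

Definition typical (C : R) G : bool := (0 < leaves G) && (leaf_weight G <= C * leaves G ^+ 2).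

Lemma mean_typical p l S : 0 < p <= 1 -> (l <= N)%N -> 3 / p ^+ k <= S%:R ->
  forall C, C = 16 * N%:R ^+ 3 * (N.+1%:R ^+ S) ^+ k * ((l`!%:R * N.+1%:R ^+ S) ^+ k) ^+ 2 ->
  1 - (2 * k%:R * defect (p ^+ k) l + 2 / N%:R) <=
  bmean p (pairs n) (fun G => (typical C G)%:R).
Proof.
move=> p01 lN pS C; have /andP[p0 p1] := p01.
set T1 := (N.+1%:R ^+ S) ^+ k; set T2 := (l`!%:R * _) ^+ k => CE.
pose A G : R := total k (kernel R (N := N) l) G / n`!%:R.
pose B G : R := total k (fun (s : {perm 'I_N}) Y => kernel R l s Y ^+ 2) G / n`!%:R.
pose mu : R := \prod_(c < k) (N`!%:R * (p ^+ c) ^+ N).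
pose b := T2 / mu; pose mb := (n`!%:R * mu) ^+ 2 * T1.
have nf : 0 < n`!%:R :> R by rewrite ltr0n fact_gt0.
have NR : 0 < N%:R :> R by rewrite ltr0n.
have mu0 : 0 < mu by apply: prodr_gt0 => c _; rewrite mulr_gt0 ?ltr0n ?fact_gt0 // !exprn_gt0.
have T10 : 0 < T1 by rewrite !exprn_gt0.
have T20 : 0 < T2 by rewrite exprn_gt0 // mulr_gt0 ?ltr0n ?fact_gt0 // exprn_gt0.
have b0 : 0 < b by rewrite divr_gt0.
have mb0 : 0 < mb by rewrite mulr_gt0 // exprn_gt0 // mulr_gt0.
have A0 G : 0 <= A G.
  by rewrite divr_ge0 // total_ge0 // => s Y; exact: kernel_ge0.
have A1 G : A G <= 1.
  rewrite ler_pdivrMr // mul1r -(card_vs R nkN); apply: ler_sum => vs _.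
  apply: sum_columns_le1 => [s Y|Y]; [exact: kernel_ge0 | exact: sum_kernel_le1].
have B0 G : 0 <= B G by rewrite divr_ge0 // total_ge0 // => s Y; exact: sqr_ge0.
have M0 := leaf_weight_ge0.
(* A single linear inequality replaces three exceptional events. The indicator of a typical graph
   dominates [2 A - 1] minus two Markov terms: that expression is at most 1 as [A <= 1], and at most
   0 as soon as one of the three conditions fails. *)
apply: (@le_trans _ _ (bmean p (pairs n) (fun G => (2 * A G - 1) +
    (- (N%:R * b)^-1 * B G + - (N%:R * mb)^-1 * leaf_weight G)))).
  rewrite !bmeanD (bmeanZ _ _ 2 A) (bmeanZ _ _ _ B) (bmeanZ _ _ _ leaf_weight) bmean_const.
  have hA := mean_total_kernel_ge p01 lN.
  have hB := mean_total_kernel_sqr_le p01 lN pS.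
  have hM := mean_leaf_weight (S := S) p01 _.
  have {}hM : bmean p (pairs n) leaf_weight <= mb.
    apply: hM; apply: le_trans pS; rewrite ler_peMl ?invr_ge0 ?exprn_ge0 ?ltW //.
    by rewrite ltr1n.
  have iB : (N%:R * b)^-1 * bmean p (pairs n) B <= N%:R^-1.
    rewrite invfM -mulrA ler_piMr ?invr_ge0 ?(ltW NR) // mulrC ler_pdivrMr // mul1r; exact: hB.
  have iM : (N%:R * mb)^-1 * bmean p (pairs n) leaf_weight <= N%:R^-1.
    by rewrite invfM -mulrA ler_piMr ?invr_ge0 ?(ltW NR) // mulrC ler_pdivrMr // mul1r.
  rewrite -/A in hA; move: hA iB iM; rewrite !mulNr; lra.
apply: bmean_le => [|G _]; first by rewrite ltW.
have Nb0 : 0 < N%:R * b by exact: mulr_gt0.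
have Nm0 : 0 < N%:R * mb by exact: mulr_gt0.
have iNb : 0 < (N%:R * b)^-1 by rewrite invr_gt0.
have iNm : 0 < (N%:R * mb)^-1 by rewrite invr_gt0.
have nB : 0 <= (N%:R * b)^-1 * B G by rewrite mulr_ge0 // ltW.
have nM : 0 <= (N%:R * mb)^-1 * leaf_weight G by rewrite mulr_ge0 // ltW.
have aG := A1 G; rewrite !mulNr.
have [Ah|Al] := lerP (2^-1) (A G); last first.
  by apply: (@le_trans _ _ 0); [move: nB nM Al; lra | rewrite ler0n].
have [Bh|Bl] := lerP (B G) (N%:R * b); last first.
  have : 1 <= (N%:R * b)^-1 * B G by rewrite [leRHS]mulrC ler_pdivlMr // mul1r; exact: ltW.
  by move=> h; apply: (@le_trans _ _ 0); [move: h nM aG; lra | rewrite ler0n].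
have [Mh|Ml] := lerP (leaf_weight G) (N%:R * mb); last first.
  have : 1 <= (N%:R * mb)^-1 * leaf_weight G by rewrite [leRHS]mulrC ler_pdivlMr // mul1r; exact: ltW.
  by move=> h; apply: (@le_trans _ _ 0); [move: h nB aG; lra | rewrite ler0n].
suff -> : typical C G = true by move: nB nM aG; rewrite mulr1n; lra.
have AB : A G ^+ 2 <= leaves G / n`!%:R * B G.
  have := total_kernel_sqr_le l G; set KA := total _ _ _; set KB := total _ _ _ => h.
  have -> : leaves G / n`!%:R * B G = leaves G * KB / n`!%:R ^+ 2.
    by rewrite /B -/KB; field; rewrite lt0r_neq0.
  by rewrite /A -/KA expr_div_n ler_pM2r ?invr_gt0 ?exprn_gt0.
have z0 : 0 <= leaves G / n`!%:R.
  by rewrite divr_ge0 // total_ge0 // => s Y; apply: prodr_ge0.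
have q4 : 4^-1 <= A G ^+ 2.
  by rewrite (_ : 4^-1 = 2^-1 ^+ 2); [apply: lerXn2r; rewrite ?nnegrE ?invr_ge0 | field].
have zb : 4^-1 <= leaves G / n`!%:R * (N%:R * b).
  by apply: le_trans q4 (le_trans AB _); apply: ler_wpM2l.
(* [A >= 1/2] and [B <= N b] force this many leaves by Cauchy-Schwarz. Its square supplies the 16
   and two factors [N] of [C]; the third [N] is the Markov bound on [leaf_weight]. *)
pose lo := n`!%:R * mu / (4 * N%:R * T2).
have lo0 : 0 < lo by rewrite divr_gt0 ?mulr_gt0.
have loL : lo <= leaves G.
  have -> : lo = 4^-1 * (n`!%:R / (N%:R * b)).
    by rewrite /lo /b; field; rewrite !lt0r_neq0.
  have -> : leaves G = leaves G / n`!%:R * (N%:R * b) * (n`!%:R / (N%:R * b)).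
    by field; rewrite !lt0r_neq0.
  by rewrite ler_pM2r // divr_gt0 // mulr_gt0.
rewrite /typical (lt_le_trans lo0 loL) /=; apply: le_trans Mh _.
have -> : N%:R * mb = C * lo ^+ 2.
  by rewrite /mb /lo CE; field; rewrite !lt0r_neq0.
apply: ler_wpM2l; first by rewrite CE !mulr_ge0 ?exprn_ge0 // ltW.
by apply: lerXn2r; rewrite ?nnegrE ?(ltW lo0) // (le_trans (ltW lo0)).
Qed.

End Typical.

(** * The leaves of the search tree are labelled clique covers *)

(** The membership indicators let the tree be written as a sum over all sequences of pairs; those
    that leave the tree get weight 0. *)
Definition node_weight (R : realType) n N g (f : nat -> R) (h : seq (nat * nat)) (x : nat * nat) : R :=
  (x.1 \in vcand n h)%:R * (x.2 \in rcand N g h x.1)%:R *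
  (f (size (vcand n h)) * f (size (rcand N g h x.1))).

Lemma node_weightE (R : realType) n N g (f : nat -> R) h v i :
  node_weight n N g f h (v, i) = (v \in vcand n h)%:R * (i \in rcand N g h v)%:R *
    (f (size (vcand n h)) * f (size (rcand N g h v))).
Proof. by []. Qed.

Definition nats n N (x : seq ('I_n * 'I_N)) : seq (nat * nat) :=
  [seq (nat_of_ord y.1, nat_of_ord y.2) | y <- x].

Lemma sum_seq_ord (R : realType) n (s : seq nat) (F : nat -> R) : uniq s ->
  all (fun i => i < n)%N s -> \sum_(i <- s) F i = \sum_(i < n) (nat_of_ord i \in s)%:R * F i.
Proof.
move=> us /allP sn.
have -> : \sum_(i < n) (nat_of_ord i \in s)%:R * F i = \sum_(i <- iota 0 n | i \in s) F i.
  transitivity (\sum_(0 <= i < n | i \in s) F i); last by rewrite /index_iota subn0.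
  rewrite big_mkord [RHS]big_mkcond /=.
  by apply: eq_bigr => i _; case: ifP => _; rewrite ?mul1r ?mul0r.
have e : perm_eq s [seq i <- iota 0 n | i \in s].
  apply: uniq_perm; rewrite ?filter_uniq ?iota_uniq // => i.
  by rewrite mem_filter mem_iota add0n /=; have [/sn ->|] := boolP (i \in s).
by rewrite (perm_big _ e) big_filter.
Qed.

Lemma vcand_uniq n h : uniq (vcand n h).
Proof. by rewrite filter_uniq // rev_uniq iota_uniq. Qed.

Lemma rcand_uniq N g h v : uniq (rcand N g h v).
Proof. by rewrite filter_uniq // rev_uniq iota_uniq. Qed.

Lemma vcand_lt n h : all (fun i => i < n)%N (vcand n h).
Proof.
by apply/allP => i; rewrite mem_filter mem_rev mem_iota add0n => /andP[_ /andP[_]].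
Qed.

Lemma rcand_lt N g h v : all (fun i => i < N)%N (rcand N g h v).
Proof.
by apply/allP => i; rewrite mem_filter mem_rev mem_iota add0n => /andP[_ /andP[_]].
Qed.

Lemma treeE (R : realType) n N g (f : nat -> R) d h :
  tree n N g f d h = \sum_(x : d.-tuple ('I_n * 'I_N))
    \prod_(t < d) node_weight n N g f (h ++ take t (nats x)) (nth (0, 0)%N (nats x) t).
Proof.
elim: d h => [|d IH] h /=.
  by rewrite (big_pred1 [tuple]) ?big_ord0 // => x; apply/esym/eqP; rewrite tuple0.
rewrite (reindex (fun q : ('I_n * 'I_N) * d.-tuple ('I_n * 'I_N) => [tuple of q.1 :: q.2])) /=; last first.
  exists (fun w => (thead w, [tuple of behead w])) => [[c w] _|w _] /=.
    by rewrite theadE; congr pair; apply: val_inj.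
  by apply: val_inj => /=; case/tupleP: w => c w.
rewrite -(pair_bigA _ (fun (y : 'I_n * 'I_N) (x : d.-tuple ('I_n * 'I_N)) =>
  \prod_(t < d.+1) node_weight n N g f (h ++ take t (nats (y :: x))) (nth (0, 0)%N (nats (y :: x)) t))) /=.
transitivity (\sum_(y : 'I_n * 'I_N) node_weight n N g f h (nat_of_ord y.1, nat_of_ord y.2) *
   tree n N g f d (rcons h (nat_of_ord y.1, nat_of_ord y.2))).
  rewrite -(pair_bigA _ (fun v i => node_weight n N g f h (nat_of_ord v, nat_of_ord i) *
    tree n N g f d (rcons h (nat_of_ord v, nat_of_ord i)))) /=.
  rewrite (sum_seq_ord _ (vcand_uniq n h) (vcand_lt n h)); apply: eq_bigr => v _.
  rewrite (sum_seq_ord _ (rcand_uniq N g h v) (rcand_lt N g h v)) mulr_sumr; apply: eq_bigr => i _.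
  by rewrite /node_weight /= !mulrA.
apply: eq_bigr => y _; rewrite IH mulr_sumr; apply: eq_bigr => x _.
rewrite big_ord_recl /= cats0; congr (_ * _); apply: eq_bigr => t _.
by rewrite /= -cat_rcons.
Qed.

Section Leaves.

Variables (R : realType) (n N k : nat) (G : {set {set 'I_n}}) (g : nat -> nat -> bool).
Hypothesis nkN : n = (k * N)%N.
Hypothesis N0 : (0 < N)%N.
Hypothesis gG : forall u v : 'I_n, g u v = ([set u; v] \in G).

Lemma col_lt (t : 'I_n) : (t %/ N < k)%N.
Proof. by rewrite ltn_divLR // -nkN. Qed.

Definition place (t : 'I_n) : 'I_k * 'I_N := (Ordinal (col_lt t), Ordinal (ltn_pmod t N0)).

Lemma time_lt (c : 'I_k) (a : 'I_N) : (c * N + a < n)%N.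
Proof.
have cN : (c.+1 * N <= n)%N by rewrite nkN leq_mul2r ltn_ord orbT.
by apply: leq_trans cN; rewrite mulSn addnC ltn_add2r.
Qed.

Definition time (z : 'I_k * 'I_N) : 'I_n := Ordinal (time_lt z.1 z.2).

Lemma timeK : cancel time place.
Proof.
case=> c a; congr pair; apply: val_inj => /=; first by rewrite divnMDl // divn_small // addn0.
by rewrite modnMDl modn_small.
Qed.

Lemma placeK : cancel place time.
Proof. by move=> t; apply: val_inj => /=; rewrite -divn_eq. Qed.

Implicit Types (vs : {ffun 'I_k * 'I_N -> 'I_n}) (rs : {ffun 'I_k -> {perm 'I_N}}).

Definition path (z : {ffun 'I_k * 'I_N -> 'I_n} * {ffun 'I_k -> {perm 'I_N}}) :
    n.-tuple ('I_n * 'I_N) :=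
  [tuple (z.1 (place t), z.2 (place t).1 (place t).2) | t < n].

Lemma nth_path vs rs (z : 'I_k * 'I_N) : nth (0, 0)%N (nats (path (vs, rs))) (time z) =
  (nat_of_ord (vs z), nat_of_ord (rs z.1 z.2)).
Proof.
have s : (time z < size (path (vs, rs)))%N by rewrite size_tuple.
by rewrite (nth_map (tnth (path (vs, rs)) (time z))) // -tnth_nth tnth_mktuple timeK.
Qed.

Lemma size_take_path vs rs (t : 'I_n) : size (take t (nats (path (vs, rs)))) = t.
Proof. by rewrite size_takel // size_map size_tuple ltnW. Qed.

Lemma nth_take_path vs rs (z w : 'I_k * 'I_N) : (time w < time z)%N ->
  nth (0, 0)%N (take (time z) (nats (path (vs, rs)))) (time w) =
  (nat_of_ord (vs w), nat_of_ord (rs w.1 w.2)).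
Proof. by move=> wz; rewrite nth_take // nth_path. Qed.

Lemma nth_take_place vs rs (t u : 'I_n) : (u < t)%N ->
  nth (0, 0)%N (take t (nats (path (vs, rs)))) u =
  (nat_of_ord (vs (place u)), nat_of_ord (rs (place u).1 (place u).2)).
Proof. by move=> ut; rewrite nth_take // -{1}(placeK u) nth_path. Qed.

Lemma time_ltE (c d : 'I_k) (a b : 'I_N) :
  (time (d, b) < time (c, a))%N = (d < c)%N || (d == c) && (b < a)%N.
Proof.
rewrite -val_eqE /=; case: (ltngtP d c) => [dc|cd|->] /=; last by rewrite ltn_add2l.
- have : (d.+1 * N <= c * N)%N by rewrite leq_mul2r dc orbT.
  by rewrite mulSn; have := ltn_ord b; lia.
- have : (c.+1 * N <= d * N)%N by rewrite leq_mul2r cd orbT.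
  by rewrite mulSn; have := ltn_ord a; lia.
Qed.

Lemma size_filter_iota m (P : pred nat) :
  size [seq i <- rev (iota 0 m) | P i] = #|[set i : 'I_m | P i]|.
Proof.
rewrite filter_rev size_rev size_filter -val_enum_ord count_map -size_filter.
by rewrite cardE; congr size; rewrite enumT; apply: eq_filter => i; rewrite /= inE.
Qed.

Lemma size_vcand_path vs rs (t : 'I_n) : injective vs ->
  size (vcand n (take t (nats (path (vs, rs))))) = (n - t)%N.
Proof.
move=> vsI; rewrite size_filter_iota.
set s := take _ _; pose T := [set v : 'I_n | nat_of_ord v \in map fst s].
have -> : [set i : 'I_n | nat_of_ord i \notin map fst s] = ~: T by apply/setP => v; rewrite !inE.
suff cT : #|T| = t by have := cardsC T; rewrite card_ord cT => e; lia.
have -> : T = [set vs (place u) | u : 'I_n in [set u : 'I_n | (u < t)%N]].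
  apply/setP => v; rewrite inE; apply/mapP/imsetP => [[x /(nthP (0, 0)%N)[j]]|[u]].
    rewrite size_take_path => jt; pose u := Ordinal (ltn_trans jt (ltn_ord t)).
    rewrite (nth_take_place vs rs (t := t) (u := u)) // => <- /= vE.
    by exists u; rewrite ?inE //; apply: val_inj.
  rewrite inE => ut ->; exists (nat_of_ord (vs (place u)), nat_of_ord (rs (place u).1 (place u).2)) => //.
  apply/(nthP (0, 0)%N); exists u; rewrite ?size_take_path //.
  exact: nth_take_place.
rewrite card_in_imset; last by move=> u w _ _ /vsI/(can_inj placeK).
rewrite -sum1_card; under eq_bigl => b do rewrite inE.
by rewrite -(big_ord_widen n (fun=> 1%N)) ?sum1_card ?card_ord // ltnW.
Qed.

Lemma mem_vcand_path vs rs (z : 'I_k * 'I_N) : injective vs ->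
  nat_of_ord (vs z) \in vcand n (take (time z) (nats (path (vs, rs)))).
Proof.
move=> vsI; rewrite mem_filter mem_rev mem_iota add0n ltn_ord leq0n !andbT.
apply/negP => /mapP[x /(nthP (0, 0)%N)[j]]; rewrite size_take_path => jt.
pose u := Ordinal (ltn_trans jt (ltn_ord (time z))).
rewrite (nth_take_place vs rs (t := time z) (u := u)) // => <- /= /val_inj/vsI zu.
by move: (jt); rewrite zu placeK ltnn.
Qed.

(** The condition of [rcand] splits by the column of the earlier step: within column [c] it says
    that the row is still free, in earlier columns that the [needed] edges are present. *)
Lemma mem_rcand_path vs rs (c : 'I_k) (a i : 'I_N) :
  (nat_of_ord i \in rcand N g (take (time (c, a)) (nats (path (vs, rs)))) (vs (c, a))) =
  (i \in row_of (available vs rs G c) a :&: free (rs c) a).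
Proof.
rewrite mem_filter mem_rev mem_iota add0n ltn_ord leq0n !andbT size_take_path !inE.
have -> : (time (c, a) %/ N = c)%N by rewrite /= divnMDl // divn_small // addn0.
apply/allP/andP => [H|[/subsetP H ai] s].
  have Hd (d : 'I_k) (b : 'I_N) : (time (d, b) < time (c, a))%N -> rs d b = i ->
      (d < c)%N && g (vs (d, b)) (vs (c, a)).
    move=> dc db; have := H (time (d, b)).
    rewrite mem_iota add0n => /(_ dc) /implyP; rewrite nth_take_path //= db => /(_ (eqxx _)) /andP[lt ->].
    rewrite andbT -(ltn_pmul2r N0); apply: leq_ltn_trans lt; exact: leq_addr.
  split.
    apply/subsetP => e /imsetP[d]; rewrite inE => dc ->.
    have := Hd d (((rs d)^-1)%g i); rewrite permKV time_ltE dc => /(_ isT erefl) /andP[_].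
    by rewrite gG finset.setUC.
  rewrite leqNgt; apply/negP => lt; have := Hd c (((rs c)^-1)%g i).
  by rewrite permKV time_ltE lt eqxx orbT => /(_ isT erefl); rewrite ltnn.
rewrite mem_iota add0n => /andP[_ st]; apply/implyP.
pose u := Ordinal (ltn_trans st (time_lt c a)).
have su : s = time (place u) by rewrite placeK.
case Ez : (place u) su => [d b] su; rewrite su nth_take_path; last by rewrite -su.
rewrite [_.2]/= [_.1]/=.
move=> /eqP /val_inj db.
have dc : (d < c)%N || (d == c) && (b < a)%N by rewrite -time_ltE -su.
have {}dc : (d < c)%N.
  case/orP: dc => // /andP[/eqP dc ba]; move: ai; rewrite -db dc permK leqNgt ba //.
have -> : (d * N + b < c * N)%N.
  by have : (d.+1 * N <= c * N)%N; [rewrite leq_mul2r dc orbT | rewrite mulSn; have := ltn_ord b; lia].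
rewrite /= gG finset.setUC; apply: H; apply/imsetP; exists d; rewrite ?inE //.
by rewrite /member -db permK.
Qed.

Lemma size_rcand_path vs rs (c : 'I_k) (a : 'I_N) :
  size (rcand N g (take (time (c, a)) (nats (path (vs, rs)))) (vs (c, a))) =
  nfree (rs c) (available vs rs G c) a.
Proof.
rewrite [LHS]size_filter_iota; apply: eq_card => i.
by rewrite -mem_rcand_path mem_filter mem_rev mem_iota add0n ltn_ord leq0n !andbT inE.
Qed.

Lemma nth_nats (x : n.-tuple ('I_n * 'I_N)) (t : 'I_n) :
  nth (0, 0)%N (nats x) t = (nat_of_ord (tnth x t).1, nat_of_ord (tnth x t).2).
Proof.
have s : (t < size x)%N by rewrite size_tuple.
by rewrite (nth_map (tnth x t)) // -tnth_nth.
Qed.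

(** Candidates exclude the vertices already used and the rows already used in the column, so both
    choices are injective; an injective choice of [N] rows is a permutation. *)
Lemma path_surj (x : n.-tuple ('I_n * 'I_N)) :
  (forall t : 'I_n, nat_of_ord (tnth x t).1 \in vcand n (take t (nats x))) ->
  (forall t : 'I_n, nat_of_ord (tnth x t).2 \in rcand N g (take t (nats x)) (tnth x t).1) ->
  exists vs rs, injective vs /\ x = path (vs, rs).
Proof.
move=> xv xr; pose vs := [ffun z => (tnth x (time z)).1].
have szt (t : 'I_n) : size (take t (nats x)) = t by rewrite size_takel // size_map size_tuple ltnW.
have neq (t u : 'I_n) : (t < u)%N -> (tnth x t).1 != (tnth x u).1.
  move=> tu; apply/eqP => e; have := xv u; rewrite mem_filter => /andP[/mapP H _].
  apply: H; exists (nth (0, 0)%N (take u (nats x)) t); first by rewrite mem_nth ?szt.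
  by rewrite nth_take // nth_nats /= e.
have tI : injective (fun t => (tnth x t).1).
  move=> t u e; apply: val_inj; case: (ltngtP t u) => // tu.
    by move: (neq _ _ tu); rewrite e eqxx.
  by move: (neq _ _ tu); rewrite e eqxx.
have vsI : injective vs by move=> z w; rewrite !ffunE => /tI/(can_inj timeK).
pose row c a := (tnth x (time (c, a))).2.
have rneq c (a b : 'I_N) : (a < b)%N -> row c a != row c b.
  move=> ab; apply/eqP => e; have := xr (time (c, b)); rewrite mem_filter szt => /andP[/allP H _].
  have lt : (time (c, a) < time (c, b))%N by rewrite time_ltE eqxx ab orbT.
  have := H (time (c, a)); rewrite mem_iota add0n => /(_ lt) /implyP.
  rewrite nth_take // nth_nats -/(row c a) -/(row c b) e eqxx => /(_ isT) /andP[+ _].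
  rewrite [(time (c, b) : nat)]/= divnMDl // divn_small // addn0.
  by rewrite ltnNge leq_addr.
have rI c : injective (row c).
  move=> a b e; apply: val_inj; case: (ltngtP a b) => // ab.
    by move: (rneq c _ _ ab); rewrite e eqxx.
  by move: (rneq c _ _ ab); rewrite e eqxx.
pose rs := [ffun c => perm (rI c)]; exists vs, rs; split=> //.
apply: eq_from_tnth => t; rewrite tnth_mktuple /= !ffunE permE /row -surjective_pairing placeK.
by case: (tnth x t).
Qed.

Lemma tree_total (f : nat -> R) :
  tree n N g f n [::] = (\prod_(t < n) f (n - t)%N) *
    total k (fun s Y => \prod_(a : 'I_N) (hit R s Y a * f (nfree s Y a))) G.
Proof.
rewrite treeE.
pose W (x : n.-tuple ('I_n * 'I_N)) : R := \prod_(t < n)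
  node_weight n N g f ([::] ++ take t (nats x)) (nth (0, 0)%N (nats x) t).
rewrite -[LHS]/(\sum_x W x).
pose D := [set z : {ffun 'I_k * 'I_N -> 'I_n} * {ffun 'I_k -> {perm 'I_N}} | injectiveb z.1].
have pathI : injective path.
  case=> [vs rs] [vs' rs'] e; have e' z := congr1 (fun x => tnth x (time z)) e.
  have ez z : vs z = vs' z /\ rs z.1 z.2 = rs' z.1 z.2.
    by have := e' z; rewrite !tnth_mktuple timeK => -[-> ->].
  congr pair; first by apply/ffunP => z; have [] := ez z.
  by apply/ffunP => c; apply/permP => a; have [] := ez (c, a).
rewrite (bigID (fun x => x \in path @: D)) /= [X in _ + X]big1 ?addr0; last first.
  move=> x xD; apply/eqP; apply: contraNT xD => /prodf_neq0 W0.
  have node (t : 'I_n) := W0 t isT; rewrite /= in node.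
  have [t|t|vs [rs [vsI ->]]] := @path_surj x.
  - by have := node t; rewrite nth_nats /node_weight /=; case: (_ \in vcand _ _); rewrite ?mul0r ?eqxx.
  - have := node t; rewrite nth_nats /node_weight /=; case: (_ \in rcand _ _ _ _) => //.
    by rewrite mulr0 mul0r eqxx.
  - by apply: imset_f; rewrite inE; apply/injectiveP.
rewrite big_imset /=; last by move=> z w _ _; exact: pathI.
rewrite /total pair_big_dep /= mulr_sumr.
under eq_bigl => z do rewrite inE -[injectiveb _]andbT.
apply: eq_bigr => -[vs rs] /= /andP[/injectiveP vsI _].
pose Fz (z : 'I_k * 'I_N) : R := hit R (rs z.1) (available vs rs G z.1) z.2 *
  f (nfree (rs z.1) (available vs rs G z.1) z.2).
transitivity (\prod_(t < n) (f (n - t)%N * Fz (place t))).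
  apply: eq_bigr => t _; rewrite -{1 2}(placeK t); case E: (place t) => [c a].
  rewrite cat0s nth_path node_weightE mem_vcand_path // mul1r.
  rewrite size_vcand_path // size_rcand_path mem_rcand_path in_setI mem_free andbT.
  have et : time (c, a) = t by rewrite -E placeK.
  by rewrite mulrCA et.
rewrite big_split /=; congr (_ * _).
rewrite (reindex time) /=; last by exists place => z _; [exact: timeK | exact: placeK].
rewrite (eq_bigr Fz); last by move=> z _; rewrite timeK.
by rewrite -(pair_bigA _ (fun c a => Fz (c, a))).
Qed.

Lemma tree_leaves : tree n N g (fun r => r%:R ^+ 0) n [::] = leaves R N k G.
Proof.
rewrite tree_total big1 ?mul1r // /leaves; congr total.
by apply/funext => s; apply/funext => Y; apply: eq_bigr => a _; rewrite expr0 mulr1.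
Qed.

Lemma tree_leaf_weight : tree n N g (fun r => r%:R ^+ 1) n [::] = leaf_weight R N k G.
Proof.
rewrite tree_total /leaf_weight; congr (_ * _).
by rewrite -(prod_ffact R (leqnn n)) subnn mulr1.
Qed.

End Leaves.

(** * The number of leaves above one clique cover *)

Section CoverCount.

Variables (n N k : nat) (G : {set {set 'I_n}}).
Hypothesis nkN : n = (k * N)%N.
Hypothesis N0 : (0 < N)%N.
Hypothesis k0 : (0 < k)%N.

Notation rowed := {ffun 'I_N -> {ffun 'I_k -> 'I_n}}.

Definition uncurried (f : rowed) (z : 'I_N * 'I_k) : 'I_n := f z.1 z.2.

Definition clique_rows (f : rowed) : bool :=
  [forall i : 'I_N, forall c : 'I_k, forall d : 'I_k, (d < c)%N ==> ([set f i c; f i d] \in G)].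

Definition blocks (f : rowed) : {ffun 'I_N -> {set 'I_n}} := [ffun i => f i @: 'I_k].

Definition labelled_cover (h : {ffun 'I_N -> {set 'I_n}}) : bool :=
  injectiveb h && clique_cover k G (h @: 'I_N).

Lemma mem_blocks (f : rowed) i c : f i c \in blocks f i.
Proof. by rewrite ffunE imset_f. Qed.

Lemma blocks_labelled (f : rowed) : injective (uncurried f) -> clique_rows f ->
  labelled_cover (blocks f).
Proof.
move=> fI /forallP fG.
have cB i : #|blocks f i| = k.
  by rewrite ffunE card_imset ?card_ord // => c d e; have [] := fI (i, c) (i, d) e.
have dB i j x : x \in blocks f i -> x \in blocks f j -> i = j.
  rewrite !ffunE => /imsetP[c _ ->] /imsetP[d _ e].
  by have [] := fI (i, c) (j, d) e.
have ne i : exists x, x \in blocks f i by exists (f i (Ordinal k0)); exact: mem_blocks.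
have bI : injective (blocks f).
  by move=> i j e; have [x xi] := ne i; apply: (dB i j x) => //; rewrite -e.
apply/andP; split; first exact/injectiveP.
apply/and3P; split.
- apply/and3P; split.
  + apply/eqP/setP => x; rewrite inE; apply/bigcupP.
    have [g _ fg] : bijective (uncurried f).
      by apply: inj_card_bij => //; rewrite card_prod !card_ord nkN mulnC.
    exists (blocks f (g x).1); first exact: imset_f.
    by rewrite -{1}(fg x) /uncurried mem_blocks.
  + apply/trivIsetP => A B /imsetP[i _ ->] /imsetP[j _ ->] ij.
    rewrite -setI_eq0; apply/eqP/setP => x; rewrite !inE; apply/negbTE/negP => /andP[xi xj].
    by move: ij; rewrite (dB i j x xi xj) eqxx.
  + by apply/imsetP => -[i _ e]; have [x] := ne i; rewrite -e inE.
- by rewrite card_imset // card_ord nkN mulKn.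
apply/forall_inP => B /imsetP[i _ ->]; rewrite cB eqxx /=.
apply/forall_inP => u; rewrite ffunE => /imsetP[c _ ->].
apply/forall_inP => v /imsetP[d _ ->]; apply/implyP => ne'.
have H (a b : 'I_k) : (b < a)%N -> [set f i a; f i b] \in G.
  by move=> ba; have /forallP/(_ a)/forallP/(_ b)/implyP := fG i; apply.
case: (ltngtP d c) => [dc|cd|/val_inj e]; first exact: H.
  by rewrite finset.setUC; exact: H.
by rewrite e eqxx in ne'.
Qed.

Lemma blocks_fiber (h : {ffun 'I_N -> {set 'I_n}}) (f : rowed) : labelled_cover h ->
  (injectiveb (uncurried f) && clique_rows f && (blocks f == h)) =
  [forall i, injectiveb (f i) && [forall c, f i c \in h i]].
Proof.
move=> /andP[/injectiveP hI /and3P[/and3P[_ /trivIsetP tI _] _ /forall_inP hC]].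
have him i : h i \in h @: 'I_N by exact: imset_f.
have hk i : #|h i| = k by have /andP[/eqP] := hC _ (him i).
apply/idP/forallP => [/andP[/andP[/injectiveP fI _] /eqP <-] i|H].
  apply/andP; split; first by apply/injectiveP => c d e; have [] := fI (i, c) (i, d) e.
  by apply/forallP => c; exact: mem_blocks.
have fI i : injective (f i) by have /andP[/injectiveP] := H i.
have fh i c : f i c \in h i by have /andP[_ /forallP] := H i.
have bh : blocks f = h.
  apply/ffunP => i; apply/eqP; rewrite eqEcard hk ffunE card_imset // card_ord leqnn andbT.
  by apply/subsetP => x /imsetP[c _ ->].
rewrite bh eqxx andbT; apply/andP; split.
  apply/injectiveP => -[i c] [j d]; rewrite /uncurried /= => e.
  have ij : i = j.
    apply/hI/eqP; apply/negPn/negP => ne.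
    have := tI (h i) (h j) (him i) (him j) ne.
    by rewrite -setI_eq0 => /eqP/setP/(_ (f i c)); rewrite !inE fh e fh.
  by move: e; rewrite ij => /fI ->.
apply/forallP => i; apply/forallP => c; apply/forallP => d; apply/implyP => dc.
have /andP[_ /forall_inP/(_ _ (fh i c))/forall_inP/(_ _ (fh i d))/implyP] := hC _ (him i).
by apply; apply/eqP => /fI e; rewrite e ltnn in dc.
Qed.

(** Two layers of labels: an enumeration of the blocks of a cover by the rows, [N!] ways, and an
    enumeration of each block by the columns, [k!] ways each. *)
Lemma card_clique_rows :
  #|[set f : rowed | injectiveb (uncurried f) && clique_rows f]| =
  (num_clique_covers k G * N`! * k`! ^ N)%N.
Proof.
rewrite -sum1_card (partition_big blocks labelled_cover) /=; last first.
  by move=> f; rewrite inE => /andP[/injectiveP]; exact: blocks_labelled.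
rewrite (eq_bigr (fun=> (k`! ^ N)%N)); last first.
  move=> h hL; rewrite sum1_card.
  pose Fm (i : 'I_N) : pred {ffun 'I_k -> 'I_n} :=
    [pred q : {ffun 'I_k -> 'I_n} | injectiveb q && [forall c, q c \in h i]].
  rewrite (eq_card (B := family Fm)); last first.
    move=> f.
    transitivity ((f \in [set f : rowed | injectiveb (uncurried f) && clique_rows f]) && (blocks f == h)); first by [].
    rewrite inE (blocks_fiber f hL).
    by apply/forallP/familyP => H i; exact: H.
  rewrite card_family.
  have /andP[_ /and3P[_ _ /forall_inP hC]] := hL.
  have cF i : #|Fm i| = k`!.
    have him : h i \in h @: 'I_N by exact: imset_f.
    have hk : #|h i| = k by have /andP[/eqP] := hC _ him.
    have := card_inj_ffuns_on 'I_k (mem (h i)); rewrite /= hk card_ord ffactnn => <-.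
    by rewrite cardsE; apply: eq_card => q; rewrite !inE andbC.
  have fE (s : seq 'I_N) : foldr muln 1%N [seq #|Fm i| | i <- s] = (k`! ^ size s)%N.
    by elim: s => //= i s ->; rewrite cF expnS.
  by rewrite fE -cardE card_ord.
rewrite sum_nat_const; congr (_ * _)%N.
rewrite -sum1_card (partition_big (fun h : {ffun 'I_N -> {set 'I_n}} => h @: 'I_N) (clique_cover k G)) /=; last first.
  by move=> h /andP[].
rewrite (eq_bigr (fun=> N`!)); last first.
  move=> P PC; rewrite sum1_card.
  have cP : #|P| = N by case/and3P: PC => _ /eqP -> _; rewrite nkN mulKn.
  have := card_inj_ffuns_on 'I_N (mem P); rewrite /= cP card_ord ffactnn => <-.
  rewrite cardsE; apply: eq_card => h.
  transitivity (labelled_cover h && (h @: 'I_N == P)); first by [].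
  rewrite [RHS]inE /labelled_cover.
  apply/andP/andP => [[/andP[hI _] /eqP hP]|[/ffun_onP hP hI]].
    by split=> //; apply/ffun_onP => i; rewrite -hP imset_f.
  have e : h @: 'I_N = P.
    apply/eqP; rewrite eqEcard cP card_imset ?card_ord ?leqnn ?andbT; last exact/injectiveP.
    by apply/subsetP => B /imsetP[i _ ->]; exact: hP.
  by rewrite e eqxx hI PC.
by rewrite sum_nat_const /num_clique_covers cardsE.
Qed.

Variable R : realType.

(** For fixed [rs], passing from [vs] to the vertex in row [i] and column [c] is a bijection that
    turns admissibility of all steps into the clique condition on the rows. The count is thus the
    same for all [N!^k] choices of [rs]. *)
Lemma leaves_covers :
  leaves R N k G = (N`! * (N`! ^ k * k`! ^ N) * num_clique_covers k G)%:R.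
Proof.
pose good (f : rowed) : R := (injectiveb (uncurried f) && clique_rows f)%:R.
have sumg : \sum_f good f = (num_clique_covers k G * N`! * k`! ^ N)%:R.
  rewrite -card_clique_rows -sum1_card natr_sum [RHS]big_mkcond; apply: eq_bigr => f _.
  by rewrite inE /good; case: ifP.
have -> : leaves R N k G = \sum_(rs : {ffun 'I_k -> {perm 'I_N}}) \sum_f good f.
  rewrite /leaves /total exchange_big; apply: eq_bigr => rs _.
  pose place_of (f : rowed) : {ffun 'I_k * 'I_N -> 'I_n} := [ffun z => f (rs z.1 z.2) z.1].
  pose rows_of (vs : {ffun 'I_k * 'I_N -> 'I_n}) : rowed :=
    [ffun i => [ffun c => vs (c, ((rs c)^-1)%g i)]].
  have pr : cancel place_of rows_of.
    by move=> f; apply/ffunP => i; apply/ffunP => c; rewrite !ffunE /= permKV.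
  have rp : cancel rows_of place_of.
    by move=> vs; apply/ffunP => -[c a]; rewrite !ffunE /= permK.
  rewrite (reindex place_of); last by exists rows_of => z _; [exact: pr | exact: rp].
  rewrite big_mkcond; apply: eq_bigr => f _.
  have injE : injectiveb (place_of f) = injectiveb (uncurried f).
    apply/injectiveP/injectiveP => fI.
      move=> [i c] [j d] e; have := fI (c, ((rs c)^-1)%g i) (d, ((rs d)^-1)%g j).
      rewrite !ffunE /= !permKV => /(_ e) [cd]; rewrite cd => /perm_inj ->.
      by [].
    by move=> [c a] [d b]; rewrite !ffunE /= => /(fI (_, _) (_, _)) [+ cd]; rewrite cd => /perm_inj ->.
  rewrite /good injE; case: ifP => //= _.
  have av c a : hit R (rs c) (available (place_of f) rs G c) a =
      [forall d : 'I_k, (d < c)%N ==> ([set f (rs c a) c; f (rs c a) d] \in G)]%:R.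
    rewrite /hit !inE; congr (nat_of_bool _)%:R; apply/subsetP/forallP => [H d|H e /imsetP[d]].
      apply/implyP => dc; apply: H; apply/imsetP; exists d; rewrite ?inE //.
      by rewrite /member !ffunE /= permKV.
    by rewrite inE => dc ->; rewrite /member !ffunE /= permKV; have /implyP := H d; apply.
  have [/forallP H|/forallPn[i /forallPn[c H]]] := boolP (clique_rows f).
    rewrite big1 // => c _; rewrite big1 // => a _; rewrite av.
    by have /forallP/(_ c) -> := H (rs c a).
  rewrite (bigD1 c) //= (bigD1 (((rs c)^-1)%g i)) //= av permKV (negPf H).
  by rewrite !mul0r.
rewrite sumg sumr_const card_ffun card_ord (_ : #|_| = N`!); last first.
  by rewrite -card_Sn; exact: eq_card.
by rewrite -[LHS]mulr_natl -natrM; congr _%:R; lia.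
Qed.

End CoverCount.

(** * Asymptotics *)

Lemma one_sub_exp_le (R : realType) (x : R) h : 0 <= x -> x <= 1 -> (1 - x) ^+ h * (1 + h%:R * x) <= 1.
Proof.
move=> x0 x1; apply: (@le_trans _ _ ((1 - x) ^+ h * (1 + x) ^+ h)).
  by apply: ler_wpM2l; [rewrite exprn_ge0 // subr_ge0 | exact: bernoulli_ineq].
rewrite -exprMn exprn_ile1 //; first by rewrite mulr_ge0 ?subr_ge0 // addr_ge0.
by have := sqr_ge0 x; rewrite expr2; nra.
Qed.

(** The upper bound follows from the lower one by [(1 + x) ^ h * (1 - x) ^ h <= 1] and
    [1 <= (1 + 2 y) (1 - y)] for [0 <= y <= 1/2]. *)
Lemma one_add_exp_le (R : realType) (x : R) h : 0 <= x -> h%:R * x <= 2^-1 ->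
  (1 + x) ^+ h <= 1 + 2 * (h%:R * x) /\ 1 - h%:R * x <= (1 - x) ^+ h.
Proof.
move=> x0 hx; have [->|h0] := posnP h; first by rewrite !expr0 mul0r mulr0 addr0 subr0.
have h1 : 1 <= h%:R :> R by rewrite ler1n.
have x1 : x <= 2^-1 by apply: le_trans hx; rewrite ler_peMl.
have lo : 1 - h%:R * x <= (1 - x) ^+ h.
  have := @prod_one_sub_ge R 'I_h xpredT (fun=> x).
  rewrite sumr_const prodr_const card_ord mulr_natl; apply => _; rewrite x0 /=; lra.
split=> //; have : (1 + x) ^+ h * (1 - h%:R * x) <= 1.
  apply: (@le_trans _ _ ((1 + x) ^+ h * (1 - x) ^+ h)).
    by apply: ler_wpM2l => //; rewrite exprn_ge0 // addr_ge0.
  rewrite -exprMn exprn_ile1 //; first by rewrite mulr_ge0 ?subr_ge0 // ?addr_ge0 //; lra.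
  by have := sqr_ge0 x; rewrite expr2; nra.
have y0 : 0 <= h%:R * x by rewrite mulr_ge0.
set y := h%:R * x in hx y0 *; set z := (1 + x) ^+ h => zy.
have : z * (1 - y) <= (1 + 2 * y) * (1 - y) by apply: le_trans zy _; nra.
by rewrite ler_pM2r //; lra.
Qed.

(** Degree 4 is what [defect_small] consumes: the block bound carries a polynomial factor of degree
    3, and one more power makes it small. With [t = (1 - x) / 4] one has [x <= (1 - t) ^ 4], and
    [one_sub_exp_le] bounds [(1 - t) ^ h]. *)
Lemma geometric_small (R : realType) (x : R) : 0 <= x < 1 ->
  exists2 t : R, 0 < t <= 1 & forall h, x ^+ h <= (t * h.+1%:R) ^- 4.
Proof.
move=> /andP[x0 x1]; pose t := (1 - x) / 4; exists t; first by rewrite /t; apply/andP; split; lra.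
have t0 : 0 < t by rewrite /t; lra.
have t1 : t <= 1 by rewrite /t; lra.
move=> h; have x4 : x <= (1 - t) ^+ 4.
  have := @prod_one_sub_ge R 'I_4 xpredT (fun=> t).
  rewrite sumr_const prodr_const card_ord => H.
  have {H} : 1 - t *+ 4 <= (1 - t) ^+ 4 by apply: H => _; rewrite ltW.
  by apply: le_trans; rewrite /t -mulr_natr; lra.
have s0 : 0 <= 1 - t by rewrite subr_ge0.
apply: (@le_trans _ _ (((1 - t) ^+ h) ^+ 4)).
  by rewrite -exprM mulnC exprM; apply: lerXn2r; rewrite ?nnegrE ?exprn_ge0.
have p0 : 0 < t * h.+1%:R by rewrite mulr_gt0.
rewrite -exprVn; apply: lerXn2r; rewrite ?nnegrE ?exprn_ge0 ?invr_ge0 ?(ltW p0) //.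
have := one_sub_exp_le h (ltW t0) t1; rewrite -ler_pdivlMr; last first.
  by rewrite ltr_wpDr // mulr_ge0 // ltW.
rewrite div1r => h1; apply: le_trans h1 _; rewrite lef_pV2 ?posrE //; last first.
  by rewrite ltr_wpDr // mulr_ge0 // ltW.
by rewrite -natr1 mulrDr mulr1 [t * _]mulrC addrC lerD2r.
Qed.

Lemma bin_le_exp l j : ('C(l, j) <= l ^ j)%N.
Proof.
elim: j l => [|j IH] l; first by rewrite bin0.
case: l => [|l]; first by rewrite bin0n.
have e := mul_bin_diag l.+1 j; rewrite /= in e.
have : (j.+1 * 'C(l.+1, j.+1) <= l.+1 * l.+1 ^ j)%N.
  rewrite -e leq_mul2l /=; apply: leq_trans (IH l) _; case: j {IH e} => // j.
  by rewrite leq_exp2r.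
by rewrite -expnS; apply: leq_trans; rewrite mulSn leq_addr.
Qed.

(** By symmetry between [j] and [l + 1 - j] let [2 j <= l + 1]. Then
    ['C(l, l + 1 - j) = 'C(l, j - 1)] and [l + 1 - j >= l / 2], so the term is at most the [j]-th
    power of [l ^ 2 * x ^ (l / 2)], hence at most this number itself. The term [j = 0] is zero. *)
Lemma block_bound_le (R : realType) (x : R) l : 0 <= x <= 1 ->
  l%:R ^+ 2 * x ^+ l./2 <= 1 -> block_bound x l <= l.+1%:R * (l%:R ^+ 2 * x ^+ l./2).
Proof.
move=> /andP[x0 x1] small; set z := _ * x ^+ _ in small *.
have z0 : 0 <= z by rewrite mulr_ge0 ?exprn_ge0.
have half j : (0 < j)%N -> (j + j <= l.+1)%N ->
    'C(l, j)%:R * 'C(l, l.+1 - j)%:R * x ^+ (j * (l.+1 - j)) <= z.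
  move=> j0 jl; apply: (@le_trans _ _ (z ^+ j)); last first.
    by rewrite -[leRHS]expr1; apply: ler_wiXn2l.
  rewrite /z exprMn -!exprM; apply: ler_pM; rewrite ?mulr_ge0 ?exprn_ge0 //.
    rewrite -natrM -natrX ler_nat mul2n -addnn expnD leq_mul ?bin_le_exp //.
    rewrite -bin_sub; last by lia.
    rewrite (_ : l - (l.+1 - j) = j.-1)%N; last by lia.
    apply: leq_trans (bin_le_exp _ _) _; apply: leq_pexp2l; last exact: leq_pred.
    by lia.
  apply: ler_wiXn2l => //; rewrite mulnC leq_mul2l; apply/orP; right.
  have := half_leq (leqnn l); have := odd_double_half l; lia.
have -> : l.+1%:R * z = \sum_(j < l.+1) z by rewrite sumr_const card_ord mulr_natl.
rewrite /block_bound.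
apply: ler_sum => j _; have [->|j0] := posnP j; first by rewrite subn0 (@bin_small l l.+1) // mulr0 mul0r.
have [jl|jl] := leqP (j + j) l.+1; first exact: half.
have jl' := ltn_ord j.
have := half (l.+1 - j)%N; rewrite subKn; last exact: ltnW.
rewrite [X in X * _ <= _]mulrC [(_ * j)%N]mulnC; apply; lia.
Qed.

Lemma half_bounds l b : (b + b <= l)%N ->
  [/\ b <= l./2, l <= 2 * l./2.+1, l.+1 <= 2 * l./2.+1 & l./2 <= l]%N.
Proof. by have := odd_double_half l; case: odd => /=; split; lia. Qed.

Lemma defect_small (R : realType) (q e : R) : 0 < q <= 1 -> 0 < e ->
  exists l0, forall l, (l0 <= l)%N -> defect q l <= e.
Proof.
move=> /andP[q0 q1] e0; have x01 : 0 <= 1 - q < 1 by apply/andP; split; lra.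
have [t /andP[t0 t1] xt] := geometric_small x01.
have [B B0 BE] : exists2 B : R, 0 < B & B = 8 / t ^+ 4.
  by exists (8 / t ^+ 4); rewrite ?divr_gt0 ?exprn_gt0.
have Bq0 : 0 <= 2 * B / q / e by rewrite !divr_ge0 ?mulr_ge0 // ltW.
have Be0 : 0 <= 2 * B / e by rewrite divr_ge0 ?mulr_ge0 // ltW.
(* The three summands serve, in this order, the smallness condition of [block_bound_le], the term
   [(1 - q) ^ l / q], and the block bound. *)
pose b := Num.bound (B + 2 * B / q / e + 2 * B / e); exists (b + b)%N => l bl.
have [h hE] : exists h, l./2 = h by exists l./2.
have [hb lh lh1 hl] := half_bounds bl; rewrite hE in hb lh lh1 hl; set H : R := h.+1%:R.
have H0 : 0 < H by rewrite ltr0n.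
have H1 : 1 <= H by rewrite ler1n.
have hR : B + 2 * B / q / e + 2 * B / e <= H.
  apply: (@le_trans _ _ b%:R); last by rewrite ler_nat leqW.
  by apply/ltW/archi_boundP; rewrite !addr_ge0 // ltW.
have HB : B <= H by move: hR Bq0 Be0; lra.
have Hq : 2 * B <= H * (q * e).
  by rewrite -ler_pdivrMr ?mulr_gt0 // invfM mulrA; move: hR B0 Be0; lra.
have He : 2 * B <= H * e by rewrite -ler_pdivrMr //; move: hR B0 Bq0; lra.
have xh0 : 0 <= (1 - q) ^+ h by rewrite exprn_ge0 // subr_ge0.
have xB : (1 - q) ^+ h * H ^+ 4 <= B / 8.
  apply: (@le_trans _ _ ((t * H) ^- 4 * H ^+ 4)).
    by apply: ler_wpM2r; [rewrite exprn_ge0 // ltW | exact: xt].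
  rewrite le_eqVlt; apply/orP; left; apply/eqP; rewrite BE; field.
  by rewrite !lt0r_neq0.
set y := (1 - q) ^+ h in xh0 xB.
have lH : l%:R <= 2 * H.
  by rewrite /H -natrM ler_nat.
have lH1 : l.+1%:R <= 2 * H by rewrite /H -natrM ler_nat.
have z1 : l%:R ^+ 2 * y <= 4 * H ^+ 2 * y.
  apply: ler_wpM2r => //; rewrite (_ : 4 * H ^+ 2 = (2 * H) ^+ 2); last by ring.
  by apply: lerXn2r; rewrite ?nnegrE ?mulr_ge0 ?(ltW H0).
have yH m : (m <= 4)%N -> y * H ^+ m <= B / 8.
  move=> m4; apply: le_trans xB; apply: ler_wpM2l => //; exact: ler_weXn2l.
have z2 : l%:R ^+ 2 * y * H <= B / 2.
  apply: (@le_trans _ _ (4 * H ^+ 2 * y * H)).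
    by apply: ler_wpM2r => //; exact: ltW.
  have := yH 3%N isT => h3; rewrite (_ : 4 * H ^+ 2 * y * H = 4 * (y * H ^+ 3)); last by ring.
  by move: h3; lra.
have small : l%:R ^+ 2 * y <= 1.
  rewrite -(ler_pM2r H0) mul1r; apply: le_trans z2 _; move: HB B0; lra.
have q01 : 0 <= 1 - q <= 1 by rewrite subr_ge0 q1 gerBl ltW.
have bb : block_bound (1 - q) l <= l.+1%:R * (l%:R ^+ 2 * y).
  by have := block_bound_le q01 (l := l); rewrite hE; apply.
rewrite /defect; apply: (@le_trans _ _ (e / 2 + e / 2)); last by lra.
apply: lerD.
  rewrite ler_pdivrMr //; apply: (@le_trans _ _ y).
    by apply: ler_wiXn2l; rewrite ?subr_ge0 ?gerBl ?(ltW q0).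
  rewrite -(ler_pM2r H0); have := yH 1%N isT; rewrite expr1 => h1.
  apply: le_trans h1 _; rewrite (_ : e / 2 * q * H = H * (q * e) / 2); last by field.
  by move: Hq B0; lra.
apply: le_trans bb _.
apply: (@le_trans _ _ (2 * H * (l%:R ^+ 2 * y))).
  by apply: ler_wpM2r => //; rewrite mulr_ge0 // exprn_ge0.
have z3 : l%:R ^+ 2 * y * H ^+ 2 <= B / 2.
  apply: (@le_trans _ _ (4 * H ^+ 2 * y * H ^+ 2)).
    by apply: ler_wpM2r => //; rewrite exprn_ge0 // ltW.
  by rewrite (_ : 4 * H ^+ 2 * y * H ^+ 2 = 4 * (y * H ^+ 4)); [move: xB; lra | ring].
rewrite -(ler_pM2r H0) (_ : 2 * H * (l%:R ^+ 2 * y) * H = 2 * (l%:R ^+ 2 * y * H ^+ 2)); last by ring.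
by rewrite (_ : e / 2 * H = H * e / 2); [move: z3 He; lra | field].
Qed.

(* The largest l with l! <= N: it tends to infinity while l! stays polynomial. *)
Definition cutoff (N : nat) : nat := \max_(l < N.+1 | (l`! <= N)%N) l.

Lemma cutoff_leq N : (cutoff N <= N)%N.
Proof. by apply/bigmax_leqP => l _; rewrite -ltnS. Qed.

Lemma cutoff_fact N : (0 < N)%N -> ((cutoff N)`! <= N)%N.
Proof.
move=> N0; have c0 : (0 < #|[pred l : 'I_N.+1 | (l`! <= N)%N]|)%N.
  by apply/card_gt0P; exists ord0; rewrite inE.
rewrite /cutoff; have [l] := eq_bigmax_cond (fun l : 'I_N.+1 => l : nat) c0.
by rewrite inE => lN ->.
Qed.

Lemma cutoff_ge l N : (l`! <= N)%N -> (l <= cutoff N)%N.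
Proof.
move=> lN; have lt : (l < N.+1)%N.
  by rewrite ltnS; apply: leq_trans lN; elim: l => // [[|l]] // IH; rewrite factS mulSn; have := fact_gt0 l.+1; nia.
exact: (leq_bigmax_cond (Ordinal lt)).
Qed.

(** * Number of trials and failure probability *)

Section Assembly.

Variables (R : realType) (p : R) (K : nat).
Hypothesis hp : 0 < p < 1.

Let p01 : 0 < p <= 1.
Proof. by have /andP[-> /ltW] := hp. Qed.

(** One exponent for both uses of [prod_harmonic_le]: it dominates the [3 / p ^ k] of the squared
    weights, hence also the [1 / p ^ k] of the second moment of the estimate. *)
Definition slack : nat := Num.bound (3 / p ^+ K).

Lemma slack_ge k : (k <= K)%N -> 3 / p ^+ k <= slack%:R.
Proof.
move=> kK; have /andP[p0 p1] := p01.
apply: (@le_trans _ _ (3 / p ^+ K)).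
  rewrite ler_pM2l // lef_pV2 ?posrE ?exprn_gt0 //; apply: ler_wiXn2l => //; exact: ltW.
by apply/ltW/archi_boundP; rewrite divr_ge0 // exprn_ge0 // ltW.
Qed.

(** With [S = slack] and [n >= 2]: [8 * 16 <= n ^ 7] for the constants of Chebyshev and of
    [mean_typical], 3 for [N ^ 3], [2 S K] and [2 K + 4 S K] for the two remaining factors, and 1 to
    let Chebyshev fail with probability at most [1 / n]. *)
Definition trials_degree : nat := (11 + 6 * slack * K + 2 * K)%N.

(* [3 / N%:R]: one third for each of two Markov inequalities and for Chebyshev's. *)
Definition failure (N : nat) : R := 2 * K%:R * defect (p ^+ K) (cutoff N) + 3 / N%:R.

(** The sum over [k] makes the bound uniform in [k]. The first summand makes the claim trivial for
    [n < 2], where powers of [n] cannot absorb constants. *)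
Definition delta (n : nat) : R := (n < 2)%N%:R + \sum_(k < K.+1 | (0 < k)%N) failure (n %/ k).

Lemma failure_ge0 N : 0 <= failure N.
Proof.
have /andP[p0 p1] := p01; have pK0 : 0 < p ^+ K by rewrite exprn_gt0.
have pK1 : p ^+ K <= 1 by rewrite exprn_ile1 // ltW.
have x0 : 0 <= 1 - p ^+ K by rewrite subr_ge0.
apply: addr_ge0; last by rewrite divr_ge0.
rewrite !mulr_ge0 //; apply: addr_ge0; first by rewrite divr_ge0 ?exprn_ge0 // ltW.
by apply: sumr_ge0 => j _; rewrite !mulr_ge0 // exprn_ge0.
Qed.

Lemma failure_small e : 0 < e -> exists N1, forall N, (N1 <= N)%N -> failure N <= e.
Proof.
move=> e0; have /andP[p0 p1] := p01; have pK0 : 0 < p ^+ K <= 1.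
  by rewrite exprn_gt0 // exprn_ile1 // ltW.
pose e' := e / (4 * K.+1%:R); have e'0 : 0 < e' by rewrite divr_gt0 // mulr_gt0.
have [l0 small] := defect_small pK0 e'0.
pose b := Num.bound (6 / e); exists (maxn l0`! b.+1) => N; rewrite geq_max => /andP[lN bN].
have N0 : (0 < N)%N by exact: leq_trans bN.
have d := small _ (cutoff_ge lN).
rewrite /failure (_ : e = e / 2 + e / 2); last by field.
apply: lerD.
  apply: (@le_trans _ _ (2 * K%:R * e')).
    by apply: ler_wpM2l => //; rewrite mulr_ge0.
  rewrite /e' (_ : 2 * K%:R * (e / (4 * K.+1%:R)) = e / 2 * (K%:R / K.+1%:R)); last first.
    by field; rewrite nat1r pnatr_eq0.
  by rewrite ler_piMr ?divr_ge0 ?(ltW e0) // ler_pdivrMr // mul1r ler_nat.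
rewrite ler_pdivrMr ?ltr0n // mulrAC ler_pdivlMr // (_ : 3 * 2 = 6); last by ring.
rewrite -ler_pdivrMl // mulrC; apply: (@le_trans _ _ b%:R); last by rewrite ler_nat ltnW.
by apply/ltW/archi_boundP; rewrite divr_ge0 // ltW.
Qed.

Lemma delta_cvg0 : (delta n @[n --> \oo] --> (0 : R))%classic.
Proof.
apply/cvgrPdist_le => e e0.
have e'0 : 0 < e / K.+1%:R by rewrite divr_gt0.
have [N1 small] := failure_small e'0.
exists (maxn 2 (N1.+1 * K.+1))%N => // n /=; rewrite geq_max => /andP[n2 nN].
rewrite sub0r normrN /delta ltnNge n2 /= add0r ger0_norm; last first.
  by apply: sumr_ge0 => k _; exact: failure_ge0.
apply: (@le_trans _ _ (\sum_(k < K.+1) e / K.+1%:R)); last first.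
  by rewrite sumr_const card_ord -[leLHS]mulr_natr divfK // pnatr_eq0.
rewrite big_mkcond; apply: ler_sum => k _; case: ifP => [k0|_]; last exact: ltW.
apply: small; rewrite leq_divRL //; apply: leq_trans nN.
by rewrite leq_mul // ltnW // ltn_ord.
Qed.

Lemma failure_le_delta n k : (0 < k <= K)%N -> failure (n %/ k) <= delta n.
Proof.
move=> /andP[k0 kK]; have kK1 : (k < K.+1)%N by rewrite ltnS.
rewrite /delta (bigD1 (Ordinal kK1)) //= addrCA lerDl addr_ge0 //.
by apply: sumr_ge0 => j _; exact: failure_ge0.
Qed.

Lemma weight_bound n N k : (1 < n)%N -> n = (k * N)%N -> (0 < N)%N -> (k <= K)%N ->
  8 * (16 * N%:R ^+ 3 * (N.+1%:R ^+ slack) ^+ k *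
    (((cutoff N)`!%:R * N.+1%:R ^+ slack) ^+ k) ^+ 2) * n%:R <= n%:R ^+ trials_degree :> R.
Proof.
move=> n1 nkN N0 kK.
have k0 : (0 < k)%N by case: k nkN {kK} => // e; rewrite e mul0n in n1.
have Nn : (N <= n)%N by rewrite nkN leq_pmull.
have n0 : (0 < n)%N by exact: ltnW.
rewrite -!(natrX, natrM) ler_nat.
have N1 : (N.+1 <= n ^ 2)%N by apply: (@leq_trans n.+1); nia.
have e7 : (8 * 16 <= n ^ 7)%N by rewrite (_ : 8 * 16 = 2 ^ 7)%N // leq_exp2r.
have e3 : (N ^ 3 <= n ^ 3)%N by rewrite leq_exp2r.
have eS : (N.+1 ^ slack <= n ^ (2 * slack))%N.
  by rewrite expnM; case: slack => // s; rewrite leq_exp2r.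
have ek (a c : nat) : (a <= n ^ c -> a ^ k <= n ^ (c * K))%N.
  move=> ac; apply: (@leq_trans ((n ^ c) ^ k)); last by rewrite -expnM leq_pexp2l // leq_mul2l kK orbT.
  by case: k {nkN kK k0} => // k; rewrite leq_exp2r.
have eT : ((cutoff N)`! * N.+1 ^ slack <= n ^ (1 + 2 * slack))%N.
  by rewrite expnD expn1 leq_mul // (leq_trans (cutoff_fact N0)).
have e1 := ek _ _ eS; have e2 := ek _ _ eT.
have e2' : ((((cutoff N)`! * N.+1 ^ slack) ^ k) ^ 2 <= n ^ ((1 + 2 * slack) * K * 2))%N.
  by rewrite [in leqRHS]expnM leq_exp2r.
have -> : (n ^ trials_degree = n ^ 7 * (n ^ 3) * n ^ (2 * slack * K) * n ^ ((1 + 2 * slack) * K * 2) * n)%N.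
  by rewrite -!expnD -expnSr; congr (_ ^ _)%N; rewrite /trials_degree; nia.
have assoc (a b c d : nat) : (8 * (16 * a * b * c) * d = 8 * 16 * a * b * c * d)%N.
  by rewrite !mulnA.
rewrite assoc; exact: (leq_mul (leq_mul (leq_mul (leq_mul e7 e3) e1) e2') (leqnn n)).
Qed.

End Assembly.

Lemma accuracy_gt0 (R : realType) (eps : R) : 0 < eps -> (0 < accuracy eps)%N.
Proof.
by move=> e0; rewrite /accuracy absz_gt0 gt_eqF // ceil_gt0 invr_gt0.
Qed.

Lemma accuracy_ge (R : realType) (eps : R) : 0 < eps -> (accuracy eps)%:R^-1 <= eps.
Proof.
move=> e0; rewrite -[leRHS]invrK lef_pV2 ?posrE ?invr_gt0 ?ltr0n ?accuracy_gt0 //.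
rewrite /accuracy natr_absz ger0_norm; first exact: ceil_ge.
by apply: ltW; rewrite ceil_gt0 invr_gt0.
Qed.

Definition adjacent (n k m : nat) (G : {set {set 'I_n}}) (a c : nat) : bool :=
  input k m G 1 (a * n + c)%N != 0%N.

Lemma adjacentE n k m (G : {set {set 'I_n}}) (u v : 'I_n) :
  adjacent k m G u v = ([set u; v] \in G).
Proof.
rewrite /adjacent /= eqb0 negbK; apply/existsP/idP => [[u' /existsP[v' /andP[/eqP e uvG]]]|uvG].
  have n0 : (0 < n)%N by exact: leq_ltn_trans (ltn_ord u).
  move: e; rewrite [(n * _)%N]mulnC => e.
  have eu : u = u'.
    by apply: val_inj; have := congr1 (divn^~ n) e; rewrite !divnMDl // !divn_small // !addn0.
  have ev : v = v'.
    by apply: val_inj; have := congr1 (modn^~ n) e; rewrite !modnMDl !modn_small.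
  by rewrite eu ev.
by exists u; apply/existsP; exists v; rewrite uvG andbT mulnC.
Qed.

(** * Success of the program on a random graph *)

Section Final.

Variables (R : realType) (p : R) (K : nat).
Hypothesis hp : 0 < p < 1.

Lemma run_main k n m (G : {set {set 'I_n}}) t w : (0 < k)%N -> (k %| n)%N ->
  (main_time (trials_degree p K) n k m <= t)%N ->
  let c := run (Main (trials_degree p K)) (input k m G) w t in
  let N := (n %/ k)%N in let T := trials (trials_degree p K) n m in
  halted c /\ answer R c =
    (sums n N (nbits n m) (adjacent k m G) T w)%:R / (N`! * (N`! ^ k * (k`! ^ N * T)))%:R.
Proof.
move=> k0 kn le c N T; have [M1 [w1 [t1 [big le1 [e0 e1]]]]] :=
  @runs_main (trials_degree p K) n k m (input k m G) w erefl erefl erefl k0 kn.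
rewrite /c (run_bigstep big (leq_trans le1 le)); split=> //.
by rewrite /answer /= e0 e1.
Qed.

Lemma estimate_success k n eps (G : {set {set 'I_n}}) t :
  (1 < n)%N -> (0 < k <= K)%N -> (k %| n)%N -> 0 < eps ->
  let m := accuracy eps in let N := (n %/ k)%N in let T := trials (trials_degree p K) n m in
  (T * (n * (nbits n m + nbits n m)) <= t)%N ->
  typical N k (16 * N%:R ^+ 3 * (N.+1%:R ^+ slack p K) ^+ k *
    (((cutoff N)`!%:R * N.+1%:R ^+ slack p K) ^+ k) ^+ 2 : R) G ->
  1 - n%:R^-1 <= cmean t (fun w => ((`|(sums n N (nbits n m) (adjacent k m G) T w)%:R / T%:R -
     leaves R N k G| <= eps * leaves R N k G)%R)%:R) :> R.
Proof.
move=> n1 /andP[k0 kK] kn eps0 m N T tT /andP[L0 Mh].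
have n0 : (0 < n)%N by exact: ltnW.
have N0 : (0 < N)%N by rewrite divn_gt0 // dvdn_leq.
have nkN : n = (k * N)%N by rewrite mulnC divnK.
have m0 : (0 < m)%N by exact: accuracy_gt0.
have nR : 0 < n%:R :> R by rewrite ltr0n.
have mR : 0 < m%:R :> R by rewrite ltr0n.
have gG := @adjacentE n k m G.
have eL := tree_leaves R nkN N0 gG; have eM := tree_leaf_weight R nkN N0 gG.
set b := nbits n m; set x : R := n%:R / 2 ^+ b.
have U : (8 * n ^ 2 * m)%:R <= 2 ^+ b :> R.
  by rewrite -natrX ler_nat (leq_trans _ (up_logP _ (ltnSn 1))) // /bound mulnC [(8 * _)%N]mulnC.
have U0 : 0 < 2 ^+ b :> R by rewrite exprn_gt0.
have x0 : 0 <= x by rewrite divr_ge0 // ltW.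
(* The 8 in [bound] is spent here: [2 n ^ 2 / 2 ^ b <= 2 n ^ 2 / (8 n ^ 2 m)]. *)
have nx : (n + n)%:R * x <= (4 * m%:R)^-1.
  rewrite /x mulrA ler_pdivrMr // ler_pdivlMl ?mulr_gt0 //.
  apply: le_trans U; rewrite -!natrM ler_nat.
  nia.
have im : (m%:R)^-1 <= 1 :> R by rewrite invf_le1 // ler1n.
have i4 : (4 * m%:R)^-1 = m%:R^-1 / 4 :> R by rewrite invfM mulrC.
have half : (n + n)%:R * x <= 2^-1 by apply: le_trans nx _; rewrite i4; lra.
have [hi lo] := one_add_exp_le x0 half.
have x1 : x <= 1.
  apply: (@le_trans _ _ ((n + n)%:R * x)); last by apply: le_trans half _; lra.
  by rewrite ler_peMl // ler1n addn_gt0 n0.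
have am := accuracy_ge eps0; rewrite -/m in am.
(* Twice [1 / (4 m)], because [one_add_exp_le] doubles the exponent times [x]; it is at most
   [eps / 2]. *)
pose eta : R := m%:R^-1 / 2.
have T0 : (0 < T)%N by rewrite /T /trials muln_gt0 !expn_gt0 m0 n0.
have main := @cmean_sums_success R n N b (adjacent k m G) T t eta eps.
rewrite eL eM in main; apply: le_trans (main _ x1 _ _ eps0 _ _ T0 tT L0).
- rewrite lerD2l lerN2.
  have TR : 0 < T%:R :> R by rewrite ltr0n.
  set L := leaves R N k G in L0 Mh *; set M := leaf_weight R N k G in Mh *.
  rewrite ler_pdivrMr ?mulr_gt0 ?exprn_gt0 //.
  have W := @weight_bound R p K hp n N k n1 nkN N0 kK.
  move: Mh W; set C := 16 * _ * _ * _ => Mh W.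
  apply: (@le_trans _ _ (8 * (C * L ^+ 2))); first by rewrite ler_pM2l.
  have TE : T%:R = m%:R ^+ 2 * n%:R ^+ trials_degree p K :> R by rewrite /T /trials natrM !natrX.
  rewrite TE; have me : 1 <= m%:R ^+ 2 * eps ^+ 2.
    rewrite -exprMn exprn_ege1 // -ler_pdivrMl // mulr1; exact: am.
  rewrite (_ : n%:R^-1 * _ = (m%:R ^+ 2 * eps ^+ 2) * (n%:R ^+ trials_degree p K / n%:R * L ^+ 2)); last first.
    by field; rewrite lt0r_neq0.
  apply: (@le_trans _ _ (n%:R ^+ trials_degree p K / n%:R * L ^+ 2)).
    rewrite mulrA; apply: ler_wpM2r; first exact: sqr_ge0.
    by rewrite ler_pdivlMr.
  by rewrite ler_peMl // mulr_ge0 ?sqr_ge0 // divr_ge0 // ltW // exprn_gt0.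
- exact: leq_div.
- by apply: le_trans hi _; rewrite lerD2l /eta; move: nx; rewrite i4; lra.
- by apply: le_trans lo; rewrite lerD2l lerN2 /eta; move: nx im; rewrite i4; have : 0 < m%:R^-1 :> R by [rewrite invr_gt0]; lra.
- by rewrite /eta; lra.
- by rewrite /eta; lra.
Qed.

Lemma success_prob_ge k n eps t : (0 < k <= K)%N -> (k %| n)%N -> 0 < eps ->
  (main_time (trials_degree p K) n k (accuracy eps) + trials (trials_degree p K) n (accuracy eps) *
     (n * (nbits n (accuracy eps) + nbits n (accuracy eps))) <= t)%N ->
  1 - delta p K n <= success_prob p (Main (trials_degree p K)) t k eps (@num_clique_covers k n).
Proof.
move=> kK kn eps0 tT; have /andP[p0 p1] := hp.
have p01 : 0 < p <= 1 by rewrite p0 ltW.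
have p01' : 0 <= p <= 1 by rewrite !ltW.
set m := accuracy eps in tT *.
have /andP[k0 kK'] := kK.
have spE : success_prob p (Main (trials_degree p K)) t k eps (@num_clique_covers k n) =
    bmean p (pairs n) (fun G => cmean t (fun w =>
      let c := run (Main (trials_degree p K)) (input k m G) w t in
      (halted c && (`|answer R c - (num_clique_covers k G)%:R| <= eps * (num_clique_covers k G)%:R))%:R)).
  apply: eq_bigr => G _; congr (_ * _); rewrite cmeanE; congr (_ / _).
  rewrite -sum1_card natr_sum big_mkcond; apply: eq_bigr => w _.
  by rewrite inE /=; case: (_ && _).
rewrite spE.
have ind_ge0 (G : {set {set 'I_n}}) : 0 <= cmean t (fun w =>
      let c := run (Main (trials_degree p K)) (input k m G) w t in
      (halted c && (`|answer R c - (num_clique_covers k G)%:R| <= eps * (num_clique_covers k G)%:R))%:R) :> R.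
  by apply: cmean_ge0.
have [n1|n1] := ltnP n 2.
  apply: (@le_trans _ _ 0).
    by rewrite /delta n1 subr_le0 lerDl sumr_ge0 // => j _; exact: failure_ge0.
  by rewrite -(bmean_const p (pairs n) (0 : R)); apply: bmean_le.
set N := (n %/ k)%N.
have n0 : (0 < n)%N by exact: ltnW.
have N0 : (0 < N)%N by rewrite divn_gt0 // dvdn_leq.
have nkN : n = (k * N)%N by rewrite mulnC divnK.
have NR : 0 < N%:R :> R by rewrite ltr0n.
have nR : 0 < n%:R :> R by rewrite ltr0n.
have nN : n%:R^-1 <= N%:R^-1 :> R by rewrite lef_pV2 ?posrE // ler_nat leq_div.
have in1 : n%:R^-1 <= 1 :> R by rewrite invf_le1 // ler1n.
have [C CE] : exists C : R, C = 16 * N%:R ^+ 3 * (N.+1%:R ^+ slack p K) ^+ k *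
    (((cutoff N)`!%:R * N.+1%:R ^+ slack p K) ^+ k) ^+ 2 by eexists.
have typ := @mean_typical R n N k nkN N0 p (cutoff N) (slack p K) p01 (cutoff_leq N) (slack_ge hp kK') C CE.
(* Chebyshev on a typical graph loses [1 / n <= 1 / N], the last third of [3 / N] in [failure]. *)
apply: (@le_trans _ _ (bmean p (pairs n) (fun G => (1 - n%:R^-1) * (typical N k C G)%:R))).
  rewrite bmeanZ; set P := bmean p (pairs n) _ in typ *.
  have P1 : P <= 1.
    rewrite -[leRHS](bmean_const p (pairs n)); apply: bmean_le => // G _.
    by rewrite lern1 leq_b1.
  have i0 : 0 <= n%:R^-1 :> R by rewrite invr_ge0.
  have PP : P - n%:R^-1 <= (1 - n%:R^-1) * P.
    have : n%:R^-1 * P <= n%:R^-1 by rewrite ler_piMr.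
    by rewrite mulrBl mul1r; lra.
  apply: le_trans PP; have fd := @failure_le_delta R p K hp n k kK.
  rewrite -/N /failure in fd.
  have dk : k%:R * defect (p ^+ k) (cutoff N) <= K%:R * defect (p ^+ K) (cutoff N).
    have dd : defect (p ^+ k) (cutoff N) <= defect (p ^+ K) (cutoff N).
      apply: le_defect; first by rewrite exprn_gt0.
        by apply: ler_wiXn2l; rewrite ?(ltW p0) ?(ltW p1).
      by rewrite exprn_ile1 // ltW.
    apply: ler_pM => //; last by rewrite ler_nat.
    have q1 : p ^+ k <= 1 by rewrite exprn_ile1 // ltW.
    have q0 : 0 < p ^+ k by rewrite exprn_gt0.
    apply: addr_ge0; first by rewrite divr_ge0 ?exprn_ge0 ?subr_ge0 // ltW.
    by apply: sumr_ge0 => j _; rewrite !mulr_ge0 // exprn_ge0 // subr_ge0.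
  by move: typ fd dk nN; rewrite -!mulrA; lra.
apply: bmean_le => // G _.
have [typG|_] := boolP (typical N k C G); last by rewrite mulr0.
rewrite mulr1; rewrite CE in typG.
have tT2 : (trials (trials_degree p K) n m * (n * (nbits n m + nbits n m)) <= t)%N.
  by apply: leq_trans tT; rewrite leq_addl.
apply: le_trans (estimate_success n1 kK kn eps0 tT2 typG) _.
apply: cmean_le => w _ /=.
have tT1 : (main_time (trials_degree p K) n k m <= t)%N.
  by apply: leq_trans tT; rewrite leq_addr.
have [-> ->] := @run_main k n m G t w k0 kn tT1.
rewrite /= ler_nat -/N; set T := trials _ n m; set S := sums _ _ _ _ _ _.
set Q := (N`! * (N`! ^ k * k`! ^ N))%N; set Y := num_clique_covers k G.
have LE : leaves R N k G = Q%:R * Y%:R by rewrite (leaves_covers G nkN N0 k0) natrM.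
have Q0 : 0 < Q%:R :> R by rewrite ltr0n /Q !muln_gt0 !expn_gt0 !fact_gt0.
have T0 : 0 < T%:R :> R by rewrite ltr0n /T /trials muln_gt0 !expn_gt0 accuracy_gt0 // n0.
have -> : (N`! * (N`! ^ k * (k`! ^ N * T)))%N = (Q * T)%N by rewrite /Q !mulnA.
rewrite LE natrM.
(* The number of leaves and its estimate are both [Q] times the number of covers and the answer, so
   the relative errors agree. *)
have -> : S%:R / T%:R - Q%:R * Y%:R = Q%:R * (S%:R / (Q%:R * T%:R) - Y%:R) :> R.
  by field; rewrite !lt0r_neq0.
by rewrite normrM (gtr0_norm Q0) mulrCA ler_pM2l.
Qed.

End Final.

(** The program depends on [p] and [K] only through the exponent [trials_degree]. Halting needs no
    randomness: the time bound of [runs_main] holds for every graph and all coins. *)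
Theorem theorem3 (R : realType) (p : R) (hp : 0 < p < 1) (K : nat) :
  exists A : prog, fpras p K num_clique_covers A.
Proof.
exists (Main (trials_degree p K)).
have [C [d time]] := main_time_poly (trials_degree p K) K.
exists C, d, (delta p K); split; first exact: delta_cvg0.
move=> k n eps kK kn eps0 t; have /andP[k0 kK'] := kK.
have m0 := accuracy_gt0 eps0; have le := time n k _ m0 kK'.
split=> [G w _|]; last exact: success_prob_ge.
by have [] := @run_main R p K k n (accuracy eps) G t w k0 kn (leq_trans (leq_addr _ _) le).
Qed.
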